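(* Let $f\in\mathcal{S}$ and $\lambda\in(0,1]$. Then the function $z\mapsto f(rz)/r$ belongs to $\mathcal{M}(\lambda)$ for $0<r\leq r_0$, where $r_0\in(0,1)$ is the smallest root in $(0,1)$ of the equation $$r^4(r^4+4r^2+1)-\lambda^2(1-r^2)^4=0.$$
   Context: $\mathbb{D}=\{z\in\mathbb{C}:|z|<1\}$. $\mathcal{A}$ is the family of functions $f$ analytic in $\mathbb{D}$ with $f(0)=0$ and $f'(0)=1$. $\mathcal{S}$ is the set of $f\in\mathcal{A}$ that are univalent (injective) in $\mathbb{D}$. For $\lambda>0$, $\mathcal{M}(\lambda)$ is the class of $f\in\mathcal{A}$ (with $f(z)\neq 0$ for $z\in\mathbb{D}\setminus\{0\}$, so that $z/f(z)$ is analytic in $\mathbb{D}$ with value $1$ at $0$) such that $$\left|z^2\left(\frac{z}{f(z)}\right)''+f'(z)\left(\frac{z}{f(z)}\right)^2-1\right|\leq\lambda\quad\text{for all } z\in\mathbb{D}.$$ *)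

(* Defs.v *)
From Stdlib Require Import Reals.
From Coquelicot Require Import Coquelicot.

Definition in_disk (z : C) : Prop := (Cmod z < 1)%R.

(* Functions on the disk are represented by total functions [C -> C]; their
   values outside the open disk are irrelevant to everything below. *)
Definition analytic_in_disk (f : C -> C) : Prop :=
  forall z : C, in_disk z -> @ex_derive C_AbsRing C_NormedModule f z.

Definition class_A (f : C -> C) : Prop :=
  analytic_in_disk f /\ f (RtoC 0) = RtoC 0 /\ C_derive f (RtoC 0) = RtoC 1.

Definition class_S (f : C -> C) : Prop :=
  class_A f /\
  forall z w : C, in_disk z -> in_disk w -> f z = f w -> z = w.

(* [z / f z], with its removable singularity at [0] filled in by the value
   [1 = 1 / f'(0)] that it takes for [f] in [class_A]. *)
Definition z_over (f : C -> C) (z : C) : C :=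
  if Ceq_dec z (RtoC 0) then RtoC 1 else (z / f z)%C.

(* [C_derive] is total; for [f] satisfying the first two clauses, [z_over f]
   is analytic in the disk, so both derivatives of it exist there. *)
Definition class_M (lambda : R) (f : C -> C) : Prop :=
  class_A f /\
  (forall z : C, in_disk z -> z <> RtoC 0 -> f z <> RtoC 0) /\
  (forall z : C, in_disk z ->
     (Cmod (z ^ 2 * C_derive (C_derive (z_over f)) z
            + C_derive f z * (z_over f z) ^ 2 - 1)%C <= lambda)%R).

Definition is_root_in_01 (lambda r : R) : Prop :=
  (0 < r < 1 /\
   r ^ 4 * (r ^ 4 + 4 * r ^ 2 + 1) - lambda ^ 2 * (1 - r ^ 2) ^ 4 = 0)%R.

Definition is_smallest_root_in_01 (lambda r0 : R) : Prop :=
  is_root_in_01 lambda r0 /\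
  forall s : R, is_root_in_01 lambda s -> (r0 <= s)%R.

(* Main.v *)
Require Import Defs.
From Stdlib Require Import Reals Lra Lia Psatz ClassicalEpsilon.
From Coquelicot Require Import Coquelicot.
Local Open Scope R_scope.

(** Write [z / f z = sum b_n z^n]. Since [f' (z/f)^2 = z/f - z (z/f)'], the expression bounded in
    the class M is [sum_(n >= 2) (n-1)^2 b_n z^n], and the area theorem
    [sum (n-1) |b_n|^2 <= 1] together with [sum k^3 x^(k+1) = x^2 (1 + 4x + x^2) / (1-x)^4] at
    [x = r^2] gives the bound by Cauchy-Schwarz.

    The area theorem is obtained without computing areas. With [h = 1/f], the kernel
    [-log |h z - h w|] is positive definite on weights of total mass zero, and
    [log |h z - h w| = log |1/z - 1/w| + Re L(z, w)] where [L] is holomorphic in both variables because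
    [f] is univalent. Testing against the weight [e^(-it) + sum Y_l e^(ilt)] on a circle, in which all
    terms of [L] cancel except those linear in [Y], and optimising [Y] yields the inequality. The
    logarithmic singularity is handled by a discretisation at the [N]-th roots of unity with the
    regularised kernel [-log (|w|^2 + e)]; one lets [N] tend to infinity first, [e] to [0] next.

    Power series expansions come from Goursat's theorem for rectangles in the logarithmic plane:
    the mean of a holomorphic function over a circle does not depend on the radius. *)

(** Three choices make the positivity argument computable. The regulariser is
    [e = (1 - rho)^2 / (rho r^2)]: after scaling, [|u - v|^2 + (1 - rho)^2 / rho] equals
    [|1 - rho conj(v) u|^2 / rho] on the unit circle, and minus the logarithm of the numerator has
    the explicit Fourier coefficients [rho^n / n]. The factor [exp (2 Re L)] does not multiply the
    regulariser; the resulting defect is dominated by a Poisson kernel scaled to mean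
    [(1 - rho) / (1 + rho)], which vanishes as [rho] tends to 1. The optimal [Y] turns positivity
    into [0 <= 1 + S - 2 S] up to these errors, with [S] the area sum. No complex logarithm is
    taken: [L] is the antiderivative of the logarithmic derivative of [quot], and only
    [|quot| = exp (Re L)] is used. It is expanded in [z] with coefficients depending on [w]; the
    dependence on [w] enters through symmetry and the absence of negative frequencies. Since the
    sequences involved change with the node and with [N], the estimates are uniform over all
    sequences obeying one Cauchy bound. *)

(** * Continuity and complex differentiability *)

Definition ccont (f : C -> C) (z : C) : Prop :=
  forall eps, 0 < eps -> exists d, 0 < d /\
    forall w, Cmod (w - z) < d -> Cmod (f w - f z) < eps.

Definition cder (f : C -> C) (z l : C) : Prop :=
  forall eps, 0 < eps -> exists d, 0 < d /\
    forall w, Cmod (w - z) < d ->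
      Cmod (f w - f z - (w - z) * l) <= eps * Cmod (w - z).

Lemma Cmod_sub_sym z w : Cmod (z - w) = Cmod (w - z).
Proof.
rewrite <- Cmod_opp. f_equal. ring.
Qed.

Lemma Cmod_le_sub z w : Cmod z <= Cmod w + Cmod (z - w).
Proof.
replace z with (w + (z - w))%C at 1 by ring. apply Cmod_triangle.
Qed.

Lemma Cmod_sub_le z w : Cmod (z - w) <= Cmod z + Cmod w.
Proof.
unfold Cminus. rewrite <- (Cmod_opp w). apply Cmod_triangle.
Qed.

Lemma Cmod_sub_triangle x y z : Cmod (x - z) <= Cmod (x - y) + Cmod (y - z).
Proof.
replace (x - z)%C with ((x - y) + (y - z))%C by ring. apply Cmod_triangle.
Qed.

Lemma Csub_neq0 (z w : C) : z <> w -> (z - w)%C <> 0.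
Proof.
intros H E. apply H. replace z with ((z - w) + w)%C by ring. rewrite E. ring.
Qed.

Lemma Cmod_self z : Cmod (z - z) = 0.
Proof.
replace (z - z)%C with (RtoC 0) by ring. apply Cmod_0.
Qed.

Lemma is_derive_C_iff (f : C -> C) (z l : C) :
  @is_derive C_AbsRing C_NormedModule f z l <-> cder f z l.
Proof.
split.
- intros [_ H] eps Heps.
  destruct (H z (fun P HP => HP) (mkposreal eps Heps)) as [d Hd].
  exists d. split; [apply cond_pos|]. intros w Hw. exact (Hd w Hw).
- intros H. split; [apply is_linear_scal_l|].
  intros x Hx. rewrite <- (is_filter_lim_locally_unique _ _ Hx).
  intros eps. destruct (H eps (cond_pos eps)) as [d [Hd0 Hd]].
  exists (mkposreal d Hd0). intros w Hw. exact (Hd w Hw).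
Qed.

Lemma ccont_ext_loc f g z d :
  0 < d -> (forall w, Cmod (w - z) < d -> f w = g w) -> ccont f z -> ccont g z.
Proof.
intros Hd Hfg Hf eps Heps. destruct (Hf eps Heps) as [d' [Hd' H]].
exists (Rmin d d'). split; [now apply Rmin_pos|]. intros w Hw.
rewrite <- !Hfg.
- apply H. apply Rlt_le_trans with (1 := Hw), Rmin_r.
- rewrite Cmod_self; lra.
- apply Rlt_le_trans with (1 := Hw), Rmin_l.
Qed.

Lemma ccont_const c z : ccont (fun _ => c) z.
Proof.
intros eps Heps. exists 1. split; [lra|]. intros w _.
rewrite Cmod_self; lra.
Qed.

Lemma ccont_id z : ccont (fun w => w) z.
Proof. intros eps Heps. exists eps. auto. Qed.

Lemma ccont_plus f g z :
  ccont f z -> ccont g z -> ccont (fun w => f w + g w)%C z.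
Proof.
intros Hf Hg eps Heps.
destruct (Hf (eps/2)) as [d1 [Hd1 H1]]; [lra|].
destruct (Hg (eps/2)) as [d2 [Hd2 H2]]; [lra|].
exists (Rmin d1 d2). split; [now apply Rmin_pos|]. intros w Hw.
pose proof (H1 w (Rlt_le_trans _ _ _ Hw (Rmin_l _ _))).
pose proof (H2 w (Rlt_le_trans _ _ _ Hw (Rmin_r _ _))).
replace (f w + g w - (f z + g z))%C with ((f w - f z) + (g w - g z))%C by ring.
eapply Rle_lt_trans; [apply Cmod_triangle|]. lra.
Qed.

Lemma ccont_mult f g z :
  ccont f z -> ccont g z -> ccont (fun w => f w * g w)%C z.
Proof.
intros Hf Hg eps Heps.
set (A := Cmod (f z)). set (B := Cmod (g z)).
assert (HA : 0 <= A) by apply Cmod_ge_0. assert (HB : 0 <= B) by apply Cmod_ge_0.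
set (e := Rmin 1 (eps / (A + B + 2))).
assert (He : 0 < e).
{ apply Rmin_pos; [lra|]. apply Rdiv_lt_0_compat; lra. }
destruct (Hf e He) as [d1 [Hd1 H1]]. destruct (Hg e He) as [d2 [Hd2 H2]].
exists (Rmin d1 d2). split; [now apply Rmin_pos|]. intros w Hw.
pose proof (H1 w (Rlt_le_trans _ _ _ Hw (Rmin_l _ _))) as K1.
pose proof (H2 w (Rlt_le_trans _ _ _ Hw (Rmin_r _ _))) as K2.
replace (f w * g w - f z * g z)%C
  with ((f w - f z) * (g w - g z) + ((f w - f z) * g z + f z * (g w - g z)))%C by ring.
eapply Rle_lt_trans; [apply Cmod_triangle|].
eapply Rle_lt_trans; [apply Rplus_le_compat_l, Cmod_triangle|].
rewrite !Cmod_mult. fold A B.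
pose proof (Cmod_ge_0 (f w - f z)). pose proof (Cmod_ge_0 (g w - g z)).
assert (E1 : e <= 1) by apply Rmin_l.
assert (E2 : e * (A + B + 2) <= eps).
{ apply Rle_trans with (eps / (A + B + 2) * (A + B + 2)).
  - apply Rmult_le_compat_r; [lra|apply Rmin_r].
  - right; field; lra. }
nra.
Qed.

Lemma ccont_inv f z : ccont f z -> f z <> 0 -> ccont (fun w => / f w)%C z.
Proof.
intros Hf Hz eps Heps. set (A := Cmod (f z)).
assert (HA : 0 < A) by now apply Cmod_gt_0.
destruct (Hf (Rmin (A/2) (eps * A * A / 2))) as [d [Hd H]].
{ apply Rmin_pos; [lra|]. assert (0 < eps * A * A) by (repeat apply Rmult_lt_0_compat; auto). lra. }
exists d. split; auto. intros w Hw. specialize (H w Hw).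
assert (H1 : Cmod (f w - f z) < A / 2) by (eapply Rlt_le_trans; [exact H|apply Rmin_l]).
assert (H2 : Cmod (f w - f z) < eps * A * A / 2) by (eapply Rlt_le_trans; [exact H|apply Rmin_r]).
assert (H3 : A / 2 < Cmod (f w)).
{ pose proof (Cmod_le_sub (f z) (f w)). rewrite Cmod_sub_sym in H0. fold A in H0. lra. }
assert (Hw0 : f w <> 0) by (apply Cmod_gt_0; lra).
replace (/ f w - / f z)%C with ((f z - f w) / (f w * f z))%C by (field; split; auto; now apply Cmod_gt_0).
rewrite Cmod_div by (now apply Cmult_neq_0).
rewrite Cmod_sub_sym, Cmod_mult. fold A.
apply Rmult_lt_reg_r with (Cmod (f w) * A); [nra|].
unfold Rdiv. rewrite Rmult_assoc, Rinv_l, Rmult_1_r by nra.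
apply Rlt_le_trans with (1 := H2).
assert (0 < eps * A) by now apply Rmult_lt_0_compat. nra.
Qed.

Lemma ccont_comp f g z : ccont g z -> ccont f (g z) -> ccont (fun w => f (g w)) z.
Proof.
intros Hg Hf eps Heps. destruct (Hf eps Heps) as [d [Hd H]].
destruct (Hg d Hd) as [d' [Hd' H']]. exists d'. auto.
Qed.

(* Caratheodory's form of differentiability; it turns the calculus rules below
   into identities plus continuity. *)
Lemma cder_iff f z l :
  cder f z l <->
  exists phi, ccont phi z /\ phi z = l /\
    forall w, (f w - f z = (w - z) * phi w)%C.
Proof.
split.
- intros H.
  exists (fun w => if Ceq_dec w z then l else (f w - f z) / (w - z))%C.
  split; [|split].
  + intros eps Heps. destruct (H (eps/2)) as [d [Hd Hw]]; [lra|].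
    exists d. split; auto. intros w Hw'. specialize (Hw w Hw').
    destruct (Ceq_dec z z) as [_|n]; [|now destruct n].
    destruct (Ceq_dec w z) as [E|n].
    * rewrite Cmod_self; lra.
    * assert (Hn := Csub_neq0 _ _ n).
      replace ((f w - f z) / (w - z) - l)%C
        with ((f w - f z - (w - z) * l) / (w - z))%C by now field.
      rewrite Cmod_div by auto.
      apply Cmod_gt_0 in Hn.
      apply Rle_lt_trans with (eps / 2); [|lra].
      apply Rmult_le_reg_r with (Cmod (w - z)); auto.
      unfold Rdiv at 1. rewrite Rmult_assoc, Rinv_l; lra.
  + destruct (Ceq_dec z z) as [_|n]; [reflexivity|now destruct n].
  + intros w. destruct (Ceq_dec w z) as [E|n].
    * rewrite E. ring.
    * field. now apply Csub_neq0.
- intros [phi [Hc [Hl He]]] eps Heps.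
  destruct (Hc eps Heps) as [d [Hd H]]. exists d. split; auto.
  intros w Hw. rewrite He, <- Hl.
  replace ((w - z) * phi w - (w - z) * phi z)%C
    with ((phi w - phi z) * (w - z))%C by ring.
  rewrite Cmod_mult. apply Rmult_le_compat_r; [apply Cmod_ge_0|].
  now apply Rlt_le, H.
Qed.

Lemma cder_ccont f z l : cder f z l -> ccont f z.
Proof.
intros H. apply cder_iff in H. destruct H as [phi [Hc [_ He]]].
apply ccont_ext_loc with (fun w => f z + (w - z) * phi w)%C 1; [lra| |].
- intros w _. rewrite <- He. ring.
- apply ccont_plus; [apply ccont_const|].
  apply ccont_mult; auto. unfold Cminus.
  apply ccont_plus; [apply ccont_id|apply ccont_const].
Qed.

Lemma cder_ext_loc f g z l d :
  0 < d -> (forall w, Cmod (w - z) < d -> f w = g w) -> cder f z l -> cder g z l.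
Proof.
intros Hd Hfg Hf eps Heps. destruct (Hf eps Heps) as [d' [Hd' H]].
exists (Rmin d d'). split; [now apply Rmin_pos|]. intros w Hw.
rewrite <- !Hfg.
- apply H. apply Rlt_le_trans with (1 := Hw), Rmin_r.
- rewrite Cmod_self; lra.
- apply Rlt_le_trans with (1 := Hw), Rmin_l.
Qed.

Lemma cder_unique f z l l' : cder f z l -> cder f z l' -> l = l'.
Proof.
intros H H'. apply is_derive_C_iff, is_C_derive_unique in H.
apply is_derive_C_iff, is_C_derive_unique in H'. congruence.
Qed.

Lemma cder_const c z : cder (fun _ => c) z 0.
Proof.
apply cder_iff. exists (fun _ => RtoC 0). split; [apply ccont_const|].
split; auto. intros w. ring.
Qed.

Lemma cder_id z : cder (fun w => w) z 1.
Proof.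
apply cder_iff. exists (fun _ => RtoC 1). split; [apply ccont_const|].
split; auto. intros w. ring.
Qed.

Lemma cder_plus f g z l m :
  cder f z l -> cder g z m -> cder (fun w => f w + g w)%C z (l + m).
Proof.
intros Hf Hg. apply cder_iff in Hf, Hg.
destruct Hf as [p [Hp [El Ep]]], Hg as [q [Hq [Em Eq]]].
apply cder_iff. exists (fun w => p w + q w)%C.
split; [now apply ccont_plus|]. split; [congruence|]. intros w.
replace (f w + g w - (f z + g z))%C with ((f w - f z) + (g w - g z))%C by ring.
rewrite Ep, Eq. ring.
Qed.

Lemma cder_mult f g z l m :
  cder f z l -> cder g z m -> cder (fun w => f w * g w)%C z (l * g z + f z * m).
Proof.
intros Hf Hg. pose proof (cder_ccont _ _ _ Hg) as Cg.
apply cder_iff in Hf, Hg.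
destruct Hf as [p [Hp [El Ep]]], Hg as [q [Hq [Em Eq]]].
apply cder_iff. exists (fun w => p w * g w + f z * q w)%C.
split; [|split; [congruence|]].
- apply ccont_plus; apply ccont_mult; auto. apply ccont_const.
- intros w.
  replace (f w * g w - f z * g z)%C
    with ((f w - f z) * g w + f z * (g w - g z))%C by ring.
  rewrite Ep, Eq. ring.
Qed.

Lemma cder_scal c f z l : cder f z l -> cder (fun w => c * f w)%C z (c * l).
Proof.
intros H. replace (c * l)%C with (0 * f z + c * l)%C by ring.
apply (cder_mult (fun _ => c)); auto. apply cder_const.
Qed.

Lemma cder_minus f g z l m :
  cder f z l -> cder g z m -> cder (fun w => f w - g w)%C z (l - m).
Proof.
intros Hf Hg. apply cder_ext_loc with (fun w => f w + (-(1)) * g w)%C 1; [lra|intros; ring|].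
replace (l - m)%C with (l + (-(1)) * m)%C by ring.
apply cder_plus; auto. now apply cder_scal.
Qed.

Lemma cder_inv f z l :
  cder f z l -> f z <> 0 -> cder (fun w => / f w)%C z (- l / (f z * f z)).
Proof.
intros Hf Hz. pose proof (cder_ccont _ _ _ Hf) as Cf.
apply cder_iff in Hf. destruct Hf as [p [Hp [El Ep]]].
destruct (Cf (Cmod (f z))) as [d [Hd Hn]]; [now apply Cmod_gt_0|].
assert (Hn' : forall w, Cmod (w - z) < d -> f w <> 0).
{ intros w Hw E. specialize (Hn w Hw). rewrite E in Hn.
  replace (0 - f z)%C with (- f z)%C in Hn by ring. rewrite Cmod_opp in Hn. lra. }
(* [cder_iff] demands the factorisation at every [w], also where [f] vanishes. Beyond radius [d] the
   reciprocal is replaced by an expression that factors by construction. *)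
set (h := fun w => if Rlt_dec (Cmod (w - z)) d then (/ f w)%C else (/ f z - (w-z) * (p w / (f z * f z)))%C).
assert (Hh : forall w, Cmod (w - z) < d -> h w = (/ f w)%C).
{ intros w Hw. unfold h. destruct (Rlt_dec (Cmod (w - z)) d); [reflexivity|lra]. }
apply cder_ext_loc with h d; auto.
apply cder_iff.
exists (fun w => if Rlt_dec (Cmod (w - z)) d then (- p w / (f w * f z))%C else (- p w / (f z * f z))%C).
split; [|split].
- apply ccont_ext_loc with (fun w => -(1) * p w * (/ f w * / f z))%C d; auto.
  + intros w Hw. destruct (Rlt_dec (Cmod (w - z)) d); [|lra]. field. auto.
  + repeat apply ccont_mult; auto; try apply ccont_const. now apply ccont_inv.
- rewrite Cmod_self. destruct (Rlt_dec 0 d); [|lra]. congruence.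
- intros w. rewrite (Hh z) by (rewrite Cmod_self; auto). unfold h.
  destruct (Rlt_dec (Cmod (w - z)) d).
  + replace (/ f w - / f z)%C with (- (f w - f z) / (f w * f z))%C by (field; auto).
    rewrite Ep. field. auto.
  + field. auto.
Qed.

Lemma cder_div f g z l m :
  cder f z l -> cder g z m -> g z <> 0 ->
  cder (fun w => f w / g w)%C z ((l * g z - f z * m) / (g z * g z)).
Proof.
intros Hf Hg Hz.
replace ((l * g z - f z * m) / (g z * g z))%C
  with (l * / g z + f z * (- m / (g z * g z)))%C by (field; auto).
apply (cder_mult f (fun w => / g w)%C); auto. now apply cder_inv.
Qed.

Lemma cder_comp f g z l m :
  cder g z m -> cder f (g z) l -> cder (fun w => f (g w)) z (m * l).
Proof.
intros Hg Hf. pose proof (cder_ccont _ _ _ Hg) as Cg.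
apply cder_iff in Hf, Hg.
destruct Hf as [p [Hp [El Ep]]], Hg as [q [Hq [Em Eq]]].
apply cder_iff. exists (fun w => q w * p (g w))%C.
split; [|split; [congruence|]].
- apply ccont_mult; auto. apply (ccont_comp p g); auto.
- intros w. rewrite Ep, Eq. ring.
Qed.

Lemma cder_pow n z : exists l, cder (fun w => w ^ n)%C z l.
Proof.
induction n as [|n [l IH]].
- exists 0. apply cder_ext_loc with (fun _ => RtoC 1) 1; [lra|reflexivity|apply cder_const].
- eexists. apply cder_ext_loc with (fun w => w * w ^ n)%C 1; [lra|reflexivity|].
  apply cder_mult; [apply cder_id|exact IH].
Qed.

(** * Integrals of complex-valued functions of a real variable *)

Definition ex_CInt (g : R -> C) (a b : R) : Prop :=
  ex_RInt (fun t => Re (g t)) a b /\ ex_RInt (fun t => Im (g t)) a b.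

Definition CInt (g : R -> C) (a b : R) : C :=
  (RInt (fun t => Re (g t)) a b, RInt (fun t => Im (g t)) a b).

Lemma im_le_Cmod z : Rabs (Im z) <= Cmod z.
Proof.
apply Rle_trans with (2 := Rmax_Cmod z), Rmax_r.
Qed.

Lemma Cmod_le_abs z : Cmod z <= Rabs (Re z) + Rabs (Im z).
Proof.
destruct z as [x y]. simpl.
replace (x, y) with (RtoC x + Ci * RtoC y)%C by (apply injective_projections; simpl; ring).
eapply Rle_trans; [apply Cmod_triangle|].
rewrite Cmod_mult, !Cmod_R, Cmod_Ci. lra.
Qed.

Lemma ex_CInt_cont g a b :
  (forall t, Rmin a b <= t <= Rmax a b -> forall eps, 0 < eps ->
     exists d, 0 < d /\ forall s, Rabs (s - t) < d -> Cmod (g s - g t) < eps) ->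
  ex_CInt g a b.
Proof.
intros H. split; apply (@ex_RInt_continuous R_CompleteNormedModule);
  intros t Ht; apply filterlim_locally; intros eps;
  destruct (H t Ht eps (cond_pos eps)) as [d [Hd Hs]];
  exists (mkposreal d Hd); intros s Hs'; specialize (Hs s Hs').
- eapply Rle_lt_trans; [|exact Hs]. apply (re_le_Cmod (g s - g t)).
- eapply Rle_lt_trans; [|exact Hs]. apply (im_le_Cmod (g s - g t)).
Qed.

Lemma CInt_ext f g a b :
  (forall t, Rmin a b < t < Rmax a b -> f t = g t) -> CInt f a b = CInt g a b.
Proof.
intros H. unfold CInt. f_equal; apply RInt_ext; intros t Ht; now rewrite H.
Qed.

Lemma ex_CInt_ext f g a b :
  (forall t, f t = g t) -> ex_CInt f a b -> ex_CInt g a b.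
Proof.
intros H [H1 H2]. split; [revert H1|revert H2]; apply ex_RInt_ext; intros t _; now rewrite H.
Qed.

Lemma ex_CInt_const c a b : ex_CInt (fun _ => c) a b.
Proof. split; apply ex_RInt_const. Qed.

Lemma ex_CInt_plus f g a b :
  ex_CInt f a b -> ex_CInt g a b -> ex_CInt (fun t => f t + g t)%C a b.
Proof.
intros [F1 F2] [G1 G2]. split; apply (ex_RInt_plus (V := R_NormedModule)); auto.
Qed.

Lemma ex_CInt_scal c g a b : ex_CInt g a b -> ex_CInt (fun t => c * g t)%C a b.
Proof.
intros [G1 G2]. split.
- apply (ex_RInt_minus (V := R_NormedModule)); now apply (ex_RInt_scal (V := R_NormedModule)).
- apply (ex_RInt_plus (V := R_NormedModule)); now apply (ex_RInt_scal (V := R_NormedModule)).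
Qed.

Lemma CInt_plus f g a b :
  ex_CInt f a b -> ex_CInt g a b ->
  CInt (fun t => f t + g t)%C a b = (CInt f a b + CInt g a b)%C.
Proof.
intros [F1 F2] [G1 G2]. unfold CInt. apply injective_projections; simpl.
- apply (RInt_plus (V := R_CompleteNormedModule)); auto.
- apply (RInt_plus (V := R_CompleteNormedModule)); auto.
Qed.

Lemma CInt_scal c g a b :
  ex_CInt g a b -> CInt (fun t => c * g t)%C a b = (c * CInt g a b)%C.
Proof.
intros [G1 G2]. unfold CInt. apply injective_projections; simpl.
- rewrite (RInt_minus (V := R_CompleteNormedModule) (fun t => fst c * Re (g t)) (fun t => snd c * Im (g t)));
    try now apply (ex_RInt_scal (V := R_NormedModule)).
  rewrite !(RInt_scal (V := R_CompleteNormedModule)); auto.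
- rewrite (RInt_plus (V := R_CompleteNormedModule) (fun t => fst c * Im (g t)) (fun t => snd c * Re (g t)));
    try now apply (ex_RInt_scal (V := R_NormedModule)).
  rewrite !(RInt_scal (V := R_CompleteNormedModule)); auto.
Qed.

Lemma CInt_const c a b : CInt (fun _ => c) a b = (RtoC (b - a) * c)%C.
Proof.
unfold CInt. rewrite !RInt_const. destruct c as [x y].
apply injective_projections; simpl; unfold scal; simpl; unfold mult; simpl; ring.
Qed.

Lemma ex_CInt_minus f g a b :
  ex_CInt f a b -> ex_CInt g a b -> ex_CInt (fun t => f t - g t)%C a b.
Proof.
intros F G. apply ex_CInt_ext with (fun t => f t + (-(1)) * g t)%C; [intros; ring|].
apply ex_CInt_plus; auto. now apply ex_CInt_scal.
Qed.

Lemma CInt_minus f g a b :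
  ex_CInt f a b -> ex_CInt g a b ->
  CInt (fun t => f t - g t)%C a b = (CInt f a b - CInt g a b)%C.
Proof.
intros F G. rewrite (CInt_ext _ (fun t => f t + (-(1)) * g t)%C) by (intros; ring).
rewrite CInt_plus, CInt_scal; auto; [ring|now apply ex_CInt_scal].
Qed.

Lemma CInt_Chasles g a b c :
  ex_CInt g a b -> ex_CInt g b c -> CInt g a c = (CInt g a b + CInt g b c)%C.
Proof.
intros [F1 F2] [G1 G2]. unfold CInt. apply injective_projections; simpl; symmetry;
  apply (RInt_Chasles (V := R_CompleteNormedModule)); auto.
Qed.

Lemma CInt_bound g a b M :
  a <= b -> ex_CInt g a b -> (forall t, a <= t <= b -> Cmod (g t) <= M) ->
  Cmod (CInt g a b) <= M * (b - a).
Proof.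
intros Hab Hg HM. set (l := CInt g a b).
destruct (Ceq_dec l 0) as [E|n].
{ rewrite E, Cmod_0. specialize (HM a (conj (Rle_refl _) Hab)).
  pose proof (Cmod_ge_0 (g a)). apply Rmult_le_pos; lra. }
assert (Hl : 0 < Cmod l) by now apply Cmod_gt_0.
(* rotate [l] onto the positive real axis and integrate real parts *)
set (c := (Cconj l / RtoC (Cmod l))%C).
assert (Hl' : RtoC (Cmod l) <> 0) by (intros E; apply RtoC_inj in E; lra).
assert (Hc : Cmod c = 1).
{ unfold c. rewrite Cmod_div, Cmod_conj, Cmod_R, Rabs_pos_eq; auto; [field; lra|lra]. }
assert (Hcl : (c * l)%C = RtoC (Cmod l)).
{ unfold c. replace (Cconj l / RtoC (Cmod l) * l)%C
    with (l * Cconj l / RtoC (Cmod l))%C by (field; auto).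
  rewrite <- Cmod2_conj, RtoC_pow. field. auto. }
assert (E : Cmod l = RInt (fun t => Re (c * g t)) a b).
{ change (RInt (fun t => Re (c * g t)) a b) with (Re (CInt (fun t => c * g t)%C a b)).
  rewrite CInt_scal by auto. fold l. rewrite Hcl. reflexivity. }
rewrite E. replace (M * (b - a)) with (RInt (fun _ => M) a b).
2:{ rewrite RInt_const. unfold scal; simpl; unfold mult; simpl; ring. }
apply RInt_le; auto.
- apply (ex_CInt_scal c) in Hg. apply Hg.
- apply ex_RInt_const.
- intros t Ht. eapply Rle_trans; [apply Rle_abs|].
  eapply Rle_trans; [apply re_le_Cmod|]. rewrite Cmod_mult, Hc, Rmult_1_l.
  apply HM. lra.
Qed.

Lemma CInt_dev g K a b M :
  a <= b -> ex_CInt g a b -> (forall t, a <= t <= b -> Cmod (g t - K) <= M) ->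
  Cmod (CInt g a b - RtoC (b - a) * K) <= M * (b - a).
Proof.
intros Hab Hg H. rewrite <- CInt_const, <- CInt_minus; auto using ex_CInt_const.
apply CInt_bound; auto. apply ex_CInt_minus; auto using ex_CInt_const.
Qed.

(** * Goursat's theorem for rectangles *)

(** The counterclockwise contour integral, with opposite sides paired in one integrand, so that a
    periodic [F] makes a pair cancel pointwise. *)
Definition rect_int (F : C -> C) (a b c d : R) : C :=
  (CInt (fun s => F (s, c) - F (s, d)) a b
   + Ci * CInt (fun t => F (b, t) - F (a, t)) c d)%C.

Definition rect_cont (F : C -> C) (a b c d : R) : Prop :=
  forall s t, a <= s <= b -> c <= t <= d -> ccont F (s, t).

Lemma ex_CInt_horiz F a b c d s1 s2 t :
  rect_cont F a b c d -> a <= s1 -> s1 <= s2 -> s2 <= b -> c <= t <= d ->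
  ex_CInt (fun s => F (s, t)) s1 s2.
Proof.
intros HF H1 H2 H3 Ht. apply ex_CInt_cont. rewrite Rmin_left, Rmax_right by auto.
intros s Hs eps Heps. destruct (HF s t) with (eps := eps) as [e [He H]]; auto; [lra|].
exists e. split; auto. intros s' Hs'. apply H.
replace (((s', t) : C) - (s, t))%C with (RtoC (s' - s))
  by (apply injective_projections; simpl; ring).
now rewrite Cmod_R.
Qed.

Lemma ex_CInt_vert F a b c d t1 t2 s :
  rect_cont F a b c d -> c <= t1 -> t1 <= t2 -> t2 <= d -> a <= s <= b ->
  ex_CInt (fun t => F (s, t)) t1 t2.
Proof.
intros HF H1 H2 H3 Ht. apply ex_CInt_cont. rewrite Rmin_left, Rmax_right by auto.
intros t Hs eps Heps. destruct (HF s t) with (eps := eps) as [e [He H]]; auto; [lra|].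
exists e. split; auto. intros t' Ht'. apply H.
replace (((s, t') : C) - (s, t))%C with (Ci * RtoC (t' - t))%C
  by (apply injective_projections; simpl; ring).
now rewrite Cmod_mult, Cmod_Ci, Rmult_1_l, Cmod_R.
Qed.

Lemma rect_int_split_x F a b c d m :
  rect_cont F a b c d -> a <= m <= b -> c <= d ->
  rect_int F a b c d = (rect_int F a m c d + rect_int F m b c d)%C.
Proof.
intros HF Hm Hcd. unfold rect_int.
assert (HH := fun s1 s2 t => ex_CInt_horiz F a b c d s1 s2 t HF).
assert (HV := fun t1 t2 s => ex_CInt_vert F a b c d t1 t2 s HF).
rewrite (CInt_Chasles (fun s => F (s, c) - F (s, d))%C a m b);
  [|apply ex_CInt_minus; apply HH; lra|apply ex_CInt_minus; apply HH; lra].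
rewrite !(CInt_minus (fun t => F (_, t))); [ring|apply HV; lra..].
Qed.

Lemma rect_int_split_y F a b c d m :
  rect_cont F a b c d -> a <= b -> c <= m <= d ->
  rect_int F a b c d = (rect_int F a b c m + rect_int F a b m d)%C.
Proof.
intros HF Hab Hm. unfold rect_int.
assert (HH := fun s1 s2 t => ex_CInt_horiz F a b c d s1 s2 t HF).
assert (HV := fun t1 t2 s => ex_CInt_vert F a b c d t1 t2 s HF).
rewrite (CInt_Chasles (fun t => F (b, t) - F (a, t))%C c m d);
  [|apply ex_CInt_minus; apply HV; lra|apply ex_CInt_minus; apply HV; lra].
rewrite !(CInt_minus (fun s => F (s, _))); [ring|apply HH; lra..].
Qed.

Lemma rect_cont_sub F a b c d a' b' c' d' :
  rect_cont F a b c d -> a <= a' -> b' <= b -> c <= c' -> d' <= d ->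
  rect_cont F a' b' c' d'.
Proof. intros H ? ? ? ? s t Hs Ht. apply H; lra. Qed.

(* the boundary integral of an affine function vanishes exactly *)
Lemma rect_int_small F a b c d p l eps r :
  rect_cont F a b c d -> a <= b -> c <= d -> a <= Re p <= b -> c <= Im p <= d ->
  b - a + (d - c) <= r -> 0 <= eps ->
  (forall w, Cmod (w - p) <= r ->
     Cmod (F w - F p - (w - p) * l) <= eps * Cmod (w - p)) ->
  Cmod (rect_int F a b c d) <= 2 * eps * r * r.
Proof.
intros HF Hab Hcd Hpx Hpy Hr Heps H.
assert (Hin : forall s t, a <= s <= b -> c <= t <= d -> Cmod ((s, t) - p) <= r).
{ intros s t Hs Ht. eapply Rle_trans; [apply Cmod_le_abs|].
  destruct p as [x y]; simpl in *.
  assert (Rabs (s + - x) <= b - a) by (apply Rabs_le; lra).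
  assert (Rabs (t + - y) <= d - c) by (apply Rabs_le; lra). lra. }
assert (H' : forall s t, a <= s <= b -> c <= t <= d ->
  Cmod (F (s, t) - F p - ((s, t) - p) * l) <= eps * r).
{ intros s t Hs Ht. eapply Rle_trans; [apply H; auto|].
  apply Rmult_le_compat_l; auto. }
(* [K1] and [K2] are what the linear part [(w - p) * l] contributes to the two paired integrands;
   they satisfy [(b - a) * K1 + Ci * (d - c) * K2 = 0]. *)
set (K1 := (- (RtoC (d - c) * Ci * l))%C).
set (K2 := (RtoC (b - a) * l)%C).
assert (D1 : Cmod (CInt (fun s => F (s, c) - F (s, d))%C a b - RtoC (b - a) * K1)
             <= 2 * eps * r * (b - a)).
{ apply CInt_dev; auto.
  - apply ex_CInt_minus; apply (ex_CInt_horiz F a b c d); auto; lra.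
  - intros s Hs.
    replace (F (s, c) - F (s, d) - K1)%C with
      ((F (s, c) - F p - ((s, c) - p) * l) - (F (s, d) - F p - ((s, d) - p) * l))%C.
    + eapply Rle_trans; [apply Cmod_sub_le|].
      pose proof (H' s c Hs (conj (Rle_refl _) Hcd)).
      pose proof (H' s d Hs (conj Hcd (Rle_refl _))). lra.
    + unfold K1. replace (RtoC (d - c) * Ci)%C with (((s, d) : C) - (s, c))%C
        by (apply injective_projections; simpl; ring).
      ring. }
assert (D2 : Cmod (CInt (fun t => F (b, t) - F (a, t))%C c d - RtoC (d - c) * K2)
             <= 2 * eps * r * (d - c)).
{ apply CInt_dev; auto.
  - apply ex_CInt_minus; apply (ex_CInt_vert F a b c d); auto; lra.
  - intros t Ht.
    replace (F (b, t) - F (a, t) - K2)%C with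
      ((F (b, t) - F p - ((b, t) - p) * l) - (F (a, t) - F p - ((a, t) - p) * l))%C.
    + eapply Rle_trans; [apply Cmod_sub_le|].
      pose proof (H' b t (conj Hab (Rle_refl _)) Ht).
      pose proof (H' a t (conj (Rle_refl _) Hab) Ht). lra.
    + unfold K2. replace (RtoC (b - a)) with (((b, t) : C) - (a, t))%C
        by (apply injective_projections; simpl; ring).
      ring. }
unfold rect_int.
replace (CInt (fun s => F (s, c) - F (s, d)) a b + Ci * CInt (fun t => F (b, t) - F (a, t)) c d)%C
  with ((CInt (fun s => F (s, c) - F (s, d)) a b - RtoC (b - a) * K1)
        + Ci * (CInt (fun t => F (b, t) - F (a, t)) c d - RtoC (d - c) * K2))%C
  by (unfold K1, K2; ring).
eapply Rle_trans; [apply Cmod_triangle|]. rewrite Cmod_mult, Cmod_Ci, Rmult_1_l.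
assert (0 <= 2 * eps * r * (r - (b - a) - (d - c))).
{ repeat apply Rmult_le_pos; lra. }
lra.
Qed.

Record rect := Rect { rx1 : R; rx2 : R; ry1 : R; ry2 : R }.

Definition rint (F : C -> C) (Q : rect) : C := rect_int F (rx1 Q) (rx2 Q) (ry1 Q) (ry2 Q).

(** If the left half carries less than half of the modulus of the integral, the triangle inequality
    gives at least half of it to the right one. Halving one direction at a time keeps this a two-way
    choice. *)
Definition half_x (F : C -> C) (Q : rect) : rect :=
  let m := (rx1 Q + rx2 Q) / 2 in
  let L := Rect (rx1 Q) m (ry1 Q) (ry2 Q) in
  if Rle_dec (Cmod (rint F Q) / 2) (Cmod (rint F L)) then L
  else Rect m (rx2 Q) (ry1 Q) (ry2 Q).

Definition half_y (F : C -> C) (Q : rect) : rect :=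
  let m := (ry1 Q + ry2 Q) / 2 in
  let L := Rect (rx1 Q) (rx2 Q) (ry1 Q) m in
  if Rle_dec (Cmod (rint F Q) / 2) (Cmod (rint F L)) then L
  else Rect (rx1 Q) (rx2 Q) m (ry2 Q).

Fixpoint bisect (F : C -> C) (Q : rect) (n : nat) : rect :=
  match n with
  | O => Q
  | S k => half_y F (half_x F (bisect F Q k))
  end.

Definition rect_in (P Q : rect) : Prop :=
  rx1 Q <= rx1 P /\ rx1 P <= rx2 P /\ rx2 P <= rx2 Q /\
  ry1 Q <= ry1 P /\ ry1 P <= ry2 P /\ ry2 P <= ry2 Q.

Lemma rect_in_trans P Q S : rect_in P Q -> rect_in Q S -> rect_in P S.
Proof. unfold rect_in. intros. lra. Qed.

Definition rcontQ F Q := rect_cont F (rx1 Q) (rx2 Q) (ry1 Q) (ry2 Q).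

Lemma rcontQ_in F P Q : rect_in P Q -> rcontQ F Q -> rcontQ F P.
Proof. unfold rect_in. intros H HF. eapply rect_cont_sub; [exact HF|lra..]. Qed.

Lemma half_x_spec F Q : rcontQ F Q -> rect_in Q Q ->
  let P := half_x F Q in
  rect_in P Q /\ rx2 P - rx1 P = (rx2 Q - rx1 Q) / 2 /\ ry2 P - ry1 P = ry2 Q - ry1 Q
  /\ Cmod (rint F Q) / 2 <= Cmod (rint F P).
Proof.
intros HF HQ. cbv zeta. unfold half_x. cbv zeta.
assert (E := rect_int_split_x F (rx1 Q) (rx2 Q) (ry1 Q) (ry2 Q) ((rx1 Q + rx2 Q)/2) HF).
destruct Rle_dec as [H|H].
- unfold rect_in in *; cbn [rx1 rx2 ry1 ry2]. repeat (split; [lra|]). exact H.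
- unfold rint in H at 2. simpl in H.
  unfold rect_in in *; cbn [rx1 rx2 ry1 ry2]. repeat (split; [lra|]).
  unfold rint in H |- *; simpl. rewrite E in H |- * by lra.
  pose proof (Cmod_triangle (rect_int F (rx1 Q) ((rx1 Q + rx2 Q) / 2) (ry1 Q) (ry2 Q))
     (rect_int F ((rx1 Q + rx2 Q) / 2) (rx2 Q) (ry1 Q) (ry2 Q))). lra.
Qed.

Lemma half_y_spec F Q : rcontQ F Q -> rect_in Q Q ->
  let P := half_y F Q in
  rect_in P Q /\ rx2 P - rx1 P = rx2 Q - rx1 Q /\ ry2 P - ry1 P = (ry2 Q - ry1 Q) / 2
  /\ Cmod (rint F Q) / 2 <= Cmod (rint F P).
Proof.
intros HF HQ. cbv zeta. unfold half_y. cbv zeta.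
assert (E := rect_int_split_y F (rx1 Q) (rx2 Q) (ry1 Q) (ry2 Q) ((ry1 Q + ry2 Q)/2) HF).
destruct Rle_dec as [H|H].
- unfold rect_in in *; cbn [rx1 rx2 ry1 ry2]. repeat (split; [lra|]). exact H.
- unfold rint in H at 2. simpl in H.
  unfold rect_in in *; cbn [rx1 rx2 ry1 ry2]. repeat (split; [lra|]).
  unfold rint in H |- *; simpl. rewrite E in H |- * by lra.
  pose proof (Cmod_triangle (rect_int F (rx1 Q) (rx2 Q) (ry1 Q) ((ry1 Q + ry2 Q) / 2))
     (rect_int F (rx1 Q) (rx2 Q) ((ry1 Q + ry2 Q) / 2) (ry2 Q))). lra.
Qed.

Lemma rect_in_self P Q : rect_in P Q -> rect_in P P.
Proof. unfold rect_in. lra. Qed.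

Lemma bisect_step F Q : rcontQ F Q -> rect_in Q Q ->
  let P := half_y F (half_x F Q) in
  rect_in P Q /\ rx2 P - rx1 P = (rx2 Q - rx1 Q) / 2 /\ ry2 P - ry1 P = (ry2 Q - ry1 Q) / 2
  /\ Cmod (rint F Q) / 4 <= Cmod (rint F P).
Proof.
intros HF HQ. destruct (half_x_spec F Q HF HQ) as [A1 [A2 [A3 A4]]].
destruct (half_y_spec F (half_x F Q)) as [B1 [B2 [B3 B4]]].
- now apply rcontQ_in with Q.
- now apply rect_in_self with Q.
- split; [eapply rect_in_trans; eauto|]. simpl in *. repeat split; lra.
Qed.

Lemma bisect_spec F Q n : rcontQ F Q -> rect_in Q Q ->
  let P := bisect F Q n in
  rect_in P Q /\ rx2 P - rx1 P = (rx2 Q - rx1 Q) / 2 ^ n /\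
  ry2 P - ry1 P = (ry2 Q - ry1 Q) / 2 ^ n /\
  Cmod (rint F Q) / 4 ^ n <= Cmod (rint F P).
Proof.
intros HF HQ. induction n as [|n IH]; simpl.
- repeat split; try (unfold rect_in in HQ; lra).
- simpl in IH. destruct IH as [A1 [A2 [A3 A4]]].
  destruct (bisect_step F (bisect F Q n)) as [B1 [B2 [B3 B4]]].
  + now apply rcontQ_in with Q.
  + now apply rect_in_self with Q.
  + simpl in *. assert (0 < 2 ^ n) by (apply pow_lt; lra).
    assert (0 < 4 ^ n) by (apply pow_lt; lra).
    split; [eapply rect_in_trans; eauto|]. rewrite B2, B3, A2, A3.
    split; [field; lra|]. split; [field; lra|].
    eapply Rle_trans; [|exact B4].
    replace (Cmod (rint F Q) / (4 * 4 ^ n)) with (Cmod (rint F Q) / 4 ^ n / 4) by (field; lra).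
    lra.
Qed.

Lemma bisect_mono F Q n k : rcontQ F Q -> rect_in Q Q ->
  rect_in (bisect F Q (k + n)) (bisect F Q n).
Proof.
intros HF HQ. induction k as [|k IH].
- destruct (bisect_spec F Q n HF HQ) as [H _]. now apply rect_in_self with Q.
- eapply rect_in_trans; [|exact IH]. simpl.
  destruct (bisect_spec F Q (k + n) HF HQ) as [H _].
  apply bisect_step.
  + now apply rcontQ_in with Q.
  + now apply rect_in_self with Q.
Qed.

Lemma nested_point (u v : nat -> R) :
  (forall n k, u n <= u (k + n)%nat) -> (forall n k, v (k + n)%nat <= v n) ->
  (forall n, u n <= v n) -> exists x, forall n, u n <= x <= v n.
Proof.
intros Hu Hv Huv.
assert (B : forall n m, u n <= v m).
{ intros n m. apply Rle_trans with (u (m + n)%nat); auto.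
  apply Rle_trans with (v (m + n)%nat); auto.
  rewrite (Nat.add_comm m n). auto. }
destruct (completeness (fun y => exists n, y = u n)) as [x [Hx1 Hx2]].
- exists (v O). intros y [n ->]. auto.
- exists (u O). eauto.
- exists x. intros n. split.
  + apply Hx1. eauto.
  + apply Hx2. intros y [m ->]. auto.
Qed.

Lemma pow2_unbounded (A : R) : exists n, A < 2 ^ n.
Proof.
destruct (Pow_x_infinity 2) with (b := A + 1) as [N H].
- rewrite Rabs_pos_eq; lra.
- exists N. specialize (H N (le_n N)). rewrite Rabs_pos_eq in H; [lra|].
  apply pow_le; lra.
Qed.

(** Each bisection of both directions halves the size and divides the integral by at most 4. At the
    common point of the nested rectangles, differentiability makes the integral small compared with
    the squared size. *)
Lemma goursat F a b c d :
  a <= b -> c <= d ->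
  (forall s t, a <= s <= b -> c <= t <= d -> exists l, cder F (s, t) l) ->
  rect_int F a b c d = 0.
Proof.
intros Hab Hcd HD. set (Q := Rect a b c d).
assert (HF : rcontQ F Q).
{ intros s t Hs Ht. destruct (HD s t Hs Ht) as [l Hl]. eapply cder_ccont; eauto. }
assert (HQ : rect_in Q Q) by (unfold rect_in; simpl; lra).
set (P := bisect F Q).
assert (HP := fun n => bisect_spec F Q n HF HQ). fold P in HP.
assert (HM := fun n k => bisect_mono F Q n k HF HQ). fold P in HM.
destruct (nested_point (fun n => rx1 (P n)) (fun n => rx2 (P n))) as [x Hx];
  [intros; apply HM|intros; apply HM|intros; apply (HP n)|].
destruct (nested_point (fun n => ry1 (P n)) (fun n => ry2 (P n))) as [y Hy];
  [intros; apply HM|intros; apply HM|intros; apply (HP n)|].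
destruct (HD x y) as [l Hl]; [apply (Hx O)|apply (Hy O)|].
(* The summand 1 keeps [L] positive for a degenerate rectangle. *)
set (L := (b - a) + (d - c) + 1).
assert (HL : 0 < L) by (unfold L; lra).
apply Cmod_eq_0. apply Rle_antisym; [|apply Cmod_ge_0].
apply le_epsilon. intros e He. rewrite Rplus_0_l.
(* Chosen so that the bound of [rect_int_small] at size [L / 2 ^ n] is exactly [e / 4 ^ n]. *)
destruct (Hl (e / (2 * L * L))) as [del [Hdel H]].
{ apply Rdiv_lt_0_compat; auto. repeat apply Rmult_lt_0_compat; lra. }
destruct (pow2_unbounded (L / del)) as [n Hn].
assert (H2 : 0 < 2 ^ n) by (apply pow_lt; lra).
assert (Hr : L / 2 ^ n < del).
{ apply Rmult_lt_reg_r with (2 ^ n); auto.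
  apply Rmult_lt_compat_r with (r := del) in Hn; auto.
  unfold Rdiv in *. rewrite Rmult_assoc, Rinv_l in Hn |- * by lra. lra. }
destruct (HP n) as [H1 [Hw [Hh Hi]]].
assert (K : Cmod (rint F (P n)) <= 2 * (e / (2 * L * L)) * (L / 2 ^ n) * (L / 2 ^ n)).
{ unfold rint. apply rect_int_small with (x, y) l.
  - now apply rcontQ_in with Q.
  - apply H1. - apply H1.
  - apply (Hx n). - apply (Hy n).
  - rewrite Hw, Hh. simpl. unfold Rdiv. rewrite <- Rmult_plus_distr_r.
    apply Rmult_le_compat_r; [left; now apply Rinv_0_lt_compat|unfold L; lra].
  - left. apply Rdiv_lt_0_compat; auto. repeat apply Rmult_lt_0_compat; lra.
  - intros w Hw'. apply H. lra. }
replace (2 * (e / (2 * L * L)) * (L / 2 ^ n) * (L / 2 ^ n)) with (e / 4 ^ n) in K.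
2:{ replace (4 ^ n) with (2 ^ n * 2 ^ n) by (rewrite <- Rpow_mult_distr; f_equal; lra).
    field; lra. }
assert (H4 : 0 < 4 ^ n) by (apply pow_lt; lra).
change (Cmod (rint F Q) <= e).
apply Rmult_le_reg_r with (/ 4 ^ n); [now apply Rinv_0_lt_compat|].
unfold Rdiv in *. lra.
Qed.

(** * The complex exponential *)

Definition cis (t : R) : C := (cos t, sin t).

Definition cexp (u : C) : C := (RtoC (exp (Re u)) * cis (Im u))%C.

Lemma Cmod_cis t : Cmod (cis t) = 1.
Proof.
unfold Cmod, cis; simpl. rewrite !Rmult_1_r.
pose proof (sin2_cos2 t) as H. unfold Rsqr in H.
replace (cos t * cos t + sin t * sin t) with 1 by lra. apply sqrt_1.
Qed.

Lemma cis_plus s t : cis (s + t) = (cis s * cis t)%C.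
Proof.
unfold cis. rewrite cos_plus, sin_plus.
apply injective_projections; simpl; ring.
Qed.

Lemma cis_0 : cis 0 = 1.
Proof. unfold cis. now rewrite cos_0, sin_0. Qed.

Lemma cis_2PI : cis (2 * PI) = 1.
Proof. unfold cis. now rewrite cos_2PI, sin_2PI. Qed.

Lemma cexp_plus u v : cexp (u + v) = (cexp u * cexp v)%C.
Proof.
unfold cexp. destruct u as [s t], v as [s' t']; simpl.
rewrite cis_plus, exp_plus, RtoC_mult. ring.
Qed.

(** Both bounds come from [1 + x <= exp x], used at [s] and at [- s]. *)
Lemma exp_quad s : Rabs s <= / 2 -> Rabs (exp s - 1 - s) <= 2 * s * s.
Proof.
intros H. assert (- / 2 <= s <= / 2) by (apply Rabs_le_between; auto).
pose proof (exp_ineq1_le s). pose proof (exp_ineq1_le (- s)) as H4.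
rewrite exp_Ropp in H4. assert (He := exp_pos s).
assert (H2 : exp s * (1 - s) <= 1).
{ apply Rmult_le_compat_l with (r := exp s) in H4; [|lra].
  rewrite Rinv_r in H4 by lra. lra. }
assert (H3 : (exp s - 1 - s) * (1 - s) <= s * s) by nra.
rewrite Rabs_pos_eq by lra. nra.
Qed.

Lemma sin_lip a b : Rabs (sin a - sin b) <= Rabs (a - b).
Proof.
destruct (MVT_gen sin b a cos) as [c [_ Hc]].
- intros x _. apply is_derive_sin.
- intros x _. apply continuity_pt_filterlim, continuous_sin.
- rewrite Hc, Rabs_mult. rewrite <- (Rmult_1_l (Rabs (a - b))) at 2.
  apply Rmult_le_compat_r; [apply Rabs_pos|].
  apply Rabs_le. apply COS_bound.
Qed.

Lemma cos_lip a b : Rabs (cos a - cos b) <= Rabs (a - b).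
Proof.
rewrite !cos_sin. replace (a - b) with (PI / 2 + a - (PI / 2 + b)) by ring.
apply sin_lip.
Qed.

Lemma cis_lip a b : Cmod (cis a - cis b) <= 2 * Rabs (a - b).
Proof.
eapply Rle_trans; [apply Cmod_le_abs|]. simpl.
pose proof (sin_lip a b). pose proof (cos_lip a b).
unfold Rminus in *. lra.
Qed.

Lemma cos_quad t : Rabs (cos t - 1) <= t * t.
Proof.
replace t with (2 * (t / 2)) at 1 by field. rewrite cos_2a_sin.
replace (1 - 2 * sin (t/2) * sin (t/2) - 1) with (- (2 * Rsqr (sin (t/2)))) by (unfold Rsqr; ring).
rewrite Rabs_Ropp, Rabs_pos_eq by (pose proof (Rle_0_sqr (sin (t/2))); lra).
assert (H := sin_lip (t/2) 0). rewrite sin_0, !Rminus_0_r in H.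
apply Rsqr_le_abs_1 in H. unfold Rsqr in *. nra.
Qed.

Lemma sin_quad t : Rabs t <= 1 -> Rabs (sin t - t) <= t * t.
Proof.
intros Ht.
destruct (MVT_gen (fun x => sin x - x) 0 t (fun x => cos x - 1)) as [c [Hc E]].
- intros x _. auto_derive; [exact I|ring].
- intros x _. apply continuity_pt_minus; [apply continuity_pt_filterlim, continuous_sin|].
  apply continuity_pt_id.
- rewrite sin_0, !Rminus_0_r in E. rewrite E, Rabs_mult.
  assert (Hc' : Rabs c <= Rabs t).
  { unfold Rmin, Rmax in Hc. destruct (Rle_dec 0 t).
    - rewrite !Rabs_pos_eq; lra.
    - rewrite !Rabs_left1; lra. }
  pose proof (cos_quad c).
  assert (c * c <= Rabs t * Rabs t).
  { replace (c * c) with (Rabs c * Rabs c).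
    - pose proof (Rabs_pos c). nra.
    - rewrite <- Rabs_mult. apply Rabs_pos_eq. nra. }
  assert (t * t = Rabs t * Rabs t).
  { rewrite <- Rabs_mult. symmetry; apply Rabs_pos_eq. nra. }
  pose proof (Rabs_pos t). rewrite H1. nra.
Qed.

(** The error terms of the real and imaginary parts add up to [8 * r * r]; the constant 10 is
    slack. *)
Lemma cexp_quad h : Cmod h <= / 2 -> Cmod (cexp h - 1 - h) <= 10 * Cmod h * Cmod h.
Proof.
intros Hh. destruct h as [s t].
pose proof (re_le_Cmod (s, t)) as Hs. pose proof (im_le_Cmod (s, t)) as Ht. simpl in Hs, Ht.
set (r := Cmod (s, t)) in *.
eapply Rle_trans; [apply Cmod_le_abs|]. unfold cexp, cis. simpl.
replace (exp s * cos t - 0 * sin t + - (1) + - s) with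
  ((exp s - 1 - s) * cos t + (1 + s) * (cos t - 1)) by ring.
replace (exp s * sin t + 0 * cos t + - 0 + - t) with
  ((exp s - 1 - s) * sin t + (1 + s) * (sin t - t) + s * t) by ring.
pose proof (exp_quad s ltac:(lra)) as E1.
pose proof (cos_quad t) as E2. pose proof (sin_quad t ltac:(lra)) as E3.
assert (C1 : Rabs (cos t) <= 1) by (apply Rabs_le, COS_bound).
assert (S1 : Rabs (sin t) <= 1) by (apply Rabs_le, SIN_bound).
assert (ss : s * s <= r * r).
{ replace (s * s) with (Rabs s * Rabs s) by (rewrite <- Rabs_mult; apply Rabs_pos_eq; nra).
  pose proof (Rabs_pos s). nra. }
assert (tt : t * t <= r * r).
{ replace (t * t) with (Rabs t * Rabs t) by (rewrite <- Rabs_mult; apply Rabs_pos_eq; nra).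
  pose proof (Rabs_pos t). nra. }
assert (st : Rabs (s * t) <= r * r).
{ rewrite Rabs_mult. pose proof (Rabs_pos s). pose proof (Rabs_pos t). nra. }
assert (S2 : Rabs (1 + s) <= 3 / 2) by (apply Rabs_le; apply Rabs_le_between in Hs; lra).
pose proof (Rabs_pos (exp s - 1 - s)). pose proof (Rabs_pos (cos t - 1)).
pose proof (Rabs_pos (sin t - t)). pose proof (Rabs_pos (1 + s)).
pose proof (Rabs_pos (cos t)). pose proof (Rabs_pos (sin t)).
eapply Rle_trans; [apply Rplus_le_compat; [apply Rabs_triang|eapply Rle_trans; [apply Rabs_triang|apply Rplus_le_compat_r, Rabs_triang]]|].
rewrite !(Rabs_mult (_ - _)), !(Rabs_mult (1 + s)).
assert (Rabs (exp s - 1 - s) * Rabs (cos t) <= 2 * (r * r)) by nra.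
assert (Rabs (exp s - 1 - s) * Rabs (sin t) <= 2 * (r * r)) by nra.
assert (Rabs (1 + s) * Rabs (cos t - 1) <= 3 / 2 * (r * r)) by nra.
assert (Rabs (1 + s) * Rabs (sin t - t) <= 3 / 2 * (r * r)) by nra.
nra.
Qed.

Lemma cder_cexp u : cder cexp u (cexp u).
Proof.
intros eps Heps. set (A := Cmod (cexp u)).
assert (HA : 0 <= A) by apply Cmod_ge_0.
exists (Rmin (/ 2) (eps / (10 * A + 1))).
split; [apply Rmin_pos; [lra|apply Rdiv_lt_0_compat; lra]|].
intros w Hw. set (h := (w - u)%C) in *.
replace w with (u + h)%C by (unfold h; ring).
rewrite cexp_plus.
replace (cexp u * cexp h - cexp u - h * cexp u)%C
  with (cexp u * (cexp h - 1 - h))%C by ring.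
rewrite Cmod_mult. fold A.
assert (H1 : Cmod h <= / 2) by (eapply Rle_trans; [left; exact Hw|apply Rmin_l]).
assert (H2 : Cmod h * (10 * A + 1) <= eps).
{ apply Rmult_le_reg_r with (/ (10 * A + 1)); [apply Rinv_0_lt_compat; lra|].
  rewrite Rmult_assoc, Rinv_r, Rmult_1_r by lra.
  eapply Rle_trans; [left; exact Hw|apply Rmin_r]. }
pose proof (cexp_quad h H1). pose proof (Cmod_ge_0 h).
apply Rle_trans with (A * (10 * Cmod h * Cmod h)).
- now apply Rmult_le_compat_l.
- nra.
Qed.

(** * Circular means *)

(** Not normalised: this is [2 * PI] times the mean over the circle. *)
Definition cmean (psi : C -> C) (r : R) : C :=
  CInt (fun t => psi (RtoC r * cis t)%C) 0 (2 * PI).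

Lemma Cmod_circle r t : Cmod (RtoC r * cis t) = Rabs r.
Proof. rewrite Cmod_mult, Cmod_cis, Cmod_R. ring. Qed.

Lemma circle_param_continuous f r :
  (forall z, Cmod z = Rabs r -> ccont f z) ->
  forall t eps, 0 < eps -> exists d, 0 < d /\
    forall s, Rabs (s - t) < d -> Cmod (f (RtoC r * cis s)%C - f (RtoC r * cis t)%C) < eps.
Proof.
intros H t eps Heps.
destruct (H (RtoC r * cis t)%C) with (eps := eps) as [d [Hd Hs]]; auto.
{ apply Cmod_circle. }
exists (d / (2 * Rabs r + 1)). pose proof (Rabs_pos r).
split; [apply Rdiv_lt_0_compat; lra|]. intros s Hst. apply Hs.
replace (RtoC r * cis s - RtoC r * cis t)%C with (RtoC r * (cis s - cis t))%C by ring.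
rewrite Cmod_mult, Cmod_R. pose proof (cis_lip s t).
assert (Rabs (s - t) * (2 * Rabs r + 1) < d).
{ apply Rmult_lt_reg_r with (/ (2 * Rabs r + 1)); [apply Rinv_0_lt_compat; lra|].
  rewrite Rmult_assoc, Rinv_r by lra. unfold Rdiv in Hst. lra. }
pose proof (Rabs_pos (s - t)). nra.
Qed.

Lemma ex_cmean psi r :
  (forall z, Cmod z = Rabs r -> ccont psi z) ->
  ex_CInt (fun t => psi (RtoC r * cis t)%C) 0 (2 * PI).
Proof.
intros H. apply ex_CInt_cont. intros t _. now apply circle_param_continuous.
Qed.

Lemma PI2_pos : 0 <= 2 * PI.
Proof. pose proof PI_RGT_0. lra. Qed.

Lemma cmean_bound psi r M :
  (forall z, Cmod z = Rabs r -> ccont psi z) ->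
  (forall t, 0 <= t <= 2 * PI -> Cmod (psi (RtoC r * cis t)%C) <= M) ->
  Cmod (cmean psi r) <= M * (2 * PI).
Proof.
intros H HM. rewrite <- (Rminus_0_r (2 * PI)). apply CInt_bound.
- apply PI2_pos.
- now apply ex_cmean.
- exact HM.
Qed.

(** [psi] composed with [cexp] is integrated around the rectangle with sides [[ln r1, ln r2]] and
    [[0, 2 * PI]]. The horizontal sides cancel by periodicity, and the vertical ones are the two
    circular means. *)
Lemma cmean_const psi r1 r2 :
  0 < r1 -> r1 <= r2 ->
  (forall z, r1 <= Cmod z <= r2 -> exists l, cder psi z l) ->
  cmean psi r1 = cmean psi r2.
Proof.
intros H1 H12 HD. set (F := fun u => psi (cexp u)).
assert (Hmod : forall s t, Cmod (cexp (s, t)) = exp s).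
{ intros s t. unfold cexp; simpl. rewrite Cmod_circle. apply Rabs_pos_eq. left; apply exp_pos. }
assert (Hln : ln r1 <= ln r2) by (apply ln_le; lra).
assert (G : rect_int F (ln r1) (ln r2) 0 (2 * PI) = 0).
{ apply goursat; auto; [apply PI2_pos|]. intros s t Hs Ht.
  destruct (HD (cexp (s, t))) as [l Hl].
  { rewrite Hmod. rewrite <- (exp_ln r1), <- (exp_ln r2) by lra.
    split; apply Rnot_lt_le; intros K; apply exp_lt_inv in K; lra. }
  eexists. apply (cder_comp psi cexp); [apply cder_cexp|exact Hl]. }
unfold rect_int in G.
rewrite (CInt_ext (fun s => F (s, 0%R) - F (s, (2 * PI)%R))%C (fun _ => RtoC 0)) in G.
2:{ intros s _. unfold F, cexp; simpl. rewrite cis_0, cis_2PI. ring. }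
rewrite CInt_const, Cmult_0_r, Cplus_0_l in G.
assert (Hi : forall r, 0 < r -> forall t, F (ln r, t) = psi (RtoC r * cis t)%C).
{ intros r Hr t. unfold F, cexp; simpl. now rewrite exp_ln. }
rewrite (CInt_ext _ (fun t => psi (RtoC r2 * cis t)%C - psi (RtoC r1 * cis t)%C)%C) in G.
2:{ intros t _. rewrite !Hi; auto; lra. }
assert (Hc : forall r, r1 <= r <= r2 -> forall z, Cmod z = Rabs r -> ccont psi z).
{ intros r Hr z Hz. rewrite Rabs_pos_eq in Hz by lra.
  destruct (HD z) as [l Hl]; [lra|]. eapply cder_ccont; eauto. }
rewrite CInt_minus in G.
2:{ apply ex_cmean. apply Hc. lra. } 2:{ apply ex_cmean. apply Hc. lra. }
fold (cmean psi r2) in G. fold (cmean psi r1) in G.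
assert (Hi0 : Ci <> 0) by (intros E; apply (f_equal Im) in E; simpl in E; lra).
replace (cmean psi r1) with (cmean psi r2 - / Ci * (Ci * (cmean psi r2 - cmean psi r1)))%C.
- rewrite G. ring.
- field. auto.
Qed.

(** Local continuity at each point of the circle is made uniform in the angle by compactness of
    [[0, 2 * PI]]. *)
Lemma circle_unif psi r0 :
  (forall z, Cmod z = Rabs r0 -> ccont psi z) ->
  forall eps, 0 < eps -> exists d, 0 < d /\
    forall r t, Rabs (r - r0) < d -> 0 <= t <= 2 * PI ->
      Cmod (psi (RtoC r * cis t)%C - psi (RtoC r0 * cis t)%C) < eps.
Proof.
intros H eps Heps. pose proof (Rabs_pos r0) as P0.
assert (K : forall t, exists e : posreal, forall r s, Rabs (r - r0) < e -> Rabs (s - t) < e ->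
   Cmod (psi (RtoC r * cis s)%C - psi (RtoC r0 * cis t)%C) < eps / 2).
{ intros t. destruct (H (RtoC r0 * cis t)%C (Cmod_circle r0 t) (eps/2)) as [e [He Hs]]; [lra|].
  assert (He' : 0 < e / (2 * Rabs r0 + 2)) by (apply Rdiv_lt_0_compat; lra).
  exists (mkposreal _ He'). simpl. intros r s Hr Hst. apply Hs.
  replace (RtoC r * cis s - RtoC r0 * cis t)%C
    with (RtoC (r - r0) * cis s + RtoC r0 * (cis s - cis t))%C by (rewrite RtoC_minus; ring).
  eapply Rle_lt_trans; [apply Cmod_triangle|].
  rewrite !Cmod_mult, Cmod_cis, !Cmod_R. pose proof (cis_lip s t).
  set (e' := e / (2 * Rabs r0 + 2)) in *.
  assert (e' * (2 * Rabs r0 + 2) = e) by (unfold e'; field; lra).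
  pose proof (Rabs_pos (s - t)). nra. }
apply choice in K. destruct K as [del Hdel].
destruct (compactness_value_1d 0 (2 * PI) del) as [d Hd].
exists d. split; [apply cond_pos|]. intros r t Hr Ht.
(* The compactness lemma yields its covering point only under a double negation; deciding the goal
   first makes it usable. *)
destruct (Rlt_dec (Cmod (psi (RtoC r * cis t)%C - psi (RtoC r0 * cis t)%C)) eps) as [L|L]; auto.
exfalso. apply (Hd t Ht). intros [u [Hu [H1 H2]]]. apply L.
eapply Rle_lt_trans; [apply (Cmod_sub_triangle _ (psi (RtoC r0 * cis u)%C))|].
assert (A := Hdel u r t (Rlt_le_trans _ _ _ Hr H2) H1).
assert (B := Hdel u r0 t).
rewrite Rminus_diag, Rabs_R0 in B. specialize (B (cond_pos _) H1).
rewrite (Cmod_sub_sym (psi (RtoC r0 * cis u)%C)). lra.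
Qed.

Lemma C_eq_of_small (x y : C) : (forall eps, 0 < eps -> Cmod (x - y) <= eps) -> x = y.
Proof.
intros H. replace x with ((x - y) + y)%C by ring.
replace (x - y)%C with (RtoC 0); [ring|]. symmetry. apply Cmod_eq_0.
apply Rle_antisym; [|apply Cmod_ge_0]. apply le_epsilon. intros e He.
rewrite Rplus_0_l. auto.
Qed.

Lemma cmean_continuous psi R0 r0 :
  Rabs r0 < R0 -> (forall z, Cmod z < R0 -> ccont psi z) ->
  forall eps, 0 < eps -> exists d, 0 < d /\
    forall r, Rabs (r - r0) < d -> Cmod (cmean psi r - cmean psi r0) <= eps.
Proof.
intros Hr0 Hc eps Heps. pose proof PI_RGT_0 as HPI.
destruct (circle_unif psi r0) with (eps := eps / (2 * PI)) as [d [Hd H]].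
{ intros z Hz. apply Hc. lra. }
{ apply Rdiv_lt_0_compat; lra. }
exists (Rmin d (R0 - Rabs r0)). split; [apply Rmin_pos; lra|]. intros r Hr.
assert (H1 : Rabs (r - r0) < d) by (eapply Rlt_le_trans; [exact Hr|apply Rmin_l]).
assert (H2 : Rabs (r - r0) < R0 - Rabs r0) by (eapply Rlt_le_trans; [exact Hr|apply Rmin_r]).
assert (H3 : Rabs r < R0).
{ pose proof (Rabs_triang (r - r0) r0). replace (r - r0 + r0) with r in H0 by ring. lra. }
unfold cmean. rewrite <- CInt_minus; try (apply ex_cmean; intros z Hz; apply Hc; lra).
replace eps with (eps / (2 * PI) * (2 * PI - 0)) by (field; lra).
apply CInt_bound; [lra| |].
- apply ex_CInt_minus; apply ex_cmean; intros z Hz; apply Hc; lra.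
- intros t Ht. left. now apply H.
Qed.

Lemma cmean_zero psi : cmean psi 0 = (RtoC (2 * PI) * psi 0)%C.
Proof.
unfold cmean. rewrite (CInt_ext _ (fun _ => psi 0)).
- now rewrite CInt_const, Rminus_0_r.
- intros t _. now rewrite Cmult_0_l.
Qed.

(* The mean is locally constant in the radius off the radii [0] and [sigma], and
   continuous everywhere; so isolated exceptional points do no harm. *)
Lemma mean_value psi R0 sigma r :
  0 <= sigma -> (forall z, Cmod z < R0 -> ccont psi z) ->
  (forall z, 0 < Cmod z < R0 -> Cmod z <> sigma -> exists l, cder psi z l) ->
  0 <= r < R0 -> cmean psi r = (RtoC (2 * PI) * psi 0)%C.
Proof.
intros Hs Hc Hd Hr. rewrite <- cmean_zero.
assert (A : forall r0 r1, 0 <= r0 -> r0 < r1 < R0 -> (sigma <= r0 \/ r1 < sigma) ->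
          cmean psi r1 = cmean psi r0).
{ intros r0 r1 H0 H1 Hor. apply C_eq_of_small. intros eps Heps.
  destruct (cmean_continuous psi R0 r0) with (eps := eps) as [d [Hd0 H]]; auto.
  { rewrite Rabs_pos_eq; lra. }
  (* At radius [r0] itself [psi] may be merely continuous, so the annulus starts slightly above
     it. *)
  set (r' := r0 + Rmin (d / 2) (r1 - r0)).
  assert (B1 : 0 < Rmin (d / 2) (r1 - r0)) by (apply Rmin_pos; lra).
  assert (B2 := Rmin_l (d / 2) (r1 - r0)). assert (B3 := Rmin_r (d / 2) (r1 - r0)).
  rewrite <- (cmean_const psi r' r1).
  - apply H. unfold r'. rewrite Rabs_pos_eq; lra.
  - unfold r'; lra.
  - unfold r'; lra.
  - intros z Hz. apply Hd; unfold r' in Hz; lra. }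
assert (B : 0 <= sigma < R0 -> cmean psi sigma = cmean psi 0).
{ intros Hs'. destruct (Req_dec sigma 0) as [->|n]; auto.
  apply C_eq_of_small. intros eps Heps.
  destruct (cmean_continuous psi R0 sigma) with (eps := eps) as [d [Hd0 H]]; auto.
  { rewrite Rabs_pos_eq; lra. }
  assert (B1 : 0 < Rmin (d / 2) (sigma / 2)) by (apply Rmin_pos; lra).
  assert (B2 := Rmin_l (d / 2) (sigma / 2)). assert (B3 := Rmin_r (d / 2) (sigma / 2)).
  rewrite <- (A 0 (sigma - Rmin (d / 2) (sigma / 2))); try lra.
  rewrite Cmod_sub_sym. apply H.
  rewrite Rabs_left; lra. }
destruct (Req_dec r 0) as [->|n]; auto.
destruct (Rtotal_order r sigma) as [L|[E|G]].
- apply A; lra.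
- rewrite E. apply B; lra.
- rewrite <- B by lra. apply A; lra.
Qed.

(** * Finite sums and complex series *)

Fixpoint csum (a : nat -> C) (n : nat) : C :=
  match n with O => RtoC 0 | S k => (csum a k + a k)%C end.

Lemma csum_ext a b n : (forall k, (k < n)%nat -> a k = b k) -> csum a n = csum b n.
Proof.
induction n as [|n IH]; intros H; simpl; auto. rewrite IH, H; auto.
Qed.

Lemma csum_plus a b n : csum (fun k => a k + b k)%C n = (csum a n + csum b n)%C.
Proof. induction n as [|n IH]; simpl; [ring|]. rewrite IH. ring. Qed.

Lemma csum_scal c a n : csum (fun k => c * a k)%C n = (c * csum a n)%C.
Proof. induction n as [|n IH]; simpl; [ring|]. rewrite IH. ring. Qed.

Lemma csum_S_left a n : csum a (S n) = (a O + csum (fun k => a (S k)) n)%C.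
Proof.
induction n as [|n IH]; [simpl; ring|]. change (csum a (S (S n))) with (csum a (S n) + a (S n))%C.
rewrite IH. simpl. ring.
Qed.

Lemma csum_0 n : csum (fun _ => RtoC 0) n = 0.
Proof. induction n as [|n IH]; simpl; auto. rewrite IH. ring. Qed.

Lemma csum_exchange (a : nat -> nat -> C) n m :
  csum (fun i => csum (fun j => a i j) m) n = csum (fun j => csum (fun i => a i j) n) m.
Proof.
induction n as [|n IH]; simpl; [now rewrite csum_0|].
now rewrite IH, csum_plus.
Qed.

Fixpoint rsum (a : nat -> R) (n : nat) : R :=
  match n with O => 0 | S k => rsum a k + a k end.

Lemma rsum_ext a b n : (forall k, (k < n)%nat -> a k = b k) -> rsum a n = rsum b n.
Proof.
induction n as [|n IH]; intros H; simpl; auto. rewrite IH, H; auto.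
Qed.

Lemma rsum_le a b n : (forall k, (k < n)%nat -> a k <= b k) -> rsum a n <= rsum b n.
Proof.
induction n as [|n IH]; intros H; simpl; [lra|]. apply Rplus_le_compat; auto.
Qed.

Lemma rsum_plus a b n : rsum (fun k => a k + b k) n = rsum a n + rsum b n.
Proof. induction n as [|n IH]; simpl; [ring|]. rewrite IH. ring. Qed.

Lemma rsum_scal c a n : rsum (fun k => c * a k) n = c * rsum a n.
Proof. induction n as [|n IH]; simpl; [ring|]. rewrite IH. ring. Qed.

Lemma rsum_const c n : rsum (fun _ => c) n = INR n * c.
Proof. induction n as [|n IH]; [simpl; ring|]. rewrite S_INR. simpl rsum. rewrite IH. ring. Qed.

Lemma rsum_geom t n : t <> 1 -> rsum (fun k => t ^ k) n = (1 - t ^ n) / (1 - t).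
Proof.
intros H. induction n as [|n IH]; simpl; [field; lra|]. rewrite IH. field. lra.
Qed.

Lemma Cmod_csum_le a n : Cmod (csum a n) <= rsum (fun k => Cmod (a k)) n.
Proof.
induction n as [|n IH]; simpl; [rewrite Cmod_0; lra|].
eapply Rle_trans; [apply Cmod_triangle|]. lra.
Qed.

Lemma csum_re a n : Re (csum a n) = rsum (fun k => Re (a k)) n.
Proof. induction n as [|n IH]; simpl; auto. f_equal. exact IH. Qed.

Definition CSer (a : nat -> C) : C :=
  (Series (fun n => Re (a n)), Series (fun n => Im (a n))).

Lemma Series_geom_rem (u : nat -> R) M t :
  0 <= t < 1 -> (forall n, Rabs (u n) <= M * t ^ n) ->
  forall T, Rabs (Series u - rsum u T) <= M * t ^ T / (1 - t).
Proof.
intros Ht H T.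
assert (Hg : forall c, is_series (fun n => c * t ^ n) (c * / (1 - t))).
{ intros c. apply (is_series_scal (K := R_AbsRing) (V := R_NormedModule) c). apply is_series_geom. rewrite Rabs_pos_eq; lra. }
assert (Ha : ex_series (fun n => Rabs (u n))).
{ apply (ex_series_le (K := R_AbsRing) (V := R_CompleteNormedModule)) with (fun n => M * t ^ n).
  - intros n. unfold norm; simpl. unfold abs; simpl. rewrite Rabs_Rabsolu. apply H.
  - eexists. apply Hg. }
assert (Hu := ex_series_Rabs _ Ha).
assert (E : Series u - rsum u T = Series (fun k => u (T + k)%nat)).
{ destruct T as [|T]; [simpl; rewrite Rminus_0_r; now apply Series_ext|].
  rewrite (Series_incr_n u (S T)); [|lia|auto].
  simpl pred. replace (rsum u (S T)) with (sum_f_R0 u T); [ring|].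
  clear. induction T as [|T IH]; simpl in *; [ring|]. rewrite IH. ring. }
assert (HT : ex_series (fun k => Rabs (u (T + k)%nat))).
{ apply (ex_series_incr_n (fun k => Rabs (u k)) T) in Ha. exact Ha. }
rewrite E. eapply Rle_trans; [now apply Series_Rabs|].
replace (M * t ^ T / (1 - t)) with (Series (fun k => (M * t ^ T) * t ^ k)).
- apply Series_le.
  + intros n. split; [apply Rabs_pos|].
    eapply Rle_trans; [apply H|]. right. rewrite pow_add. ring.
  + eexists. apply Hg.
- apply is_series_unique. apply Hg.
Qed.

Lemma csum_im a n : Im (csum a n) = rsum (fun k => Im (a k)) n.
Proof. induction n as [|n IH]; simpl; auto. f_equal. exact IH. Qed.

(** The factor 2 pays for estimating real and imaginary parts separately. *)
Lemma CSer_rem a M t :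
  0 <= t < 1 -> (forall n, Cmod (a n) <= M * t ^ n) ->
  forall T, Cmod (CSer a - csum a T) <= 2 * M * t ^ T / (1 - t).
Proof.
intros Ht H T. eapply Rle_trans; [apply Cmod_le_abs|].
change (Re (CSer a - csum a T)) with (Series (fun n => Re (a n)) - Re (csum a T)).
change (Im (CSer a - csum a T)) with (Series (fun n => Im (a n)) - Im (csum a T)).
rewrite csum_re, csum_im.
assert (A := Series_geom_rem (fun n => Re (a n)) M t Ht
  (fun n => Rle_trans _ _ _ (re_le_Cmod (a n)) (H n)) T).
assert (B := Series_geom_rem (fun n => Im (a n)) M t Ht
  (fun n => Rle_trans _ _ _ (im_le_Cmod (a n)) (H n)) T).
unfold Rdiv in *. lra.
Qed.

Lemma pow_small t K eps : 0 <= t < 1 -> 0 < eps ->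
  exists N, forall n, (N <= n)%nat -> K * t ^ n <= eps.
Proof.
intros Ht He. destruct (pow_lt_1_zero t) with (y := eps / (Rabs K + 1)) as [N HN].
- rewrite Rabs_pos_eq; lra.
- apply Rdiv_lt_0_compat; auto. pose proof (Rabs_pos K). lra.
- exists N. intros n Hn. specialize (HN n Hn).
  assert (P : 0 <= t ^ n) by (apply pow_le; lra).
  rewrite Rabs_pos_eq in HN by auto.
  pose proof (Rle_abs K). pose proof (Rabs_pos K).
  assert (t ^ n * (Rabs K + 1) <= eps).
  { apply Rmult_le_reg_r with (/ (Rabs K + 1)); [apply Rinv_0_lt_compat; lra|].
    rewrite Rmult_assoc, Rinv_r by lra. unfold Rdiv in HN. lra. }
  nra.
Qed.

Lemma CSer_unique a l M t K :
  0 <= t < 1 -> (forall n, Cmod (a n) <= M * t ^ n) ->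
  (forall T, Cmod (l - csum a T) <= K * t ^ T) -> l = CSer a.
Proof.
intros Ht Ha Hl. apply C_eq_of_small. intros eps Heps.
destruct (pow_small t (K + 2 * M / (1 - t)) eps Ht Heps) as [N HN].
specialize (HN N (le_n N)).
eapply Rle_trans; [apply (Cmod_sub_triangle l (csum a N))|].
rewrite (Cmod_sub_sym (csum a N)).
pose proof (Hl N). pose proof (CSer_rem a M t Ht Ha N).
eapply Rle_trans; [apply Rplus_le_compat; eassumption|].
eapply Rle_trans; [|exact HN]. right. field. lra.
Qed.

(** * Power series *)

Definition PS (b : nat -> C) (z : C) : C := CSer (fun n => b n * z ^ n)%C.

Definition psum (b : nat -> C) (z : C) (T : nat) : C := csum (fun n => b n * z ^ n)%C T.

(** A Cauchy estimate serves as the notion of convergence: it gives a geometric remainder for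
    [Cmod z < rho] that depends on [b] only through [rho] and [M], hence is uniform over families of
    sequences. *)
Definition geo (rho M : R) (b : nat -> C) : Prop :=
  forall n, Cmod (b n) * rho ^ n <= M.

Lemma geo_pos rho M b : geo rho M b -> 0 <= M.
Proof.
intros H. eapply Rle_trans; [|apply (H O)]. simpl. rewrite Rmult_1_r. apply Cmod_ge_0.
Qed.

Lemma geo_term rho M b z n :
  0 < rho -> geo rho M b -> Cmod (b n * z ^ n) <= M * (Cmod z / rho) ^ n.
Proof.
intros Hr H. rewrite Cmod_mult, Cmod_pow.
assert (P : 0 < rho ^ n) by now apply pow_lt.
unfold Rdiv. rewrite Rpow_mult_distr, pow_inv.
replace (Cmod (b n) * Cmod z ^ n) with
  (Cmod (b n) * rho ^ n * (Cmod z ^ n * / rho ^ n)) by (field; lra).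
apply Rmult_le_compat_r; auto.
apply Rmult_le_pos; [apply pow_le, Cmod_ge_0|left; now apply Rinv_0_lt_compat].
Qed.

Lemma div_lt1 a b : 0 <= a < b -> 0 <= a / b < 1.
Proof.
intros H. split; [apply Rdiv_le_0_compat; lra|]. apply Rlt_div_l; lra.
Qed.

Lemma ratio_lt1 z rho : 0 < rho -> Cmod z < rho -> 0 <= Cmod z / rho < 1.
Proof. intros Hr Hz. apply div_lt1. split; auto. apply Cmod_ge_0. Qed.

Lemma PS_rem rho M b z T :
  0 < rho -> geo rho M b -> Cmod z < rho ->
  Cmod (PS b z - psum b z T) <= 2 * M * (Cmod z / rho) ^ T / (1 - Cmod z / rho).
Proof.
intros Hr H Hz. apply CSer_rem; [now apply ratio_lt1|].
intros n. now apply geo_term.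
Qed.

Lemma PS_rem_unif rho M b s z T :
  geo rho M b -> Cmod z <= s < rho ->
  Cmod (PS b z - psum b z T) <= 2 * M / (1 - s / rho) * (s / rho) ^ T.
Proof.
intros H Hz. pose proof (Cmod_ge_0 z). pose proof (geo_pos _ _ _ H).
eapply Rle_trans; [apply (PS_rem rho M); auto; lra|].
destruct (div_lt1 s rho) as [_ S1]; [lra|].
assert (V : 0 <= Cmod z / rho <= s / rho).
{ split; [apply Rdiv_le_0_compat; lra|]. apply Rmult_le_compat_r; [|lra].
  left; apply Rinv_0_lt_compat; lra. }
replace (2 * M * (Cmod z / rho) ^ T / (1 - Cmod z / rho))
  with (2 * M / (1 - Cmod z / rho) * (Cmod z / rho) ^ T) by (field; lra).
assert (0 < / (1 - Cmod z / rho)) by (apply Rinv_0_lt_compat; lra).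
apply Rmult_le_compat; [apply Rdiv_le_0_compat; lra|now apply pow_le| |now apply pow_incr].
apply Rmult_le_compat_l; [lra|]. apply Rinv_le_contravar; lra.
Qed.

Lemma PS_unique rho M b z l K :
  0 < rho -> geo rho M b -> Cmod z < rho ->
  (forall T, Cmod (l - psum b z T) <= K * (Cmod z / rho) ^ T) -> l = PS b z.
Proof.
intros Hr H Hz Hl. apply CSer_unique with M (Cmod z / rho) K; auto.
- now apply ratio_lt1.
- intros n. now apply geo_term.
Qed.

(** * Cauchy's theorem: holomorphic functions are power series *)

Lemma cmean_ext f g r :
  (forall z, Cmod z = Rabs r -> f z = g z) -> cmean f r = cmean g r.
Proof. intros H. apply CInt_ext. intros t _. apply H, Cmod_circle. Qed.

Lemma cmean_plus f g r :
  (forall z, Cmod z = Rabs r -> ccont f z) -> (forall z, Cmod z = Rabs r -> ccont g z) ->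
  cmean (fun z => f z + g z)%C r = (cmean f r + cmean g r)%C.
Proof. intros Hf Hg. apply CInt_plus; now apply ex_cmean. Qed.

Lemma cmean_scal c f r :
  (forall z, Cmod z = Rabs r -> ccont f z) ->
  cmean (fun z => c * f z)%C r = (c * cmean f r)%C.
Proof. intros Hf. apply (CInt_scal c (fun t => f (RtoC r * cis t)%C)). now apply ex_cmean. Qed.

Lemma neq0_of_Cmod (z : C) : 0 < Cmod z -> z <> 0.
Proof. apply Cmod_gt_0. Qed.

Lemma cder_cauchy_kernel (w z : C) : z <> w -> exists l, cder (fun z => z / (z - w))%C z l.
Proof.
intros H. eexists. apply (cder_div (fun z => z) (fun z => z - w)%C).
- apply cder_id.
- apply (cder_minus (fun z => z) (fun _ => w)); [apply cder_id|apply cder_const].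
- now apply Csub_neq0.
Qed.

Lemma neq_of_Cmod_lt z w : Cmod w < Cmod z -> z <> w.
Proof. intros H E. rewrite E in H. lra. Qed.

(** The mean does not change when the radius grows, and the kernel [z / (z - w)] tends to 1 at
    infinity. *)
Lemma kernel_mean w r : Cmod w < r -> cmean (fun z => z / (z - w))%C r = RtoC (2 * PI).
Proof.
intros Hw. pose proof (Cmod_ge_0 w) as Hw0. pose proof PI_RGT_0 as HPI.
apply C_eq_of_small. intros eps Heps.
(* Large enough for [|w / (z - w)| <= eps / (2 * PI)] on the circle of radius [r']. *)
set (r' := r + Cmod w + Cmod w * (2 * PI) / eps).
assert (P : 0 <= Cmod w * (2 * PI) / eps).
{ apply Rmult_le_pos; [nra|left; now apply Rinv_0_lt_compat]. }
assert (Hr' : r <= r') by (unfold r'; lra).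
rewrite (cmean_const _ r r'); auto; try lra.
2:{ intros z Hz. apply cder_cauchy_kernel, neq_of_Cmod_lt. lra. }
unfold cmean. replace (RtoC (2 * PI)) with (RtoC (2 * PI - 0) * 1)%C
  by (rewrite Rminus_0_r; ring).
replace eps with (eps / (2 * PI) * (2 * PI - 0)) by (field; lra).
apply CInt_dev; [lra| |].
- apply (ex_cmean (fun z => z / (z - w))%C). intros z Hz. rewrite Rabs_pos_eq in Hz by lra.
  destruct (cder_cauchy_kernel w z) as [l Hl]; [apply neq_of_Cmod_lt; lra|].
  eapply cder_ccont; eauto.
- intros t _. set (z := (RtoC r' * cis t)%C).
  assert (Hz : Cmod z = r') by (unfold z; rewrite Cmod_circle; apply Rabs_pos_eq; lra).
  assert (Hzw : (z - w)%C <> 0) by (apply Csub_neq0, neq_of_Cmod_lt; lra).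
  replace (z / (z - w) - 1)%C with (w / (z - w))%C by (field; auto).
  rewrite Cmod_div by auto.
  assert (D : Cmod w * (2 * PI) / eps < Cmod (z - w)).
  { pose proof (Cmod_le_sub z w). unfold r' in Hz. lra. }
  assert (D0 : 0 < Cmod (z - w)) by lra.
  apply Rmult_le_reg_r with (Cmod (z - w)); auto.
  unfold Rdiv at 1. rewrite Rmult_assoc, Rinv_l, Rmult_1_r by lra.
  apply Rmult_lt_compat_l with (r := eps / (2 * PI)) in D.
  + replace (eps / (2 * PI) * (Cmod w * (2 * PI) / eps)) with (Cmod w) in D by (field; lra). lra.
  + apply Rdiv_lt_0_compat; lra.
Qed.

Lemma ccont_pow n z : ccont (fun w => w ^ n)%C z.
Proof. destruct (cder_pow n z) as [l H]. eapply cder_ccont; eauto. Qed.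

Lemma cder_invpow n (z : C) : z <> 0 -> exists l, cder (fun w => (/ w) ^ n)%C z l.
Proof.
intros H. destruct (cder_pow n (/ z)%C) as [l Hl]. eexists.
apply (cder_comp (fun w => w ^ n)%C (fun w => / w)%C z l); [|exact Hl].
apply (cder_inv (fun w => w) z 1); [apply cder_id|exact H].
Qed.

Lemma ccont_invpow n (z : C) : z <> 0 -> ccont (fun w => (/ w) ^ n)%C z.
Proof. intros H. destruct (cder_invpow n z H) as [l Hl]. eapply cder_ccont; eauto. Qed.

Definition cauchy_coef (f : C -> C) (r : R) (n : nat) : C :=
  (cmean (fun z => f z * (/ z) ^ n)%C r / RtoC (2 * PI))%C.

Lemma RtoC_2PI_neq0 : RtoC (2 * PI) <> 0.
Proof. intros E. apply RtoC_inj in E. pose proof PI_RGT_0. lra. Qed.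

Lemma Cmod_circle_pos r t : 0 <= r -> Cmod (RtoC r * cis t) = r.
Proof. intros Hr. rewrite Cmod_circle. now apply Rabs_pos_eq. Qed.

Lemma cauchy_coef_bound f r M n :
  0 < r -> (forall z, Cmod z = r -> ccont f z) ->
  (forall t, 0 <= t <= 2 * PI -> Cmod (f (RtoC r * cis t)%C) <= M) ->
  Cmod (cauchy_coef f r n) * r ^ n <= M.
Proof.
intros Hr Hc HM. unfold cauchy_coef. rewrite Cmod_div by apply RtoC_2PI_neq0.
pose proof PI_RGT_0 as HPI. rewrite Cmod_R, (Rabs_pos_eq (2 * PI)) by lra.
assert (Hp : 0 < r ^ n) by now apply pow_lt.
assert (B : Cmod (cmean (fun z => f z * (/ z) ^ n)%C r) <= M / r ^ n * (2 * PI)).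
{ apply cmean_bound.
  - rewrite Rabs_pos_eq by lra; intros z Hz.
    apply ccont_mult; auto. apply ccont_invpow, neq0_of_Cmod. lra.
  - intros t Ht.
    assert (Hz := Cmod_circle_pos r t (Rlt_le _ _ Hr)).
    rewrite Cmod_mult, Cmod_pow, Cmod_inv, Hz by (apply neq0_of_Cmod; lra).
    rewrite pow_inv. apply Rmult_le_compat_r; auto. left; now apply Rinv_0_lt_compat. }
apply Rmult_le_reg_r with (2 * PI * / r ^ n).
- apply Rmult_lt_0_compat; [lra|now apply Rinv_0_lt_compat].
- replace (Cmod (cmean (fun z => f z * (/ z) ^ n)%C r) / (2 * PI) * r ^ n * (2 * PI * / r ^ n))
    with (Cmod (cmean (fun z => f z * (/ z) ^ n)%C r)) by (field; lra).
  unfold Rdiv in B. lra.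
Qed.

(** The factor [z] makes [psi] vanish at [0], so that its mean will be zero. When [w = 0] it cancels
    the denominator, and continuity of [f] is enough there. *)
Lemma difference_quotient_ext f w :
  ccont f w -> (w <> 0 -> exists l, cder f w l) ->
  exists psi, (forall z, z <> w -> psi z = (z * ((f z - f w) / (z - w)))%C) /\
    ccont psi w /\ psi 0 = 0.
Proof.
intros Hc Hd. destruct (Ceq_dec w 0) as [E|n].
- exists (fun z => f z - f w)%C. split; [|split].
  + intros z Hz. rewrite E in *. field. intros K. apply Hz. rewrite <- K. ring.
  + unfold Cminus. apply ccont_plus; auto. apply ccont_const.
  + rewrite E. ring.
- destruct (Hd n) as [l Hl]. apply cder_iff in Hl. destruct Hl as [phi [H1 [H2 H3]]].
  exists (fun z => z * phi z)%C. split; [|split].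
  + intros z Hz. rewrite H3. field. now apply Csub_neq0.
  + apply ccont_mult; auto. apply ccont_id.
  + ring.
Qed.

(** The function [psi] above is differentiable off [0] and [w], so [mean_value] with exceptional
    radius [Cmod w] makes its mean zero. What is left is [f w] times the mean of the kernel. *)
Lemma cauchy_formula f R0 w r :
  (forall z, Cmod z < R0 -> ccont f z) ->
  (forall z, 0 < Cmod z < R0 -> exists l, cder f z l) ->
  Cmod w < r -> r < R0 ->
  cmean (fun z => f z * (z / (z - w)))%C r = (RtoC (2 * PI) * f w)%C.
Proof.
intros Hc Hd Hw Hr. pose proof (Cmod_ge_0 w) as Hw0.
destruct (difference_quotient_ext f w) as [psi [P1 [P2 P3]]].
{ apply Hc. lra. }
{ intros H. apply Hd. split; [now apply Cmod_gt_0|lra]. }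
assert (Q : forall z, Cmod z < R0 -> z <> w -> ccont psi z /\ (0 < Cmod z -> exists l, cder psi z l)).
{ intros z Hz Hzw.
  assert (N : 0 < Cmod (z - w)) by now apply Cmod_gt_0, Csub_neq0.
  assert (X : forall v, Cmod (v - z) < Cmod (z - w) -> (v * ((f v - f w) / (v - w)))%C = psi v).
  { intros v Hv. symmetry. apply P1. intros E. rewrite E, Cmod_sub_sym in Hv. lra. }
  split.
  - apply (ccont_ext_loc _ _ _ _ N X). unfold Cdiv.
    apply ccont_mult; [apply ccont_id|]. apply ccont_mult.
    + unfold Cminus. apply ccont_plus; [now apply Hc|apply ccont_const].
    + apply ccont_inv; [|now apply Csub_neq0]. unfold Cminus.
      apply ccont_plus; [apply ccont_id|apply ccont_const].
  - intros Hz0. destruct (Hd z) as [l Hl]; [lra|]. eexists.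
    apply (cder_ext_loc _ _ _ _ _ N X).
    apply (cder_mult (fun v => v) (fun v => (f v - f w) / (v - w))%C); [apply cder_id|].
    apply (cder_div (fun v => f v - f w)%C (fun v => v - w)%C).
    + apply (cder_minus f (fun _ => f w)); [exact Hl|apply cder_const].
    + apply (cder_minus (fun v => v) (fun _ => w)); [apply cder_id|apply cder_const].
    + now apply Csub_neq0. }
assert (M0 : cmean psi r = 0).
{ rewrite (mean_value psi R0 (Cmod w) r), P3; auto; try lra; [ring| |].
  - intros z Hz. destruct (Ceq_dec z w) as [->|n]; auto. now apply Q.
  - intros z Hz Hzw. apply Q; try lra. intros E. now rewrite E in Hzw. }
assert (D : forall z, Cmod z = Rabs r -> (z - w)%C <> 0).
{ intros z Hz. rewrite Rabs_pos_eq in Hz by lra. apply Csub_neq0, neq_of_Cmod_lt. lra. }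
rewrite (cmean_ext _ (fun z => psi z + f w * (z / (z - w)))%C).
- assert (Ck : forall z, Cmod z = Rabs r -> ccont (fun z => z / (z - w))%C z).
  { intros z Hz. destruct (cder_cauchy_kernel w z) as [l Hl].
    - rewrite Rabs_pos_eq in Hz by lra. apply neq_of_Cmod_lt. lra.
    - eapply cder_ccont; eauto. }
  rewrite cmean_plus, cmean_scal, kernel_mean, M0; auto.
  + ring.
  + intros z Hz. rewrite Rabs_pos_eq in Hz by lra.
    apply Q; [lra|apply neq_of_Cmod_lt; lra].
  + intros z Hz. apply ccont_mult; [apply ccont_const|auto].
- intros z Hz. rewrite P1.
  + field. auto.
  + intros E. apply (D z Hz). rewrite E. ring.
Qed.


Lemma Rabs_Cmod_sub z w : Rabs (Cmod z - Cmod w) <= Cmod (z - w).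
Proof.
pose proof (Cmod_le_sub z w). pose proof (Cmod_le_sub w z).
rewrite (Cmod_sub_sym w z) in H0. apply Rabs_le. lra.
Qed.

Lemma circle_Cmod_continuity f r :
  (forall z, Cmod z = Rabs r -> ccont f z) ->
  forall t, continuity_pt (fun t => Cmod (f (RtoC r * cis t)%C)) t.
Proof.
intros H t eps Heps.
destruct (circle_param_continuous f r H t eps Heps) as [d [Hd Hs]].
exists d. split; auto. intros s [_ Hst]. simpl in *. unfold R_dist in *.
eapply Rle_lt_trans; [apply Rabs_Cmod_sub|]. auto.
Qed.

Lemma circle_bounded f r :
  (forall z, Cmod z = Rabs r -> ccont f z) ->
  exists M, forall t, 0 <= t <= 2 * PI -> Cmod (f (RtoC r * cis t)%C) <= M.
Proof.
intros H. destruct (continuity_ab_maj (fun t => Cmod (f (RtoC r * cis t)%C)) 0 (2 * PI)) as [m [Hm _]].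
- apply PI2_pos.
- intros t _. now apply circle_Cmod_continuity.
- eexists. exact Hm.
Qed.

Lemma circle_min f r :
  (forall z, Cmod z = Rabs r -> ccont f z) -> (forall z, Cmod z = Rabs r -> f z <> 0) ->
  exists m, 0 < m /\ forall t, 0 <= t <= 2 * PI -> m <= Cmod (f (RtoC r * cis t)%C).
Proof.
intros H Hn. destruct (continuity_ab_min (fun t => Cmod (f (RtoC r * cis t)%C)) 0 (2 * PI)) as [m [Hm _]].
- apply PI2_pos.
- intros t _. now apply circle_Cmod_continuity.
- eexists. split; [|exact Hm]. apply Cmod_gt_0, Hn, Cmod_circle.
Qed.

Lemma cauchy_coef_indep f R0 r1 r2 n :
  (forall z, 0 < Cmod z < R0 -> exists l, cder f z l) ->
  0 < r1 -> r1 <= r2 -> r2 < R0 -> cauchy_coef f r1 n = cauchy_coef f r2 n.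
Proof.
intros Hd H1 H12 H2. unfold cauchy_coef. f_equal. apply cmean_const; auto.
intros z Hz. destruct (Hd z) as [l Hl]; [lra|].
destruct (cder_invpow n z) as [m Hm]; [apply neq0_of_Cmod; lra|].
eexists. apply (cder_mult f (fun z => (/ z) ^ n)%C); eauto.
Qed.

(* [E T] is the remainder of order [T] of the geometric expansion of the Cauchy kernel. *)
Lemma cauchy_expansion f R0 w r M :
  (forall z, Cmod z < R0 -> ccont f z) ->
  (forall z, 0 < Cmod z < R0 -> exists l, cder f z l) ->
  (forall t, 0 <= t <= 2 * PI -> Cmod (f (RtoC r * cis t)%C) <= M) ->
  Cmod w < r -> r < R0 ->
  forall T, Cmod (f w - psum (cauchy_coef f r) w T) <= M / (1 - Cmod w / r) * (Cmod w / r) ^ T.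
Proof.
intros Hc Hd HM Hw Hr T. pose proof (Cmod_ge_0 w) as Hw0. pose proof PI_RGT_0 as HPI.
assert (Hr0 : 0 < r) by lra.
set (E := fun T => cmean (fun z => f z * ((w * / z) ^ T * (z / (z - w))))%C r).
assert (Cz : forall z, Cmod z = Rabs r -> z <> 0 /\ (z - w)%C <> 0 /\ ccont f z).
{ intros z Hz. rewrite Rabs_pos_eq in Hz by lra. split; [|split].
  - apply neq0_of_Cmod. lra.
  - apply Csub_neq0, neq_of_Cmod_lt. lra.
  - apply Hc. lra. }
assert (Ck : forall z, Cmod z = Rabs r -> ccont (fun z => z / (z - w))%C z).
{ intros z Hz. destruct (cder_cauchy_kernel w z) as [l Hl].
  - rewrite Rabs_pos_eq in Hz by lra. apply neq_of_Cmod_lt. lra.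
  - eapply cder_ccont; eauto. }
assert (Cp : forall n z, Cmod z = Rabs r -> ccont (fun z => (w * / z) ^ n)%C z).
{ intros n z Hz. apply (ccont_comp (fun v => v ^ n)%C (fun z => w * / z)%C); [|apply ccont_pow].
  apply ccont_mult; [apply ccont_const|]. apply ccont_inv; [apply ccont_id|]. now apply Cz. }
assert (CE : forall n z, Cmod z = Rabs r ->
  ccont (fun z => f z * ((w * / z) ^ n * (z / (z - w))))%C z).
{ intros n z Hz. apply ccont_mult; [now apply Cz|]. apply ccont_mult; auto. }
assert (E0 : E O = (RtoC (2 * PI) * f w)%C).
{ rewrite <- (cauchy_formula f R0 w r Hc Hd Hw Hr). unfold E.
  apply cmean_ext. intros z Hz. simpl. ring. }
assert (ES : forall n, E n = (RtoC (2 * PI) * (cauchy_coef f r n * w ^ n) + E (S n))%C).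
{ intros n.
  replace (RtoC (2 * PI) * (cauchy_coef f r n * w ^ n))%C
    with (cmean (fun z => w ^ n * (f z * (/ z) ^ n))%C r).
  2:{ rewrite cmean_scal.
      - unfold cauchy_coef. field. apply RtoC_2PI_neq0.
      - intros z Hz. apply ccont_mult; [now apply Cz|]. apply ccont_invpow. now apply Cz. }
  unfold E. rewrite <- cmean_plus; auto.
  - apply cmean_ext. intros z Hz. destruct (Cz z Hz) as [Z1 [Z2 _]].
    rewrite Cpow_S, !Cpow_mult_l. field. auto.
  - intros z Hz. apply ccont_mult; [apply ccont_const|].
    apply ccont_mult; [now apply Cz|]. apply ccont_invpow. now apply Cz. }
assert (EE : forall n, (RtoC (2 * PI) * (f w - psum (cauchy_coef f r) w n))%C = E n).
{ induction n as [|n IH].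
  - rewrite E0. unfold psum; simpl. ring.
  - unfold psum in *; simpl. rewrite ES in IH.
    replace (E (S n)) with ((RtoC (2 * PI) * (cauchy_coef f r n * w ^ n) + E (S n))
      - RtoC (2 * PI) * (cauchy_coef f r n * w ^ n))%C by ring.
    rewrite <- IH. ring. }
assert (B : Cmod (E T) <= M / (1 - Cmod w / r) * (Cmod w / r) ^ T * (2 * PI)).
{ unfold E. apply cmean_bound; [exact (CE T)|]. intros t Ht. set (z := (RtoC r * cis t)%C).
  assert (Hz : Cmod z = r) by (apply Cmod_circle_pos; lra).
  destruct (Cz z) as [Z1 [Z2 _]]; [rewrite Hz, Rabs_pos_eq; lra|].
  rewrite !Cmod_mult, Cmod_pow, Cmod_mult, Cmod_inv, Cmod_div, Hz by auto.
  fold (Cmod w / r).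
  assert (D : r - Cmod w <= Cmod (z - w)) by (pose proof (Cmod_le_sub z w); lra).
  assert (Pt : 0 <= (Cmod w / r) ^ T).
  { apply pow_le. apply Rmult_le_pos; auto. left; now apply Rinv_0_lt_compat. }
  specialize (HM t Ht). fold z in HM. pose proof (Cmod_ge_0 (f z)) as F0.
  assert (K : r / Cmod (z - w) <= / (1 - Cmod w / r)).
  { replace (/ (1 - Cmod w / r)) with (r / (r - Cmod w)) by (field; lra).
    apply Rmult_le_compat_l; [lra|]. apply Rinv_le_contravar; lra. }
  assert (K0 : 0 <= r / Cmod (z - w)).
  { apply Rmult_le_pos; [lra|]. left; apply Rinv_0_lt_compat; lra. }
  replace (M / (1 - Cmod w / r) * (Cmod w / r) ^ T)
    with (M * ((Cmod w / r) ^ T * / (1 - Cmod w / r))) by (unfold Rdiv; ring).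
  apply Rmult_le_compat; auto.
  - now apply Rmult_le_pos.
  - now apply Rmult_le_compat_l. }
rewrite <- EE, Cmod_mult, Cmod_R, Rabs_pos_eq in B by lra.
apply Rmult_le_reg_r with (2 * PI); lra.
Qed.

(** Only continuity is asked at [0], which is what a difference quotient such as [f z / z] offers
    there. The last clause ties the coefficient bound to the size of [f] on one circle and so makes
    it uniform over families of functions. *)
Theorem holomorphic_power_series f R0 :
  0 < R0 ->
  (forall z, Cmod z < R0 -> ccont f z) ->
  (forall z, 0 < Cmod z < R0 -> exists l, cder f z l) ->
  exists b,
    (forall z, Cmod z < R0 -> f z = PS b z) /\
    (forall r, 0 < r < R0 -> exists M, geo r M b) /\
    (forall r M, 0 < r < R0 ->
      (forall t, 0 <= t <= 2 * PI -> Cmod (f (RtoC r * cis t)%C) <= M) -> geo r M b).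
Proof.
intros HR Hc Hd. set (b := cauchy_coef f (R0 / 2)).
assert (I : forall r n, 0 < r < R0 -> cauchy_coef f r n = b n).
{ intros r n Hr. unfold b. destruct (Rle_dec r (R0 / 2)).
  - apply (cauchy_coef_indep f R0); auto; lra.
  - symmetry. apply (cauchy_coef_indep f R0); auto; lra. }
assert (G : forall r M, 0 < r < R0 ->
      (forall t, 0 <= t <= 2 * PI -> Cmod (f (RtoC r * cis t)%C) <= M) -> geo r M b).
{ intros r M Hr HM n. rewrite <- (I r) by auto. apply cauchy_coef_bound; auto; try lra.
  intros z Hz. apply Hc. lra. }
assert (X : forall r, 0 < r < R0 -> exists M, forall t, 0 <= t <= 2 * PI -> Cmod (f (RtoC r * cis t)%C) <= M).
{ intros r Hr. apply circle_bounded. intros z Hz. rewrite Rabs_pos_eq in Hz by lra. apply Hc. lra. }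
exists b. split; [|split; [|exact G]].
- intros w Hw. pose proof (Cmod_ge_0 w).
  set (r := (Cmod w + R0) / 2). assert (Hr : 0 < r < R0) by (unfold r; lra).
  destruct (X r Hr) as [M HM].
  apply PS_unique with r M (M / (1 - Cmod w / r)); auto; try (unfold r; lra).
  intros T. assert (A := cauchy_expansion f R0 w r M Hc Hd HM).
  specialize (A ltac:(unfold r; lra) ltac:(lra) T).
  eapply Rle_trans; [|exact A]. right. do 2 f_equal.
  unfold psum. apply csum_ext. intros k _. now rewrite I.
- intros r Hr. destruct (X r Hr) as [M HM]. eauto.
Qed.

(** * Calculus of power series *)

Lemma Cmod_limit_le (X : C) (x : nat -> C) B K t :
  0 <= t < 1 -> (forall T, Cmod (X - x T) <= K * t ^ T) ->
  (forall T, Cmod (x T) <= B) -> Cmod X <= B.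
Proof.
intros Ht H1 H2. apply le_epsilon. intros e He.
destruct (pow_small t K e Ht He) as [N HN]. specialize (HN N (le_n N)).
pose proof (Cmod_le_sub X (x N)). specialize (H1 N). specialize (H2 N). lra.
Qed.

Lemma PS_0 rho M b : 0 < rho -> geo rho M b -> PS b 0 = b O.
Proof.
intros Hr H. symmetry. apply PS_unique with rho M (Cmod (b O)); auto.
- rewrite Cmod_0; auto.
- intros T. rewrite Cmod_0. unfold Rdiv. rewrite Rmult_0_l.
  destruct T as [|T].
  + unfold psum; simpl. rewrite Rmult_1_r. right. f_equal. ring.
  + unfold psum. rewrite csum_S_left.
    rewrite (csum_ext _ (fun _ => RtoC 0)), csum_0.
    * simpl Cpow. rewrite pow_i by lia.
      replace (b O - (b O * 1 + 0))%C with (RtoC 0) by ring. rewrite Cmod_0. lra.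
    * intros k _. rewrite Cpow_S. ring.
Qed.

Definition shift (b : nat -> C) (n : nat) : C := b (S n).

Lemma geo_shift rho M b : 0 < rho -> geo rho M b -> geo rho (M / rho) (shift b).
Proof.
intros Hr H n. unfold shift. specialize (H (S n)). simpl in H.
apply Rmult_le_reg_r with rho; auto. unfold Rdiv. rewrite (Rmult_assoc M), Rinv_l; lra.
Qed.

Lemma psum_S b z T : psum b z (S T) = (b O + z * psum (shift b) z T)%C.
Proof.
unfold psum. rewrite csum_S_left, <- csum_scal.
f_equal; [simpl; ring|]. apply csum_ext. intros k _. unfold shift. rewrite Cpow_S. ring.
Qed.

Lemma PS_rem_S rho M b z T :
  0 < rho -> geo rho M b -> Cmod z < rho ->
  Cmod (PS b z - psum b z (S T)) <= 2 * M / (1 - Cmod z / rho) * (Cmod z / rho) ^ T.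
Proof.
intros Hr H Hz. eapply Rle_trans; [now apply (PS_rem rho M)|].
destruct (ratio_lt1 z rho Hr Hz) as [t0 t1].
pose proof (geo_pos _ _ _ H). unfold Rdiv at 1. rewrite <- tech_pow_Rmult.
assert (P : 0 <= (Cmod z / rho) ^ T) by now apply pow_le.
assert (Q : 0 < / (1 - Cmod z / rho)) by (apply Rinv_0_lt_compat; lra).
assert (A : 0 <= 2 * M * / (1 - Cmod z / rho) * (Cmod z / rho) ^ T).
{ repeat apply Rmult_le_pos; lra. }
unfold Rdiv at 3. nra.
Qed.

(** Identities such as [PS_shift] and [quot_identity] are checked on partial sums and pass to the
    limit here. *)
Lemma Cmod_limit_eq (X Y : C) (x : nat -> C) K L t :
  0 <= t < 1 -> (forall T, Cmod (X - x T) <= K * t ^ T) ->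
  (forall T, Cmod (Y - x T) <= L * t ^ T) -> X = Y.
Proof.
intros Ht H1 H2. apply C_eq_of_small. intros e He.
destruct (pow_small t (K + L) e Ht He) as [N HN]. specialize (HN N (le_n N)).
eapply Rle_trans; [apply (Cmod_sub_triangle X (x N))|]. rewrite (Cmod_sub_sym (x N)).
specialize (H1 N). specialize (H2 N). lra.
Qed.

Lemma PS_shift rho M b z :
  0 < rho -> geo rho M b -> Cmod z < rho -> PS b z = (b O + z * PS (shift b) z)%C.
Proof.
intros Hr H Hz. set (t := Cmod z / rho).
apply (Cmod_limit_eq _ _ (fun T => psum b z (S T)) (2 * M / (1 - t))
  (Cmod z * (2 * (M / rho) / (1 - t))) t).
- now apply ratio_lt1.
- intros T. now apply PS_rem_S.
- intros T. rewrite psum_S.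
  replace (b O + z * PS (shift b) z - (b O + z * psum (shift b) z T))%C
    with (z * (PS (shift b) z - psum (shift b) z T))%C by ring.
  rewrite Cmod_mult, Rmult_assoc. apply Rmult_le_compat_l; [apply Cmod_ge_0|].
  eapply Rle_trans; [apply (PS_rem rho (M / rho)); auto; now apply geo_shift|].
  fold t. unfold Rdiv. right. ring.
Qed.

(** Each of the [n + 1] powers [x ^ k] with [k <= n] is at least [x ^ n], and together they stay
    below the geometric series. *)
Lemma lin_geom x n : 0 <= x < 1 -> INR (S n) * x ^ n <= / (1 - x).
Proof.
intros Hx. apply Rle_trans with (rsum (fun k => x ^ k) (S n)).
- rewrite <- rsum_const. apply rsum_le. intros k Hk.
  replace n with (k + (n - k))%nat by lia. rewrite pow_add.
  rewrite <- (Rmult_1_r (x ^ k)) at 2. apply Rmult_le_compat_l; [now apply pow_le|].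
  rewrite <- (pow1 (n - k)). apply pow_incr. lra.
- rewrite rsum_geom by lra. unfold Rdiv. rewrite <- (Rmult_1_l (/ (1 - x))) at 2.
  apply Rmult_le_compat_r; [left; apply Rinv_0_lt_compat; lra|].
  assert (0 <= x ^ S n) by (apply pow_le; lra). lra.
Qed.

Lemma geo_deg rho rho' M b :
  0 < rho' < rho -> geo rho M b ->
  geo rho' (M / (1 - rho' / rho)) (fun n => RtoC (INR (S n)) * b n)%C.
Proof.
intros Hr H n. rewrite Cmod_mult, Cmod_R, Rabs_pos_eq by apply pos_INR.
assert (Hx : 0 <= rho' / rho < 1).
{ apply div_lt1. lra. }
pose proof (lin_geom _ n Hx) as L. specialize (H n).
replace (INR (S n) * Cmod (b n) * rho' ^ n)
  with ((Cmod (b n) * rho ^ n) * (INR (S n) * (rho' / rho) ^ n)).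
- apply Rmult_le_compat; auto.
  + apply Rmult_le_pos; [apply Cmod_ge_0|apply pow_le; lra].
  + apply Rmult_le_pos; [apply pos_INR|apply pow_le; lra].
- unfold Rdiv. rewrite Rpow_mult_distr, pow_inv. field. apply pow_nonzero. lra.
Qed.

Definition dcoef (b : nat -> C) (n : nat) : C := (RtoC (INR (S n)) * b (S n))%C.

Lemma geo_le rho rho' M b : 0 <= rho' <= rho -> geo rho M b -> geo rho' M b.
Proof.
intros Hr H n. eapply Rle_trans; [|apply H].
apply Rmult_le_compat_l; [apply Cmod_ge_0|]. now apply pow_incr.
Qed.

Lemma geo_dcoef rho rho' M b :
  0 < rho' < rho -> geo rho M b -> exists M', geo rho' M' (dcoef b).
Proof.
intros Hr H. eexists. unfold dcoef.
apply (geo_deg rho rho' (M / rho) (shift b)); auto. apply geo_shift; auto. lra.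
Qed.

Definition pow_rem (z w : C) (n : nat) : C :=
  (w ^ n - z ^ n - (w - z) * (RtoC (INR n) * z ^ pred n))%C.

Lemma pow_rem_S z w n :
  pow_rem z w (S n) = (w * pow_rem z w n + (w - z) * (w - z) * (RtoC (INR n) * z ^ pred n))%C.
Proof.
unfold pow_rem. rewrite S_INR, RtoC_plus. destruct n as [|n].
- simpl. ring.
- simpl pred. rewrite !Cpow_S. ring.
Qed.

(** Multiplying by [s ^ 2] avoids the exponent [n - 2]. The square of [n + 1] is generous compared
    with [n (n - 1) / 2] and leaves room in the induction along [pow_rem_S]. *)
Lemma pow_rem_bound z w s n :
  0 < s -> Cmod z <= s -> Cmod w <= s ->
  Cmod (pow_rem z w n) * s ^ 2 <= Cmod (w - z) ^ 2 * (INR (S n) * (INR (S n) * s ^ n)).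
Proof.
intros Hs Hz Hw. set (d := Cmod (w - z)).
assert (Hd : 0 <= d) by apply Cmod_ge_0.
induction n as [|n IH].
- unfold pow_rem. simpl pred. simpl INR.
  replace (w ^ 0 - z ^ 0 - (w - z) * (RtoC 0 * z ^ 0))%C with (RtoC 0) by (simpl; ring).
  rewrite Cmod_0. simpl. nra.
- rewrite pow_rem_S.
  assert (Z : Cmod (z ^ pred n) * INR n * s <= INR n * s ^ n).
  { rewrite Cmod_pow. destruct n as [|n]; [simpl; lra|]. simpl pred.
    assert (Cmod z ^ n <= s ^ n) by (apply pow_incr; split; auto; apply Cmod_ge_0).
    pose proof (pos_INR (S n)). simpl pow.
    replace (INR (S n) * (s * s ^ n)) with (s ^ n * INR (S n) * s) by ring.
    apply Rmult_le_compat_r; [lra|]. now apply Rmult_le_compat_r. }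
  assert (B : Cmod (w * pow_rem z w n + (w - z) * (w - z) * (RtoC (INR n) * z ^ pred n))
     <= s * Cmod (pow_rem z w n) + d * d * (Cmod (z ^ pred n) * INR n)).
  { eapply Rle_trans; [apply Cmod_triangle|]. rewrite !Cmod_mult, Cmod_R.
    rewrite (Rabs_pos_eq (INR n)) by apply pos_INR. fold d.
    pose proof (Cmod_ge_0 (pow_rem z w n)).
    apply Rplus_le_compat; [now apply Rmult_le_compat_r|right; ring]. }
  apply Rle_trans with ((s * Cmod (pow_rem z w n) + d * d * (Cmod (z ^ pred n) * INR n)) * s ^ 2).
  { apply Rmult_le_compat_r; auto. apply pow_le; lra. }
  set (P := Cmod (pow_rem z w n)) in *. set (q := Cmod (z ^ pred n)) in *.
  rewrite !S_INR in *. pose proof (pos_INR n) as Pn. set (m := INR n) in *.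
  assert (Sn : 0 <= s ^ n) by (apply pow_le; lra).
  simpl pow in *. set (x := s ^ n) in *. rewrite Rmult_1_r in *.
  assert (A1 : s * (P * (s * s)) <= s * (d * d * ((m + 1) * ((m + 1) * x)))).
  { apply Rmult_le_compat_l; lra. }
  assert (A2 : d * d * s * (q * m * s) <= d * d * s * (m * x)).
  { apply Rmult_le_compat_l; auto. repeat apply Rmult_le_pos; lra. }
  assert (A3 : 0 <= d * d * (s * x)) by (repeat apply Rmult_le_pos; lra).
  nra.
Qed.

Lemma rsum_geom_bound (u : nat -> R) M t T :
  0 <= t < 1 -> 0 <= M -> (forall n, u n <= M * t ^ n) -> rsum u T <= M / (1 - t).
Proof.
intros Ht HM H. apply Rle_trans with (rsum (fun n => M * t ^ n) T); [now apply rsum_le|].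
rewrite rsum_scal, rsum_geom by lra. unfold Rdiv.
apply Rmult_le_compat_l; auto.
rewrite <- (Rmult_1_l (/ (1 - t))) at 2.
apply Rmult_le_compat_r; [left; apply Rinv_0_lt_compat; lra|].
assert (0 <= t ^ T) by (apply pow_le; lra). lra.
Qed.

Lemma psum_rem_pow b z w T :
  (psum b w (S T) - psum b z (S T) - (w - z) * psum (dcoef b) z T)%C
  = csum (fun n => b n * pow_rem z w n)%C (S T).
Proof.
induction T as [|T IH].
- unfold psum, pow_rem; simpl. ring.
- unfold psum in *.
  change (csum (fun n => b n * pow_rem z w n)%C (S (S T))) with
   (csum (fun n => b n * pow_rem z w n)%C (S T) + b (S T) * pow_rem z w (S T))%C.
  rewrite <- IH. cbn [csum]. unfold dcoef, pow_rem. change (pred (S T)) with T. ring.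
Qed.

(** Termwise, the error of the linear approximation is [pow_rem]; summed, these errors are at most a
    constant times [|w - z|^2]. *)
Lemma PS_cder rho M b z :
  0 < rho -> geo rho M b -> Cmod z < rho -> cder (PS b) z (PS (dcoef b) z).
Proof.
intros Hr H Hz. pose proof (Cmod_ge_0 z) as Hz0.
(* Radii [Cmod z < s < s1 < s2 < rho]: two uses of [geo_deg] absorb the two factors [n + 1] of
   [pow_rem_bound], and the ratio [s / s1] makes the sum converge. *)
set (s := (2 * Cmod z + rho) / 3). set (s2 := (Cmod z + 2 * rho) / 3).
set (s1 := (s + s2) / 2).
assert (Hs : 0 < s < s1 /\ s1 < s2 < rho /\ Cmod z < s) by (unfold s1, s, s2; lra).
assert (G1 := geo_deg rho s2 M b ltac:(lra) H).
assert (G2 := geo_deg s2 s1 _ _ ltac:(lra) G1).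
set (M2 := M / (1 - s2 / rho) / (1 - s1 / s2)) in G2.
destruct (geo_dcoef rho s2 M b ltac:(lra) H) as [M' HM'].
set (t := s / s1).
assert (Ht : 0 <= t < 1).
{ apply div_lt1. lra. }
assert (M20 := geo_pos _ _ _ G2).
set (K := M2 / (1 - t) / s ^ 2).
assert (Q : 0 <= K).
{ unfold K. apply Rdiv_le_0_compat; [apply Rdiv_le_0_compat; lra|]. apply pow_lt; lra. }
assert (B : forall w, Cmod w < s ->
  Cmod (PS b w - PS b z - (w - z) * PS (dcoef b) z) <= K * Cmod (w - z) ^ 2).
{ intros w Hw. pose proof (Cmod_ge_0 w) as Hw0.
  set (t2 := s / s2).
  assert (Ht2 : 0 <= t2 < 1).
  { apply div_lt1. lra. }
  assert (TT : forall c N v T, geo s2 N c -> Cmod v < s ->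
     Cmod (PS c v - psum c v T) <= 2 * N / (1 - t2) * t2 ^ T).
  { intros c N v T HN Hv. apply PS_rem_unif; auto. lra. }
  assert (Gb := geo_le rho s2 M b ltac:(lra) H).
  apply (Cmod_limit_le _ (fun T => psum b w (S T) - psum b z (S T) - (w - z) * psum (dcoef b) z T)%C
    _ (2 * (2 * M / (1 - t2)) + Cmod (w - z) * (2 * M' / (1 - t2))) t2); auto.
  - intros T.
    replace (PS b w - PS b z - (w - z) * PS (dcoef b) z
       - (psum b w (S T) - psum b z (S T) - (w - z) * psum (dcoef b) z T))%C
    with ((PS b w - psum b w (S T)) - (PS b z - psum b z (S T))
       - (w - z) * (PS (dcoef b) z - psum (dcoef b) z T))%C by ring.
    eapply Rle_trans; [apply Cmod_sub_le|].
    eapply Rle_trans; [apply Rplus_le_compat_r, Cmod_sub_le|].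
    rewrite Cmod_mult.
    assert (X1 := TT b M w (S T) Gb Hw). assert (X2 := TT b M z (S T) Gb ltac:(lra)).
    assert (X3 := TT (dcoef b) M' z T HM' ltac:(lra)).
    pose proof (Cmod_ge_0 (w - z)). pose proof (geo_pos _ _ _ H) as M0.
    assert (Y : 2 * M / (1 - t2) * t2 ^ S T <= 2 * M / (1 - t2) * t2 ^ T).
    { apply Rmult_le_compat_l.
      - unfold Rdiv. apply Rmult_le_pos; [lra|]. left; apply Rinv_0_lt_compat; lra.
      - simpl. assert (0 <= t2 ^ T) by (apply pow_le; lra). nra. }
    apply (Rmult_le_compat_l (Cmod (w - z))) in X3; auto. lra.
  - intros T. rewrite psum_rem_pow.
    eapply Rle_trans; [apply Cmod_csum_le|].
    apply Rle_trans with (rsum (fun n => Cmod (w - z) ^ 2 / s ^ 2 * (M2 * t ^ n)) (S T)).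
    + apply rsum_le. intros n _. rewrite Cmod_mult.
      assert (PB := pow_rem_bound z w s n ltac:(lra) ltac:(lra) ltac:(lra)).
      specialize (G2 n). cbv beta in G2. rewrite !Cmod_mult, Cmod_R in G2.
      rewrite (Rabs_pos_eq (INR (S n))) in G2 by apply pos_INR.
      assert (S2 : 0 < s ^ 2) by (apply pow_lt; lra).
      assert (S1n : 0 < s1 ^ n) by (apply pow_lt; lra).
      assert (Sn : 0 < s ^ n) by (apply pow_lt; lra).
      apply Rmult_le_reg_r with (s ^ 2); auto.
      replace (Cmod (w - z) ^ 2 / s ^ 2 * (M2 * t ^ n) * s ^ 2) with
        (Cmod (w - z) ^ 2 * (M2 * t ^ n)) by (field; lra).
      apply Rle_trans with (Cmod (b n) * (Cmod (w - z) ^ 2 * (INR (S n) * (INR (S n) * s ^ n)))).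
      * rewrite Rmult_assoc. apply Rmult_le_compat_l; auto. apply Cmod_ge_0.
      * replace (Cmod (b n) * (Cmod (w - z) ^ 2 * (INR (S n) * (INR (S n) * s ^ n)))) with
         (Cmod (w - z) ^ 2 * ((INR (S n) * (INR (S n) * Cmod (b n)) * s1 ^ n) * t ^ n)).
        { apply Rmult_le_compat_l; [apply pow2_ge_0|].
          apply Rmult_le_compat_r; auto. apply pow_le; lra. }
        unfold t, Rdiv. rewrite Rpow_mult_distr, pow_inv. field. lra.
    + rewrite rsum_scal.
      apply Rle_trans with (Cmod (w - z) ^ 2 / s ^ 2 * (M2 / (1 - t))).
      * apply Rmult_le_compat_l.
        { unfold Rdiv. apply Rmult_le_pos; [apply pow2_ge_0|].
          left; apply Rinv_0_lt_compat, pow_lt; lra. }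
        apply rsum_geom_bound; auto. intros n. lra.
      * unfold K. right. field. repeat split; try lra. }
intros eps Heps.
exists (Rmin (s - Cmod z) (eps / (K + 1))).
split; [apply Rmin_pos; [lra|apply Rdiv_lt_0_compat; lra]|]. intros w Hw.
assert (W1 : Cmod (w - z) < s - Cmod z) by (eapply Rlt_le_trans; [exact Hw|apply Rmin_l]).
assert (W2 : Cmod (w - z) * (K + 1) <= eps).
{ apply Rmult_le_reg_r with (/ (K + 1)); [apply Rinv_0_lt_compat; lra|].
  rewrite Rmult_assoc, Rinv_r, Rmult_1_r by lra.
  left. eapply Rlt_le_trans; [exact Hw|apply Rmin_r]. }
eapply Rle_trans; [apply B; pose proof (Cmod_le_sub w z); lra|].
pose proof (Cmod_ge_0 (w - z)). simpl. nra.
Qed.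

(** * Averages over roots of unity *)

Definition root (N j : nat) : C := cis (2 * PI * INR j / INR N).

Definition avg (N : nat) (f : nat -> C) : C := (csum f N / RtoC (INR N))%C.

Lemma cis_pow t n : (cis t ^ n)%C = cis (INR n * t).
Proof.
induction n as [|n IH].
- simpl. now rewrite Rmult_0_l, cis_0.
- rewrite Cpow_S, IH, S_INR, Rmult_plus_distr_r, Rmult_1_l, Rplus_comm, cis_plus. reflexivity.
Qed.

Lemma Cmod_root N j : Cmod (root N j) = 1.
Proof. apply Cmod_cis. Qed.

Lemma root_conj N j : (root N j * Cconj (root N j))%C = 1.
Proof. rewrite <- Cmod2_conj, Cmod_root. f_equal. ring. Qed.

Lemma cis_eq1 t : 0 < t < 2 * PI -> cis t <> 1.
Proof.
intros Ht E. apply (f_equal Re) in E. simpl in E.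
assert (S : 0 < sin (t / 2)) by (apply sin_gt_0; lra).
replace t with (2 * (t / 2)) in E by field. rewrite cos_2a_sin in E. nra.
Qed.

Lemma RtoC_INR_neq0 N : (0 < N)%nat -> RtoC (INR N) <> 0.
Proof. intros H E. apply RtoC_inj in E. apply lt_0_INR in H. lra. Qed.

Lemma csum_geom c n : ((1 - c) * csum (fun k => c ^ k) n)%C = (1 - c ^ n)%C.
Proof.
induction n as [|n IH]; simpl; [ring|].
rewrite Cmult_plus_distr_l, IH. ring.
Qed.

Lemma csum_root_pow N d : (0 < d < N)%nat -> csum (fun j => root N j ^ d)%C N = 0.
Proof.
intros Hd. set (c := cis (2 * PI * INR d / INR N)).
assert (HN : 0 < INR N) by (apply lt_0_INR; lia).
rewrite (csum_ext _ (fun j => c ^ j)%C).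
2:{ intros j _. unfold root, c. rewrite !cis_pow. f_equal. field. lra. }
assert (Hc : c <> 1).
{ apply cis_eq1. pose proof PI_RGT_0.
  assert (0 < INR d) by (apply lt_0_INR; lia). assert (INR d < INR N) by (apply lt_INR; lia).
  split.
  - apply Rdiv_lt_0_compat; auto. nra.
  - apply Rmult_lt_reg_r with (INR N); auto. unfold Rdiv.
    rewrite Rmult_assoc, Rinv_l by lra. nra. }
assert (HcN : (c ^ N)%C = 1).
{ unfold c. rewrite cis_pow. replace (INR N * (2 * PI * INR d / INR N)) with (INR d * (2 * PI)) by (field; lra).
  rewrite <- cis_pow, cis_2PI. apply Cpow_1_l. }
assert (H1c : (1 - c)%C <> 0) by (apply Csub_neq0; auto).
assert (G := csum_geom c N). rewrite HcN in G.
replace (csum (fun j => c ^ j)%C N) with ((1 - c) * csum (fun j => c ^ j)%C N / (1 - c))%C by (field; auto).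
rewrite G. field. auto.
Qed.

Lemma csum_conj a n : Cconj (csum a n) = csum (fun k => Cconj (a k)) n.
Proof.
induction n as [|n IH]; simpl.
- apply injective_projections; simpl; ring.
- now rewrite Cplus_conj, IH.
Qed.

Lemma csum_const c n : csum (fun _ => c) n = (RtoC (INR n) * c)%C.
Proof.
induction n as [|n IH]; [simpl; ring|]. cbn [csum]. rewrite IH, S_INR, RtoC_plus. ring.
Qed.

Lemma Cconj_RtoC x : Cconj (RtoC x) = x.
Proof. apply injective_projections; simpl; ring. Qed.

Lemma avg_conj N f : (0 < N)%nat -> Cconj (avg N f) = avg N (fun j => Cconj (f j)).
Proof.
intros HN. unfold avg. rewrite Cdiv_conj, csum_conj, Cconj_RtoC; auto.
now apply RtoC_INR_neq0.
Qed.

Lemma avg_plus N f g : (0 < N)%nat -> avg N (fun j => f j + g j)%C = (avg N f + avg N g)%C.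
Proof. intros HN. unfold avg. rewrite csum_plus. field. now apply RtoC_INR_neq0. Qed.

Lemma avg_scal N c f : (0 < N)%nat -> avg N (fun j => c * f j)%C = (c * avg N f)%C.
Proof. intros HN. unfold avg. rewrite csum_scal. field. now apply RtoC_INR_neq0. Qed.

Lemma avg_ext N f g : (forall j, (j < N)%nat -> f j = g j) -> avg N f = avg N g.
Proof. intros H. unfold avg. now rewrite (csum_ext f g). Qed.

Lemma avg_const N c : (0 < N)%nat -> avg N (fun _ => c) = c.
Proof. intros HN. unfold avg. rewrite csum_const. field. now apply RtoC_INR_neq0. Qed.

Lemma avg_bound N f B :
  (0 < N)%nat -> (forall j, (j < N)%nat -> Cmod (f j) <= B) -> Cmod (avg N f) <= B.
Proof.
intros HN H. unfold avg. rewrite Cmod_div by now apply RtoC_INR_neq0.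
assert (P := lt_0_INR N HN). rewrite Cmod_R, Rabs_pos_eq by lra.
apply Rmult_le_reg_r with (INR N); auto. unfold Rdiv. rewrite Rmult_assoc, Rinv_l, Rmult_1_r by lra.
eapply Rle_trans; [apply Cmod_csum_le|].
rewrite Rmult_comm, <- rsum_const. now apply rsum_le.
Qed.

Lemma avg_sub_bound N f g e :
  (0 < N)%nat -> (forall j, (j < N)%nat -> Cmod (f j - g j) <= e) ->
  Cmod (avg N f - avg N g) <= e.
Proof.
intros HN H. replace (avg N f - avg N g)%C with (avg N (fun j => f j - g j)%C).
- now apply avg_bound.
- unfold Cminus. rewrite avg_plus by auto. f_equal.
  rewrite (avg_ext N _ (fun j => (-(1)) * g j)%C) by (intros; ring).
  rewrite avg_scal by auto. ring.
Qed.

Lemma avg_csum N (f : nat -> nat -> C) T : (0 < N)%nat ->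
  avg N (fun j => csum (fun n => f n j) T) = csum (fun n => avg N (f n)) T.
Proof.
intros HN. induction T as [|T IH]; simpl; [now apply avg_const|].
now rewrite avg_plus, IH.
Qed.

Lemma avg_root_pow N d : (0 < d < N)%nat -> avg N (fun j => root N j ^ d)%C = 0.
Proof.
intros H. unfold avg. rewrite csum_root_pow by auto. field. apply RtoC_INR_neq0. lia.
Qed.

Lemma avg_root_conj N m n : (m < N)%nat -> (n < N)%nat ->
  avg N (fun j => root N j ^ m * Cconj (root N j) ^ n)%C = if Nat.eq_dec m n then 1 else 0.
Proof.
intros Hm Hn.
assert (U : forall j k, (root N j ^ k * Cconj (root N j) ^ k)%C = 1).
{ intros j k. rewrite <- Cpow_mult_l, root_conj. apply Cpow_1_l. }
destruct (Compare_dec.lt_eq_lt_dec m n) as [[L|E]|G].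
- destruct (Nat.eq_dec m n); [lia|].
  rewrite (avg_ext N _ (fun j => Cconj (root N j ^ (n - m)))).
  + rewrite <- avg_conj, avg_root_pow by lia. apply injective_projections; simpl; ring.
  + intros j _. replace n with (m + (n - m))%nat at 1 by lia.
    rewrite Cpow_add_r, Cmult_assoc, U, Cpow_conj. ring.
- destruct (Nat.eq_dec m n); [|lia]. subst.
  rewrite (avg_ext N _ (fun _ => RtoC 1)); [apply avg_const; lia|]. intros; apply U.
- destruct (Nat.eq_dec m n); [lia|].
  rewrite (avg_ext N _ (fun j => root N j ^ (m - n))%C); [apply avg_root_pow; lia|].
  intros j _. replace m with (n + (m - n))%nat at 1 by lia.
  rewrite Cpow_add_r.
  transitivity (root N j ^ n * Cconj (root N j) ^ n * root N j ^ (m - n))%C; [ring|].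
  rewrite U. ring.
Qed.

Lemma Cmod_conj_root_pow N j p : Cmod (Cconj (root N j) ^ p) = 1.
Proof. rewrite Cmod_pow, Cmod_conj, Cmod_root. apply pow1. Qed.

Lemma Cmod_root_pow N j p : Cmod (root N j ^ p) = 1.
Proof. rewrite Cmod_pow, Cmod_root. apply pow1. Qed.

Lemma csum_delta (a : nat -> C) p T : (p < T)%nat ->
  csum (fun n => a n * (if Nat.eq_dec n p then 1 else 0))%C T = a p.
Proof.
intros H. induction T as [|T IH]; [lia|]. simpl.
destruct (Nat.eq_dec T p) as [->|n].
- rewrite (csum_ext _ (fun _ => RtoC 0)), csum_0; [ring|].
  intros k Hk. destruct (Nat.eq_dec k p); [lia|ring].
- rewrite IH by lia. ring.
Qed.

Lemma Cmod_scaled_root r N j : 0 <= r -> Cmod (RtoC r * root N j) = r.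
Proof. intros Hr. rewrite Cmod_mult, Cmod_root, Cmod_R, Rabs_pos_eq; lra. Qed.

Lemma avg_psum N b r T (phi : nat -> C) : (0 < N)%nat ->
  avg N (fun j => psum b (RtoC r * root N j) T * phi j)%C
  = csum (fun n => b n * RtoC r ^ n * avg N (fun j => root N j ^ n * phi j))%C T.
Proof.
intros HN.
rewrite (avg_ext N _ (fun j => csum (fun n => b n * RtoC r ^ n * (root N j ^ n * phi j)) T)%C).
- rewrite (avg_csum N (fun n j => b n * RtoC r ^ n * (root N j ^ n * phi j))%C) by auto.
  apply csum_ext. intros n _. now rewrite avg_scal.
- intros j _. unfold psum. rewrite Cmult_comm, <- csum_scal.
  apply csum_ext. intros n _. rewrite Cpow_mult_l. ring.
Qed.

(** Roots of unity confuse frequencies that agree modulo [N], but the terms of order about [N] and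
    beyond are geometrically small. [N0] is chosen before [b] and [phi], which later depend on [N]
    and on the node. *)
Lemma alias_error rho M r p eps :
  0 < r < rho -> 0 <= M -> 0 < eps -> exists N0, (p < N0)%nat /\ forall N, (N0 <= N)%nat ->
    forall b (phi : nat -> C), geo rho M b -> (forall j, Cmod (phi j) <= 1) ->
    forall T, (N - p <= T)%nat ->
    Cmod (avg N (fun j => PS b (RtoC r * root N j) * phi j)%C
          - csum (fun n => b n * RtoC r ^ n * avg N (fun j => root N j ^ n * phi j))%C T) <= eps.
Proof.
intros Hr HM Heps. set (t := r / rho).
assert (Ht : 0 <= t < 1).
{ apply div_lt1. lra. }
destruct (pow_small t (2 * M / (1 - t)) eps Ht Heps) as [N0 HN0].
exists (S (N0 + p)). split; [lia|]. intros N HN b phi Hb Hphi T HT.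
rewrite <- avg_psum by lia. apply avg_sub_bound; [lia|]. intros j _.
replace (PS b (RtoC r * root N j) * phi j - psum b (RtoC r * root N j) T * phi j)%C
  with ((PS b (RtoC r * root N j) - psum b (RtoC r * root N j) T) * phi j)%C by ring.
rewrite Cmod_mult. rewrite <- (Rmult_1_r eps).
apply Rmult_le_compat; auto; try apply Cmod_ge_0.
eapply Rle_trans; [apply (PS_rem rho M); auto; [lra|]; rewrite Cmod_scaled_root; lra|].
rewrite Cmod_scaled_root by lra. fold t.
eapply Rle_trans; [|apply (HN0 T); lia]. right. unfold Rdiv. ring.
Qed.

Lemma alias_pos rho M r p eps :
  0 < r < rho -> 0 <= M -> 0 < eps -> exists N0, (0 < N0)%nat /\ forall N, (N0 <= N)%nat ->
    forall b, geo rho M b ->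
    Cmod (avg N (fun j => PS b (RtoC r * root N j) * Cconj (root N j) ^ p)%C - b p * RtoC r ^ p) <= eps.
Proof.
intros Hr HM Heps. destruct (alias_error rho M r p eps Hr HM Heps) as [N0 [H0 H]].
exists (S N0). split; [lia|]. intros N HN b Hb.
specialize (H N ltac:(lia) b (fun j => Cconj (root N j) ^ p)%C Hb).
specialize (H ltac:(intros; cbv beta; rewrite Cmod_conj_root_pow; lra) N ltac:(lia)).
rewrite (csum_ext _ (fun n => b n * RtoC r ^ n * (if Nat.eq_dec n p then 1 else 0))%C) in H.
- rewrite csum_delta in H by lia. exact H.
- intros n Hn. rewrite avg_root_conj by lia. reflexivity.
Qed.

Lemma alias_neg rho M r p eps :
  (0 < p)%nat ->
  0 < r < rho -> 0 <= M -> 0 < eps -> exists N0, (0 < N0)%nat /\ forall N, (N0 <= N)%nat ->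
    forall b, geo rho M b ->
    Cmod (avg N (fun j => PS b (RtoC r * root N j) * root N j ^ p)%C) <= eps.
Proof.
intros Hp Hr HM Heps. destruct (alias_error rho M r p eps Hr HM Heps) as [N0 [H0 H]].
exists (S N0). split; [lia|]. intros N HN b Hb.
specialize (H N ltac:(lia) b (fun j => root N j ^ p)%C Hb).
(* Cut at [N - p], so that every remaining frequency [n + p] lies strictly between [0] and [N] and
   averages to zero. *)
specialize (H ltac:(intros; cbv beta; rewrite Cmod_root_pow; lra) (N - p)%nat ltac:(lia)).
rewrite (csum_ext _ (fun n => RtoC 0)%C), csum_0 in H.
- unfold Cminus in H. rewrite Copp_0, Cplus_0_r in H. exact H.
- intros n Hn. rewrite (avg_ext N _ (fun j => root N j ^ (n + p))%C).
  + rewrite avg_root_pow by lia. ring.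
  + intros j _. now rewrite Cpow_add_r.
Qed.

Lemma RtoC_Re z : RtoC (Re z) = (/ 2 * (z + Cconj z))%C.
Proof.
rewrite re_alt. unfold Cdiv. ring.
Qed.

Lemma C2_neq0 : RtoC 2 <> 0.
Proof. intros E. apply RtoC_inj in E. lra. Qed.

Lemma Cmod_half x y e : Cmod x <= e -> Cmod y <= e -> Cmod (/ 2 * (x + y)) <= e.
Proof.
intros Hx Hy. rewrite Cmod_mult, Cmod_inv, Cmod_R, Rabs_pos_eq by (try apply C2_neq0; lra).
pose proof (Cmod_triangle x y). lra.
Qed.

(** The real part is half the sum of the series and its conjugate. The conjugate carries frequencies
    at most zero, so it is invisible at [p > 0]. *)
Lemma row_pos rho M r p eps :
  (0 < p)%nat ->
  0 < r < rho -> 0 <= M -> 0 < eps -> exists N0, (0 < N0)%nat /\ forall N, (N0 <= N)%nat ->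
    forall b, geo rho M b ->
    Cmod (avg N (fun j => RtoC (Re (PS b (RtoC r * root N j))) * Cconj (root N j) ^ p)%C
          - / 2 * (b p * RtoC r ^ p)) <= eps.
Proof.
intros Hp Hr HM Heps.
destruct (alias_pos rho M r p eps Hr HM Heps) as [N1 [P1 H1]].
destruct (alias_neg rho M r p eps Hp Hr HM Heps) as [N2 [P2 H2]].
exists (N1 + N2)%nat. split; [lia|]. intros N HN b Hb.
specialize (H1 N ltac:(lia) b Hb). specialize (H2 N ltac:(lia) b Hb).
rewrite (avg_ext N _ (fun j => / 2 * (PS b (RtoC r * root N j) * Cconj (root N j) ^ p
    + Cconj (PS b (RtoC r * root N j) * root N j ^ p)))%C).
2:{ intros j _. rewrite RtoC_Re, Cmult_conj, Cpow_conj. ring. }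
rewrite avg_scal, avg_plus, <- avg_conj by lia.
match goal with |- Cmod (?h * (?x + ?y) - ?h * ?z)%C <= _ =>
  replace (h * (x + y) - h * z)%C with (h * ((x - z) + y))%C by ring end.
apply Cmod_half; auto. now rewrite Cmod_conj.
Qed.

Lemma row_neg rho M r p eps :
  (0 < p)%nat ->
  0 < r < rho -> 0 <= M -> 0 < eps -> exists N0, (0 < N0)%nat /\ forall N, (N0 <= N)%nat ->
    forall b, geo rho M b ->
    Cmod (avg N (fun j => RtoC (Re (PS b (RtoC r * root N j))) * root N j ^ p)%C
          - / 2 * (Cconj (b p) * RtoC r ^ p)) <= eps.
Proof.
intros Hp Hr HM Heps. destruct (row_pos rho M r p eps Hp Hr HM Heps) as [N0 [P0 H]].
exists N0. split; auto. intros N HN b Hb. specialize (H N HN b Hb).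
rewrite <- Cmod_conj. rewrite Cminus_conj, avg_conj by lia.
rewrite !Cmult_conj, Cpow_conj, Cconj_conj, Cinv_conj, !Cconj_RtoC by apply C2_neq0.
erewrite avg_ext; [exact H|]. intros j _. cbv beta.
now rewrite Cmult_conj, Cconj_RtoC, Cpow_conj.
Qed.

Lemma row_zero rho M r eps :
  0 < r < rho -> 0 <= M -> 0 < eps -> exists N0, (0 < N0)%nat /\ forall N, (N0 <= N)%nat ->
    forall b, geo rho M b ->
    Cmod (avg N (fun j => RtoC (Re (PS b (RtoC r * root N j)))) - RtoC (Re (b O))) <= eps.
Proof.
intros Hr HM Heps. destruct (alias_pos rho M r O eps Hr HM Heps) as [N0 [P0 H]].
exists N0. split; auto. intros N HN b Hb. specialize (H N HN b Hb).
assert (E : avg N (fun j => PS b (RtoC r * root N j) * Cconj (root N j) ^ 0)%C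
   = avg N (fun j => PS b (RtoC r * root N j))) by (apply avg_ext; intros; simpl; ring).
rewrite E in H. clear E.
rewrite (avg_ext N _ (fun j => / 2 * (PS b (RtoC r * root N j) + Cconj (PS b (RtoC r * root N j))))%C)
  by (intros; apply RtoC_Re).
rewrite avg_scal, avg_plus, <- avg_conj by lia.
rewrite RtoC_Re. simpl Cpow in H. rewrite Cmult_1_r in H.
match goal with |- Cmod (?h * (?x + ?y) - ?h * (?z + ?w))%C <= _ =>
  replace (h * (x + y) - h * (z + w))%C with (h * ((x - z) + (y - w)))%C by ring end.
apply Cmod_half; auto. now rewrite <- Cminus_conj, Cmod_conj.
Qed.

(** * Vanishing derivatives and logarithms of moduli *)

(** The mean value theorem needs real values; [g] stands for [Re] and for [Im]. *)
Lemma segment_component (g : C -> R) H z0 z :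
  (forall u, Rabs (g u) <= Cmod u) -> (forall u v, g (u - v)%C = g u - g v) ->
  (forall t, 0 <= t <= 1 -> cder H (z0 + RtoC t * (z - z0))%C 0) -> g (H z) = g (H z0).
Proof.
intros Hg Hl Hd. set (p := fun t => (z0 + RtoC t * (z - z0))%C).
set (phi := fun t => g (H (p t))).
assert (D : forall t, 0 <= t <= 1 -> is_derive phi t 0).
{ intros t Ht. apply is_derive_Reals. intros e He.
  set (K := Cmod (z - z0) + 1). assert (HK : 0 < K) by (unfold K; pose proof (Cmod_ge_0 (z - z0)); lra).
  destruct (Hd t Ht (e / (2 * K))) as [d [Hd0 Hw]]; [apply Rdiv_lt_0_compat; lra|].
  assert (Hdk : 0 < d / K) by (apply Rdiv_lt_0_compat; lra).
  exists (mkposreal _ Hdk). simpl. intros h Hh Hhd.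
  assert (P : (p (t + h)%R - p t)%C = (RtoC h * (z - z0))%C) by (unfold p; rewrite RtoC_plus; ring).
  assert (Hm : Cmod (p (t + h)%R - p t) <= Rabs h * K).
  { rewrite P, Cmod_mult, Cmod_R. apply Rmult_le_compat_l; [apply Rabs_pos|unfold K; lra]. }
  assert (Hhk : Rabs h * K < d).
  { apply Rmult_lt_reg_r with (/ K); [now apply Rinv_0_lt_compat|].
    rewrite Rmult_assoc, Rinv_r by lra. unfold Rdiv in Hhd. lra. }
  specialize (Hw (p (t + h)%R)). fold (p t) in Hw. specialize (Hw ltac:(lra)).
  rewrite Cmult_0_r in Hw. unfold Cminus in Hw at 1. rewrite Copp_0, Cplus_0_r in Hw.
  rewrite Rminus_0_r. unfold phi. rewrite <- Hl. unfold Rdiv. rewrite Rabs_mult, Rabs_inv.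
  assert (Hh0 : 0 < Rabs h) by now apply Rabs_pos_lt.
  apply Rmult_lt_reg_r with (Rabs h); auto. rewrite Rmult_assoc, Rinv_l, Rmult_1_r by lra.
  eapply Rle_lt_trans; [apply Hg|]. eapply Rle_lt_trans; [exact Hw|].
  apply Rle_lt_trans with (e / (2 * K) * (Rabs h * K)).
  - apply Rmult_le_compat_l; auto. left. apply Rdiv_lt_0_compat; lra.
  - replace (e / (2 * K) * (Rabs h * K)) with (e * Rabs h / 2) by (field; lra). nra. }
destruct (MVT_gen phi 0 1 (fun _ => 0)) as [c [_ E]].
- intros x Hx. rewrite Rmin_left, Rmax_right in Hx by lra. apply D. lra.
- intros x Hx. rewrite Rmin_left, Rmax_right in Hx by lra.
  apply continuity_pt_filterlim. apply (ex_derive_continuous (V := R_NormedModule) phi).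
  exists 0. now apply D.
- unfold phi in E. replace (p 1) with z in E by (unfold p; ring).
  replace (p 0) with z0 in E by (unfold p; ring). lra.
Qed.

Lemma cder_zero_const H z0 z :
  (forall t, 0 <= t <= 1 -> cder H (z0 + RtoC t * (z - z0))%C 0) -> H z = H z0.
Proof.
intros Hd. apply injective_projections.
- apply (segment_component Re); auto; apply re_le_Cmod.
- apply (segment_component Im); auto; apply im_le_Cmod.
Qed.

Lemma segment_in_ball z0 z d t :
  Cmod (z - z0) < d -> 0 <= t <= 1 -> Cmod (z0 + RtoC t * (z - z0) - z0) < d.
Proof.
intros Hz Ht. replace (z0 + RtoC t * (z - z0) - z0)%C with (RtoC t * (z - z0))%C by ring.
rewrite Cmod_mult, Cmod_R, Rabs_pos_eq by lra. pose proof (Cmod_ge_0 (z - z0)). nra.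
Qed.

Lemma cder_congr f z l m : l = m -> cder f z l -> cder f z m.
Proof. now intros ->. Qed.

(** Coefficients of the antiderivative that vanishes at [0]. *)
Definition icoef (c : nat -> C) (n : nat) : C :=
  match n with O => RtoC 0 | S k => (c k / RtoC (INR (S k)))%C end.

Lemma dcoef_icoef c n : dcoef (icoef c) n = c n.
Proof. unfold dcoef, icoef. field. apply RtoC_INR_neq0. lia. Qed.

Lemma geo_icoef rho M c : 0 < rho -> geo rho M c -> geo rho (M * rho) (icoef c).
Proof.
intros Hr H n. pose proof (geo_pos _ _ _ H). destruct n as [|k].
- simpl. rewrite Cmod_0. nra.
- simpl icoef. rewrite Cmod_div by (apply (RtoC_INR_neq0 (S k)); lia).
  rewrite Cmod_R, Rabs_pos_eq by apply (pos_INR (S k)).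
  change (match k with O => 1 | S _ => INR k + 1 end) with (INR (S k)).
  assert (1 <= INR (S k)) by (rewrite S_INR; pose proof (pos_INR k); lra).
  specialize (H k).
  replace (Cmod (c k) / INR (S k) * rho ^ S k) with (Cmod (c k) * rho ^ k * rho * / INR (S k)) by (simpl pow; field; lra).
  assert (Q : / INR (S k) <= 1) by (rewrite <- Rinv_1; apply Rinv_le_contravar; lra).
  assert (Q0 : 0 < / INR (S k)) by (apply Rinv_0_lt_compat; lra).
  assert (X : 0 <= Cmod (c k) * rho ^ k) by (apply Rmult_le_pos; [apply Cmod_ge_0|apply pow_le; lra]).
  rewrite <- (Rmult_1_r (M * rho)). apply Rmult_le_compat; auto; try lra.
  - apply Rmult_le_pos; lra.
  - apply Rmult_le_compat_r; lra.
Qed.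

Lemma PS_ext b c z : (forall n, b n = c n) -> PS b z = PS c z.
Proof.
intros H. unfold PS, CSer. f_equal; apply Series_ext; intros n; now rewrite H.
Qed.

Lemma Cmod_cexp u : Cmod (cexp u) = exp (Re u).
Proof. unfold cexp. rewrite Cmod_circle. apply Rabs_pos_eq. left; apply exp_pos. Qed.

Lemma cexp_0 : cexp 0 = 1.
Proof. unfold cexp. simpl. rewrite exp_0, cis_0. ring. Qed.

(* [G exp(-L)] has vanishing derivative when [L' = G'/G]. *)
Lemma log_modulus G G' c rho M :
  0 < rho -> geo rho M c ->
  (forall z, Cmod z < rho -> cder G z (G' z) /\ G' z = (PS c z * G z)%C) ->
  G 0 = 1 ->
  forall z, Cmod z < rho -> Cmod (G z) = exp (Re (PS (icoef c) z)).
Proof.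
intros Hr Hc HG G0 z Hz.
assert (Gi := geo_icoef _ _ _ Hr Hc).
set (H := fun w => (G w * cexp ((-(1)) * PS (icoef c) w))%C).
assert (E : H z = H 0).
{ apply cder_zero_const. intros t Ht.
  assert (B := segment_in_ball 0 z rho t).
  replace (z - 0)%C with z in * by ring. specialize (B Hz Ht).
  replace (0 + RtoC t * z - 0)%C with (0 + RtoC t * z)%C in B by ring.
  set (w := (0 + RtoC t * z)%C) in *.
  destruct (HG w B) as [D1 D2].
  eapply cder_congr; [|apply (cder_mult G (fun w => cexp ((-(1)) * PS (icoef c) w))%C); [exact D1|]].
  2:{ apply (cder_comp cexp (fun w => (-(1)) * PS (icoef c) w)%C).
      - apply cder_scal. apply PS_cder with rho (M * rho); auto.
      - apply cder_cexp. }
  rewrite (PS_ext (dcoef (icoef c)) c) by apply dcoef_icoef.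
  rewrite D2. ring. }
assert (H0 : H 0 = 1).
{ unfold H. rewrite G0, (PS_0 rho (M * rho)) by auto. simpl icoef.
  rewrite Cmult_0_r, cexp_0. ring. }
rewrite H0 in E. apply (f_equal Cmod) in E. unfold H in E.
rewrite Cmod_mult, Cmod_cexp, Cmod_1 in E.
replace (Re (-(1) * PS (icoef c) z)) with (- Re (PS (icoef c) z)) in E by (simpl; ring).
rewrite exp_Ropp in E. assert (P := exp_pos (Re (PS (icoef c) z))).
replace (Cmod (G z)) with ((Cmod (G z) * / exp (Re (PS (icoef c) z))) * exp (Re (PS (icoef c) z))) by (field; lra).
rewrite E. ring.
Qed.

(** * Injective holomorphic maps have non-vanishing derivative *)

Lemma diff_quotient_cder f phi c w l :
  (forall v, (f v - f c = (v - c) * phi v)%C) -> w <> c -> cder f w l ->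
  exists l', cder phi w l'.
Proof.
intros Hp Hn Hf. assert (N := Csub_neq0 _ _ Hn). eexists.
apply (cder_ext_loc (fun v => (f v - f c) / (v - c))%C phi w _ (Cmod (w - c))).
- now apply Cmod_gt_0.
- intros v Hv. rewrite Hp. field. apply Csub_neq0. intros E. rewrite E, Cmod_sub_sym in Hv. lra.
- apply (cder_div (fun v => f v - f c)%C (fun v => v - c)%C).
  + apply (cder_minus f (fun _ => f c)); [exact Hf|apply cder_const].
  + apply (cder_minus (fun v => v) (fun _ => c)); [apply cder_id|apply cder_const].
  + exact N.
Qed.

Lemma cder_shift f c v l : cder f (c + v)%C l -> cder (fun v => f (c + v))%C v l.
Proof.
intros H. replace l with ((0 + 1) * l)%C by ring.
apply (cder_comp f (fun v => c + v)%C); auto.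
apply (cder_plus (fun _ => c) (fun v => v)); [apply cder_const|apply cder_id].
Qed.

Lemma ccont_shift f c v : ccont f (c + v)%C -> ccont (fun v => f (c + v))%C v.
Proof.
intros H. apply (ccont_comp f (fun v => c + v)%C); auto.
apply ccont_plus; [apply ccont_const|apply ccont_id].
Qed.

(* If [f'(c) = 0 <> f'(c')], the mean value property of the reciprocal difference
   quotient at [c'] bounds [|c - c'|] by a multiple of [|f c - f c'|]. *)
Lemma injective_derivative_neq0 f f' :
  (forall z, Cmod z < 1 -> cder f z (f' z)) ->
  (forall z w, Cmod z < 1 -> Cmod w < 1 -> f z = f w -> z = w) ->
  forall c, Cmod c < 1 -> f' c <> 0.
Proof.
intros Hd Hinj c Hc E. set (s := (1 - Cmod c) / 2).
assert (Hs : 0 < s) by (unfold s; lra).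
assert (In : forall v, Cmod v < 2 * s -> Cmod (c + v) < 1).
{ intros v Hv. pose proof (Cmod_triangle c v). unfold s in Hv. lra. }
destruct (circle_min (fun v => f (c + v)%C - f c)%C s) as [m [Hm Hmin]].
{ intros v Hv. rewrite Rabs_pos_eq in Hv by lra. unfold Cminus.
  apply ccont_plus; [|apply ccont_const]. apply ccont_shift.
  eapply cder_ccont. apply Hd, In. lra. }
{ intros v Hv K. rewrite Rabs_pos_eq in Hv by lra.
  assert (X : (c + v)%C = c).
  { apply Hinj; auto; [apply In; lra|].
    replace (f (c + v)%C) with ((f (c + v) - f c) + f c)%C by ring. rewrite K. ring. }
  assert (v = 0) by (replace v with ((c + v) - c)%C by ring; rewrite X; ring).
  subst v. rewrite Cmod_0 in Hv. lra. }
assert (Hdc := Hd c Hc). rewrite E in Hdc.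
destruct (cder_ccont _ _ _ Hdc (m / 2)) as [d1 [Hd1 C1]]; [lra|].
(* The [6 * s] is twice the [3 * s] of [B1] below: together they would give [m <= m / 2]. *)
destruct (Hdc (m / (6 * s))) as [d2 [Hd2 C2]]; [apply Rdiv_lt_0_compat; lra|].
set (eta := Rmin (Rmin d1 d2) (s / 2)).
assert (Heta : 0 < eta /\ eta <= d1 /\ eta <= d2 /\ eta <= s / 2).
{ unfold eta. repeat split.
  - repeat apply Rmin_pos; lra.
  - eapply Rle_trans; [apply Rmin_l|apply Rmin_l].
  - eapply Rle_trans; [apply Rmin_l|apply Rmin_r].
  - apply Rmin_r. }
(* Once the derivative vanishes on a whole neighbourhood of [c], [f] is constant there, which
   contradicts injectivity. *)
assert (Z : forall c', Cmod (c' - c) < eta -> f' c' = 0).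
{ intros c' Hc'. destruct (Ceq_dec (f' c') 0) as [|n]; auto. exfalso.
  assert (Hcc : Cmod c' < 1).
  { replace c' with (c + (c' - c))%C by ring. apply In. lra. }
  assert (Ne : c' <> c) by (intros K; rewrite K in n; auto).
  assert (Hd' := Hd c' Hcc). apply cder_iff in Hd'.
  destruct Hd' as [phi [P1 [P2 P3]]].
  assert (Pn : forall z, Cmod z < 1 -> phi z <> 0).
  { intros z Hz K. destruct (Ceq_dec z c') as [->|nz]; [congruence|].
    apply nz. apply Hinj; auto. specialize (P3 z). rewrite K, Cmult_0_r in P3.
    replace (f z) with ((f z - f c') + f c')%C by ring. rewrite P3. ring. }
  set (psi := fun v => (/ phi (c + v))%C).
  assert (MV : cmean psi s = (RtoC (2 * PI) * psi 0)%C).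
  { apply (mean_value psi (2 * s) (Cmod (c' - c)) s); try lra; [apply Cmod_ge_0| |].
    - intros v Hv. apply ccont_inv; [|now apply Pn, In].
      apply ccont_shift. destruct (Ceq_dec (c + v)%C c') as [->|nv]; auto.
      destruct (diff_quotient_cder f phi c' (c + v)%C (f' (c + v)%C)) as [l' Hl']; auto.
      eapply cder_ccont; eauto.
    - intros v Hv Hv'. assert (nv : (c + v)%C <> c').
      { intros K. apply Hv'. rewrite <- K. f_equal. ring. }
      destruct (diff_quotient_cder f phi c' (c + v)%C (f' (c + v)%C)) as [l' Hl']; auto.
      { apply Hd, In. lra. }
      eexists. apply (cder_inv (fun v => phi (c + v))%C); [apply cder_shift; exact Hl'|].
      apply Pn, In. lra. }
  assert (Bd : Cmod (cmean psi s) <= 3 * s / m * (2 * PI)).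
  { apply cmean_bound.
    - intros v Hv. rewrite Rabs_pos_eq in Hv by lra.
      apply ccont_inv; [|apply Pn, In; lra]. apply ccont_shift.
      destruct (Ceq_dec (c + v)%C c') as [->|nv]; auto.
      destruct (diff_quotient_cder f phi c' (c + v)%C (f' (c + v)%C)) as [l' Hl']; auto.
      { apply Hd, In; lra. }
      eapply cder_ccont; eauto.
    - intros t Ht. set (v := (RtoC s * cis t)%C).
      assert (Hv : Cmod v = s) by (apply Cmod_circle_pos; lra).
      specialize (Hmin t Ht). fold v in Hmin.
      assert (L1 : m / 2 <= Cmod (f (c + v)%C - f c')).
      { assert (Cmod (f c' - f c) < m / 2) by (apply C1; lra).
        pose proof (Cmod_sub_triangle (f (c + v)%C) (f c') (f c)). lra. }
      rewrite (P3 (c + v)%C), Cmod_mult in L1.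
      assert (L2 : Cmod (c + v - c') <= 3 / 2 * s).
      { replace (c + v - c')%C with (v - (c' - c))%C by ring.
        pose proof (Cmod_sub_le v (c' - c)). lra. }
      assert (Pp : 0 < Cmod (phi (c + v)%C)) by (apply Cmod_gt_0, Pn, In; lra).
      unfold psi. rewrite Cmod_inv by (apply Pn, In; lra).
      apply Rmult_le_reg_r with (Cmod (phi (c + v)%C) * m); [now apply Rmult_lt_0_compat|].
      replace (/ Cmod (phi (c + v)%C) * (Cmod (phi (c + v)%C) * m)) with m by (field; lra).
      replace (3 * s / m * (Cmod (phi (c + v)%C) * m)) with (3 * s * Cmod (phi (c + v)%C)) by (field; lra).
      nra. }
  rewrite MV, Cmod_mult, Cmod_R in Bd. pose proof PI_RGT_0 as HPI.
  rewrite Rabs_pos_eq in Bd by lra. unfold psi in Bd.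
  replace (c + 0)%C with c in Bd by ring.
  rewrite Cmod_inv in Bd by now apply Pn.
  assert (Pc : 0 < Cmod (phi c)) by (apply Cmod_gt_0; now apply Pn).
  assert (B1 : m <= 3 * s * Cmod (phi c)).
  { assert (B2 : / Cmod (phi c) <= 3 * s / m).
    { apply Rmult_le_reg_r with (2 * PI); lra. }
    apply Rmult_le_compat_r with (r := Cmod (phi c) * m) in B2; [|nra].
    replace (/ Cmod (phi c) * (Cmod (phi c) * m)) with m in B2 by (field; lra).
    replace (3 * s / m * (Cmod (phi c) * m)) with (3 * s * Cmod (phi c)) in B2 by (field; lra). lra. }
  assert (B3 := C2 c' ltac:(lra)). rewrite Cmult_0_r in B3.
  unfold Cminus in B3 at 1. rewrite Copp_0, Cplus_0_r in B3.
  rewrite Cmod_sub_sym, (P3 c), Cmod_mult, Cmod_sub_sym in B3.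
  assert (Pcc : 0 < Cmod (c' - c)) by (apply Cmod_gt_0, Csub_neq0; auto).
  assert (B4 : Cmod (phi c) <= m / (6 * s)) by (apply Rmult_le_reg_l with (Cmod (c' - c)); lra).
  apply Rmult_le_compat_l with (r := 6 * s) in B4; [|lra].
  replace (6 * s * (m / (6 * s))) with m in B4 by (field; lra). lra. }
set (z1 := (c + RtoC (eta / 2))%C).
assert (Hz1 : Cmod (z1 - c) < eta).
{ unfold z1. replace (c + RtoC (eta / 2) - c)%C with (RtoC (eta / 2)) by ring.
  rewrite Cmod_R, Rabs_pos_eq; lra. }
assert (In' : forall w, Cmod (w - c) < eta -> Cmod w < 1).
{ intros w Hw. replace w with (c + (w - c))%C by ring. apply In. lra. }
assert (F : z1 = c).
{ apply Hinj; auto. apply cder_zero_const. intros t Ht.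
  assert (B := segment_in_ball c z1 eta t Hz1 Ht).
  rewrite <- (Z _ B). apply Hd. now apply In'. }
assert (K : RtoC (eta / 2) = 0).
{ replace (RtoC (eta / 2)) with (z1 - c)%C by (unfold z1; ring). rewrite F. ring. }
apply RtoC_inj in K. lra.
Qed.

(** * Conditional positivity of the logarithmic kernel *)

Definition quad (u : nat -> R) (k : nat -> nat -> R) (N : nat) : R :=
  rsum (fun i => rsum (fun j => u i * u j * k i j) N) N.

Lemma rsum_0 n : rsum (fun _ => 0) n = 0.
Proof. rewrite rsum_const. ring. Qed.

Lemma rsum_exchange (a : nat -> nat -> R) n m :
  rsum (fun i => rsum (fun j => a i j) m) n = rsum (fun j => rsum (fun i => a i j) n) m.
Proof.
induction n as [|n IH]; simpl; [now rewrite rsum_0|].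
now rewrite IH, rsum_plus.
Qed.

Lemma quad_ext u k k' N :
  (forall i j, (i < N)%nat -> (j < N)%nat -> k i j = k' i j) -> quad u k N = quad u k' N.
Proof.
intros H. apply rsum_ext. intros i Hi. apply rsum_ext. intros j Hj. now rewrite H.
Qed.

Lemma quad_plus u k k' N : quad u (fun i j => k i j + k' i j) N = quad u k N + quad u k' N.
Proof.
unfold quad. rewrite <- rsum_plus. apply rsum_ext. intros i _.
rewrite <- rsum_plus. apply rsum_ext. intros j _. ring.
Qed.

Lemma quad_scal u c k N : quad u (fun i j => c * k i j) N = c * quad u k N.
Proof.
unfold quad. rewrite <- rsum_scal. apply rsum_ext. intros i _.
rewrite <- rsum_scal. apply rsum_ext. intros j _. ring.
Qed.

Lemma quad_left u (a : nat -> R) N : rsum u N = 0 -> quad u (fun i _ => a i) N = 0.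
Proof.
intros H. unfold quad. rewrite (rsum_ext _ (fun _ => 0)); [apply rsum_0|].
intros i _. rewrite (rsum_ext _ (fun j => u i * a i * u j)) by (intros; ring).
rewrite rsum_scal, H. ring.
Qed.

Lemma quad_right u (a : nat -> R) N : rsum u N = 0 -> quad u (fun _ j => a j) N = 0.
Proof.
intros H. unfold quad. rewrite rsum_exchange. rewrite (rsum_ext _ (fun _ => 0)); [apply rsum_0|].
intros j _. rewrite (rsum_ext _ (fun i => u j * a j * u i)) by (intros; ring).
rewrite rsum_scal, H. ring.
Qed.

Lemma quad_one u N : 0 <= quad u (fun _ _ => 1) N.
Proof.
unfold quad. rewrite (rsum_ext _ (fun i => rsum u N * u i)).
- rewrite rsum_scal. nra.
- intros i _. rewrite (rsum_ext _ (fun j => u i * u j)) by (intros; ring).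
  rewrite rsum_scal. ring.
Qed.

(* the Schur product theorem, for powers of an explicit Gram matrix *)
Lemma quad_gram_pow (v : nat -> nat -> R) m n N : forall u,
  0 <= quad u (fun i j => (rsum (fun s => v s i * v s j) m) ^ n) N.
Proof.
induction n as [|n IH]; intros u.
- apply quad_one.
- assert (E : quad u (fun i j => (rsum (fun s => v s i * v s j) m) ^ S n) N
    = rsum (fun s => quad (fun i => u i * v s i) (fun i j => (rsum (fun s => v s i * v s j) m) ^ n) N) m).
  { unfold quad. rewrite (rsum_exchange _ m N). apply rsum_ext. intros i _.
    rewrite (rsum_exchange _ m N). apply rsum_ext. intros j _.
    simpl pow. set (q := rsum (fun s => v s i * v s j) m).
    rewrite (rsum_ext _ (fun s => (u i * u j * q ^ n) * (v s i * v s j))) by (intros; ring).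
    rewrite rsum_scal. fold q. ring. }
  rewrite E. rewrite <- (rsum_0 m). apply rsum_le. intros s _. apply IH.
Qed.

(** The coefficients [- 1 / n] of [log (1 - z)], obtained as antiderivative of [- 1 / (1 - z)]. *)
Definition logc : nat -> C := icoef (fun _ => (-(1))%C).

Lemma geo_logc : geo 1 1 logc.
Proof.
unfold logc. rewrite <- (Rmult_1_r 1) at 2. apply geo_icoef; [lra|].
intros n. rewrite Cmod_m1, pow1. lra.
Qed.

Lemma PS_m1 z : Cmod z < 1 -> (PS (fun _ => (-(1))%C) z * (1 - z))%C = (-(1))%C.
Proof.
intros Hz. assert (G : geo 1 1 (fun _ => (-(1))%C)) by (intros n; rewrite Cmod_m1, pow1; lra).
assert (E := PS_shift 1 1 _ z Rlt_0_1 G Hz). unfold shift in E.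
set (p := PS (fun _ => (-(1))%C) z) in *.
replace (p * (1 - z))%C with (p - z * p)%C by ring. rewrite E at 1. ring.
Qed.

Lemma log_one_minus z : Cmod z < 1 -> ln (Cmod (1 - z)) = Re (PS logc z).
Proof.
intros Hz. rewrite (log_modulus (fun w => 1 - w)%C (fun _ => (-(1))%C) (fun _ => (-(1))%C) 1 1).
- apply ln_exp.
- lra.
- intros n. rewrite Cmod_m1, pow1. lra.
- intros w Hw. split; [|now rewrite PS_m1].
  replace (-(1))%C with (0 - 1)%C by ring.
  apply (cder_minus (fun _ => RtoC 1) (fun w => w)); [apply cder_const|apply cder_id].
- ring.
- exact Hz.
Qed.

Lemma Re_psum_logc q T :
  Re (psum logc (RtoC q) T) = rsum (fun n => match n with O => 0 | S _ => - / INR n end * q ^ n) T.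
Proof.
unfold psum. rewrite csum_re. apply rsum_ext. intros n _. rewrite <- RtoC_pow.
unfold logc. destruct n as [|k].
- simpl. ring.
- unfold icoef. replace (-(1))%C with (RtoC (-(1))) by (apply injective_projections; simpl; ring).
  rewrite <- RtoC_div by (apply (not_0_INR (S k)); lia). rewrite <- RtoC_mult. unfold Re, RtoC; cbn [fst]. field. apply (not_0_INR (S k)). lia.
Qed.

Lemma Re_minus z w : Re (z - w) = Re z - Re w.
Proof. reflexivity. Qed.

Lemma Im_minus z w : Im (z - w) = Im z - Im w.
Proof. reflexivity. Qed.

Lemma quad_abs_le u k e N :
  0 <= e -> (forall i j, (i < N)%nat -> (j < N)%nat -> Rabs (k i j) <= e) ->
  Rabs (quad u k N) <= e * (rsum (fun i => Rabs (u i)) N * rsum (fun i => Rabs (u i)) N).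
Proof.
intros He H.
assert (A : forall (a : nat -> R) n, Rabs (rsum a n) <= rsum (fun i => Rabs (a i)) n).
{ intros a n. induction n as [|n IH]; simpl; [rewrite Rabs_R0; lra|].
  eapply Rle_trans; [apply Rabs_triang|]. lra. }
unfold quad. eapply Rle_trans; [apply A|].
set (S := rsum (fun i => Rabs (u i)) N).
replace (e * (S * S)) with (rsum (fun i => (e * S) * Rabs (u i)) N) by (rewrite rsum_scal; fold S; ring).
apply rsum_le. intros i Hi. eapply Rle_trans; [apply A|].
replace (e * S * Rabs (u i)) with (rsum (fun j => (e * Rabs (u i)) * Rabs (u j)) N) by (rewrite rsum_scal; fold S; ring).
apply rsum_le. intros j Hj. rewrite !Rabs_mult.
pose proof (H i j Hi Hj). pose proof (Rabs_pos (u i)). pose proof (Rabs_pos (u j)).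
replace (e * Rabs (u i) * Rabs (u j)) with (Rabs (u i) * Rabs (u j) * e) by ring.
apply Rmult_le_compat_l; auto. now apply Rmult_le_pos.
Qed.

(** [- ln (1 - q)] is the sum of [q^n / n]. The coefficients are non-negative, the powers of a Gram
    matrix are positive semidefinite, and [|q| <= t < 1] controls the truncation. *)
Lemma quad_neg_ln (v : nat -> nat -> R) m t N u :
  0 <= t < 1 ->
  (forall i j, (i < N)%nat -> (j < N)%nat -> Rabs (rsum (fun s => v s i * v s j) m) <= t) ->
  0 <= quad u (fun i j => - ln (1 - rsum (fun s => v s i * v s j) m)) N.
Proof.
intros Ht Hq. set (q := fun i j => rsum (fun s => v s i * v s j) m) in *.
set (S := rsum (fun i => Rabs (u i)) N).
assert (K : forall T, - (2 * 1 / (1 - t) * (S * S) * t ^ T) <= quad u (fun i j => - ln (1 - q i j)) N).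
{ intros T.
  assert (E : forall i j, (i < N)%nat -> (j < N)%nat ->
     Rabs (- ln (1 - q i j) - - Re (psum logc (RtoC (q i j)) T)) <= 2 * 1 / (1 - t) * t ^ T).
  { intros i j Hi Hj. specialize (Hq i j Hi Hj). fold (q i j) in Hq. set (x := q i j) in *.
    assert (Hx : Cmod (RtoC x) < 1) by (rewrite Cmod_R; lra).
    assert (L := log_one_minus (RtoC x) Hx).
    replace (1 - RtoC x)%C with (RtoC (1 - x)) in L by (rewrite RtoC_minus; reflexivity).
    rewrite Cmod_R in L. apply Rabs_le_between in Hq. rewrite Rabs_pos_eq in L by lra.
    rewrite L. replace (- Re (PS logc (RtoC x)) - - Re (psum logc (RtoC x) T))
      with (- Re (PS logc (RtoC x) - psum logc (RtoC x) T)) by (rewrite Re_minus; ring).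
    rewrite Rabs_Ropp. eapply Rle_trans; [apply re_le_Cmod|].
    eapply Rle_trans; [apply (PS_rem 1 1); auto using geo_logc; lra|].
    rewrite Cmod_R. rewrite !Rdiv_1_r, !Rmult_1_r.
    assert (X : 0 <= Rabs x <= t) by (split; [apply Rabs_pos|apply Rabs_le; lra]).
    unfold Rdiv. rewrite 2!(Rmult_assoc 2).
    apply Rmult_le_compat_l; [lra|]. rewrite Rmult_comm. apply Rmult_le_compat.
    - left; apply Rinv_0_lt_compat; lra.
    - apply pow_le; lra.
    - apply Rinv_le_contravar; lra.
    - now apply pow_incr. }
  assert (P : 0 <= quad u (fun i j => - Re (psum logc (RtoC (q i j)) T)) N).
  { rewrite (quad_ext _ _ (fun i j => - rsum (fun n => match n with O => 0 | S _ => - / INR n end * q i j ^ n) T))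
      by (intros; now rewrite Re_psum_logc).
    clear E. induction T as [|T IH]; simpl rsum.
    - rewrite (quad_ext _ _ (fun i j => 0 * 1)) by (intros; ring).
      rewrite quad_scal. lra.
    - rewrite (quad_ext _ _ (fun i j => - rsum (fun n => match n with O => 0 | S _ => - / INR n end * q i j ^ n) T
         + (match T with O => 0 | S _ => / INR T end) * q i j ^ T)) by (intros; destruct T; ring).
      rewrite quad_plus, quad_scal. apply Rplus_le_le_0_compat; auto.
      apply Rmult_le_pos; [|apply quad_gram_pow].
      destruct T as [|T]; [lra|]. left. apply Rinv_0_lt_compat, lt_0_INR. lia. }
  assert (Q := quad_abs_le u _ (2 * 1 / (1 - t) * t ^ T) N
    ltac:(apply Rmult_le_pos; [apply Rdiv_le_0_compat; lra|apply pow_le; lra]) E).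
  fold S in Q.
  assert (R1 : quad u (fun i j => - ln (1 - q i j)) N =
    quad u (fun i j => - ln (1 - q i j) - - Re (psum logc (RtoC (q i j)) T)) N
    + quad u (fun i j => - Re (psum logc (RtoC (q i j)) T)) N).
  { rewrite <- quad_plus. apply quad_ext. intros. ring. }
  rewrite R1. apply Rabs_le_between in Q. lra. }
destruct (Rle_dec 0 (quad u (fun i j => - ln (1 - q i j)) N)) as [|n]; auto.
exfalso. set (X := quad u (fun i j => - ln (1 - q i j)) N) in *.
destruct (pow_small t (2 * 1 / (1 - t) * (S * S)) (- X / 2) Ht) as [T HT]; [lra|].
specialize (HT T (le_n T)). specialize (K T). lra.
Qed.

Lemma rsum_term_le (a : nat -> R) N i :
  (forall k, 0 <= a k) -> (i < N)%nat -> a i <= rsum a N.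
Proof.
intros Ha Hi. induction N as [|N IH]; [lia|]. simpl.
assert (P : 0 <= rsum a N) by (rewrite <- (rsum_0 N); apply rsum_le; auto).
destruct (Nat.eq_dec i N) as [->|n]; [lra|]. specialize (Ha N). assert (a i <= rsum a N) by (apply IH; lia). lra.
Qed.

(* [|w_i - w_j|^2 + e = (1 + a_i)(1 + a_j)(1 - q_ij)] with [a_i = |w_i|^2 + e/2] and [q] a Gram
   matrix of diagonal entries [1 - e/(1 + a_i)^2 < 1]. *)
Lemma log_kernel_real (w : nat -> C) u e N :
  0 < e -> rsum u N = 0 ->
  0 <= quad u (fun i j => - ln (Cmod (w i - w j) ^ 2 + e)) N.
Proof.
intros He Hu.
set (a := fun i => Re (w i) * Re (w i) + Im (w i) * Im (w i) + e / 2).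
assert (Ha : forall i, 0 < a i) by (intros i; unfold a; nra).
set (v := fun s i => match s with
  | O => 1 / (1 + a i) | 1%nat => a i / (1 + a i)
  | 2%nat => sqrt 2 * Re (w i) / (1 + a i) | _ => sqrt 2 * Im (w i) / (1 + a i) end).
assert (S2 : sqrt 2 * sqrt 2 = 2) by (apply sqrt_sqrt; lra).
assert (Hq : forall i j, rsum (fun s => v s i * v s j) 4 =
   (1 + a i * a j + 2 * (Re (w i) * Re (w j) + Im (w i) * Im (w j))) / ((1 + a i) * (1 + a j))).
{ intros i j. pose proof (Ha i). pose proof (Ha j). unfold v; cbn [rsum].
  transitivity ((1 + a i * a j + (sqrt 2 * sqrt 2) * (Re (w i) * Re (w j) + Im (w i) * Im (w j))) / ((1 + a i) * (1 + a j))).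
  - field. lra.
  - now rewrite S2. }
assert (Hs : forall i j, Cmod (w i - w j) ^ 2 + e =
   (1 + a i) * (1 + a j) * (1 - rsum (fun s => v s i * v s j) 4)).
{ intros i j. rewrite Hq, Cmod2_alt. pose proof (Ha i). pose proof (Ha j).
  rewrite Re_minus, Im_minus.
  transitivity ((1 + a i) * (1 + a j) - (1 + a i * a j + 2 * (Re (w i) * Re (w j) + Im (w i) * Im (w j)))).
  - unfold a. field.
  - field. lra. }
set (A := rsum a N).
assert (HA : forall i, (i < N)%nat -> a i <= A) by (intros i Hi; apply rsum_term_le; auto; intros k; left; auto).
assert (A0 : 0 <= A) by (unfold A; rewrite <- (rsum_0 N); apply rsum_le; intros k _; left; auto).
set (t := Rmax 0 (1 - e / (1 + A) ^ 2)).
assert (P1A : 0 < (1 + A) ^ 2) by (apply pow_lt; lra).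
assert (Ht : 0 <= t < 1).
{ unfold t. split; [apply Rmax_l|]. apply Rmax_lub_lt; [lra|].
  assert (0 < e / (1 + A) ^ 2) by (apply Rdiv_lt_0_compat; auto). lra. }
assert (Hd : forall i, (i < N)%nat -> rsum (fun s => v s i * v s i) 4 <= t).
{ intros i Hi. eapply Rle_trans; [|apply Rmax_r].
  assert (E := Hs i i). rewrite Cmod_self, pow_ne_zero, Rplus_0_l in E by lia.
  pose proof (Ha i). specialize (HA i Hi).
  assert (e / (1 + A) ^ 2 <= e / ((1 + a i) * (1 + a i))).
  { apply Rmult_le_compat_l; [lra|]. apply Rinv_le_contravar; [nra|]. simpl. nra. }
  assert (e / ((1 + a i) * (1 + a i)) = 1 - rsum (fun s => v s i * v s i) 4).
  { rewrite E at 1. field. lra. }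
  lra. }
(* The first two logarithms depend on one index only and vanish against a weight of total mass zero;
   this is why positivity is conditional. *)
rewrite (quad_ext _ _ (fun i j => - ln (1 + a i) + - ln (1 + a j) + - ln (1 - rsum (fun s => v s i * v s j) 4))).
- rewrite !quad_plus, quad_left, quad_right by auto.
  rewrite !Rplus_0_l. apply quad_neg_ln with t; auto.
  intros i j Hi Hj. pose proof (Hd i Hi) as D1. pose proof (Hd j Hj) as D2.
  cbn [rsum] in *. apply Rabs_le.
  set (x0 := v 0%nat i) in *. set (x1 := v 1%nat i) in *. set (x2 := v 2%nat i) in *. set (x3 := v 3%nat i) in *.
  set (y0 := v 0%nat j) in *. set (y1 := v 1%nat j) in *. set (y2 := v 2%nat j) in *. set (y3 := v 3%nat j) in *.
  (* From [2 |x . y| <= |x|^2 + |y|^2], off-diagonal Gram entries are bounded by the diagonal bound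
     [t]. *)
  pose proof (Rle_0_sqr (x0 - y0)). pose proof (Rle_0_sqr (x1 - y1)).
  pose proof (Rle_0_sqr (x2 - y2)). pose proof (Rle_0_sqr (x3 - y3)).
  pose proof (Rle_0_sqr (x0 + y0)). pose proof (Rle_0_sqr (x1 + y1)).
  pose proof (Rle_0_sqr (x2 + y2)). pose proof (Rle_0_sqr (x3 + y3)).
  unfold Rsqr in *. lra.
- intros i j Hi Hj. pose proof (Ha i). pose proof (Ha j). rewrite Hs.
  assert (P : 0 < Cmod (w i - w j) ^ 2 + e) by (pose proof (pow2_ge_0 (Cmod (w i - w j))); lra).
  rewrite Hs in P. assert (Q : 0 < (1 + a i) * (1 + a j)) by nra.
  assert (0 < 1 - rsum (fun s => v s i * v s j) 4) by nra.
  rewrite !ln_mult; try lra; nra.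
Qed.

(** The Hermitian form of [k] divided by [N^2], nested so that the inner average tests a single row
    against the weight. *)
Definition havg (x : nat -> C) (k : nat -> nat -> R) (N : nat) : C :=
  avg N (fun j => avg N (fun i => RtoC (k i j) * x i)%C * Cconj (x j))%C.

Lemma rsum_Re_INR (f : nat -> C) N : (0 < N)%nat -> Re (avg N f) = rsum (fun i => Re (f i)) N / INR N.
Proof.
intros HN. unfold avg. assert (P := lt_0_INR N HN).
unfold Cdiv. rewrite <- RtoC_inv by lra. rewrite <- csum_re.
destruct (csum f N) as [p q]. simpl. unfold Rdiv. ring.
Qed.

(** For a real kernel, the real part of the Hermitian form at [x] is the quadratic form at [Re x]
    plus the one at [Im x]. *)
Lemma log_kernel_complex (w x : nat -> C) e N :
  (0 < N)%nat -> 0 < e -> csum x N = 0 ->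
  0 <= Re (havg x (fun i j => - ln (Cmod (w i - w j) ^ 2 + e)) N).
Proof.
intros HN He Hx. set (k := fun i j => - ln (Cmod (w i - w j) ^ 2 + e)).
assert (P := lt_0_INR N HN).
assert (X : Re (havg x k N) =
  (quad (fun i => Re (x i)) k N + quad (fun i => Im (x i)) k N) / INR N / INR N).
{ unfold havg. rewrite rsum_Re_INR by auto.
  rewrite (rsum_ext _ (fun j => / INR N * rsum (fun i => (Re (x i) * Re (x j) + Im (x i) * Im (x j)) * k i j) N)).
  - rewrite rsum_scal, rsum_exchange. unfold quad. rewrite <- rsum_plus.
    rewrite (rsum_ext _ (fun i => rsum (fun j => Re (x i) * Re (x j) * k i j) N
      + rsum (fun j => Im (x i) * Im (x j) * k i j) N)).
    + unfold Rdiv. ring.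
    + intros i _. rewrite <- rsum_plus. apply rsum_ext. intros j _. ring.
  - intros j _.
    replace (avg N (fun i => RtoC (k i j) * x i) * Cconj (x j))%C
      with (avg N (fun i => Cconj (x j) * (RtoC (k i j) * x i)))%C
      by (rewrite avg_scal by auto; ring).
    rewrite rsum_Re_INR by auto. unfold Rdiv. rewrite Rmult_comm. f_equal.
    apply rsum_ext. intros i _. destruct (x i) as [p q], (x j) as [p' q']. simpl. ring. }
rewrite X. clear X.
assert (H1 : rsum (fun i => Re (x i)) N = 0) by (rewrite <- csum_re, Hx; reflexivity).
assert (H2 : rsum (fun i => Im (x i)) N = 0) by (rewrite <- csum_im, Hx; reflexivity).
assert (A := log_kernel_real w _ e N He H1). assert (B := log_kernel_real w _ e N He H2).
fold k in A, B. apply Rdiv_le_0_compat; auto. apply Rdiv_le_0_compat; auto. lra.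
Qed.

Lemma PS_bound rho M b z :
  0 < rho -> geo rho M b -> Cmod z < rho -> Cmod (PS b z) <= 2 * M / (1 - Cmod z / rho).
Proof.
intros Hr H Hz. assert (E := PS_rem rho M b z 0 Hr H Hz).
unfold psum in E; simpl in E. unfold Cminus in E. rewrite Copp_0, Cplus_0_r, Rmult_1_r in E. exact E.
Qed.

Lemma geo_dcoef_explicit rho rho' M b :
  0 < rho' < rho -> geo rho M b -> geo rho' (M / rho / (1 - rho' / rho)) (dcoef b).
Proof.
intros Hr H. apply (geo_deg rho rho' (M / rho) (shift b)); auto. apply geo_shift; auto. lra.
Qed.

Lemma pow_diff_bound z w s n :
  0 < s -> Cmod z <= s -> Cmod w <= s ->
  Cmod (w ^ n - z ^ n) * s <= INR (S n) * s ^ n * Cmod (w - z).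
Proof.
intros Hs Hz Hw. induction n as [|n IH].
- simpl. replace (1 - 1)%C with (RtoC 0) by ring. rewrite Cmod_0. pose proof (Cmod_ge_0 (w - z)). lra.
- rewrite !Cpow_S.
  replace (w * w ^ n - z * z ^ n)%C with (w * (w ^ n - z ^ n) + (w - z) * z ^ n)%C by ring.
  eapply Rle_trans; [apply Rmult_le_compat_r; [lra|apply Cmod_triangle]|].
  rewrite !Cmod_mult, Cmod_pow.
  pose proof (Cmod_ge_0 (w ^ n - z ^ n)). pose proof (Cmod_ge_0 (w - z)).
  assert (Cmod z ^ n <= s ^ n) by (apply pow_incr; split; auto; apply Cmod_ge_0).
  assert (0 <= Cmod z ^ n) by (apply pow_le, Cmod_ge_0).
  rewrite (S_INR (S n)). simpl pow. set (q := Cmod (w ^ n - z ^ n)) in *. set (d := Cmod (w - z)) in *.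
  set (m := INR (S n)) in *. set (x := s ^ n) in *.
  assert (A : Cmod w * q * s <= s * (m * x * d)).
  { rewrite Rmult_assoc. apply Rmult_le_compat; auto; [apply Cmod_ge_0|apply Rmult_le_pos; lra]. }
  assert (B : d * Cmod z ^ n * s <= d * x * s) by (apply Rmult_le_compat_r; [lra|now apply Rmult_le_compat_l]).
  lra.
Qed.

(** [L] is chosen before [c], so that one constant serves the functions [quot b w] for all [w] at
    once. *)
Lemma PS_lipschitz rho M s : 0 < s < rho -> 0 <= M -> exists L, 0 <= L /\
  forall c, geo rho M c -> forall z w, Cmod z <= s -> Cmod w <= s ->
    Cmod (PS c w - PS c z) <= L * Cmod (w - z).
Proof.
intros Hs HM. set (s1 := (s + rho) / 2). assert (Hs1 : s < s1 < rho) by (unfold s1; lra).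
set (t := s / s1).
assert (Ht : 0 <= t < 1).
{ apply div_lt1. lra. }
set (M1 := M / (1 - s1 / rho)).
assert (HM1 : 0 <= M1).
{ apply Rdiv_le_0_compat; auto. pose proof (div_lt1 s1 rho). lra. }
exists (M1 / (1 - t) / s). split.
{ apply Rdiv_le_0_compat; [apply Rdiv_le_0_compat; lra|lra]. }
intros c Hc z w Hz Hw.
assert (G := geo_deg rho s1 M c ltac:(lra) Hc). fold M1 in G.
assert (Hc1 := geo_le rho s1 M c ltac:(lra) Hc).
pose proof (Cmod_ge_0 (w - z)) as Hd.
assert (TT : forall v T, Cmod v <= s -> Cmod (PS c v - psum c v T) <= 2 * M / (1 - t) * t ^ T).
{ intros v T Hv. apply PS_rem_unif; auto. lra. }
apply (Cmod_limit_le _ (fun T => psum c w T - psum c z T)%C _ (2 * (2 * M / (1 - t))) t); auto.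
- intros T. replace (PS c w - PS c z - (psum c w T - psum c z T))%C
    with ((PS c w - psum c w T) - (PS c z - psum c z T))%C by ring.
  eapply Rle_trans; [apply Cmod_sub_le|].
  pose proof (TT w T Hw). pose proof (TT z T Hz). lra.
- intros T. replace (psum c w T - psum c z T)%C with (csum (fun n => c n * (w ^ n - z ^ n))%C T).
  2:{ unfold psum. unfold Cminus. induction T as [|T IH]; simpl; [ring|]. rewrite IH. ring. }
  eapply Rle_trans; [apply Cmod_csum_le|].
  apply Rle_trans with (rsum (fun n => Cmod (w - z) / s * (M1 * t ^ n)) T).
  + apply rsum_le. intros n _. rewrite Cmod_mult.
    assert (B := pow_diff_bound z w s n ltac:(lra) Hz Hw).
    specialize (G n). cbv beta in G. rewrite Cmod_mult, Cmod_R, Rabs_pos_eq in G by apply pos_INR.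
    apply Rmult_le_reg_r with s; [lra|].
    replace (Cmod (w - z) / s * (M1 * t ^ n) * s) with (Cmod (w - z) * (M1 * t ^ n)) by (field; lra).
    apply Rle_trans with (Cmod (c n) * (INR (S n) * s ^ n * Cmod (w - z))).
    * rewrite Rmult_assoc. apply Rmult_le_compat_l; auto. apply Cmod_ge_0.
    * replace (Cmod (c n) * (INR (S n) * s ^ n * Cmod (w - z)))
        with (Cmod (w - z) * ((INR (S n) * Cmod (c n) * s1 ^ n) * t ^ n)).
      { apply Rmult_le_compat_l; auto. apply Rmult_le_compat_r; auto. apply pow_le; lra. }
      unfold t, Rdiv. rewrite Rpow_mult_distr, pow_inv. field. apply pow_nonzero; lra.
  + rewrite rsum_scal.
    replace (M1 / (1 - t) / s * Cmod (w - z)) with (Cmod (w - z) / s * (M1 / (1 - t))) by (field; lra).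
    apply Rmult_le_compat_l.
    * apply Rdiv_le_0_compat; lra.
    * apply rsum_geom_bound; auto. intros n. lra.
Qed.

(** * The two-variable function of a univalent map *)

Definition geo_disk (b : nat -> C) : Prop :=
  forall r, 0 < r < 1 -> exists M, geo r M b.

Definition tail_series (b : nat -> C) (i : nat) (w : C) : C := PS (fun j => b (i + j)%nat) w.

(** For [n >= 2], [(w z^n - z w^n) / (w - z)] is [- w z] times the sum of [z^k w^(n-2-k)] over
    [k <= n - 2]; the coefficients collect these by powers of [z]. The index [n = 0] gives 1 since
    [b 0 = 1], and [n = 1] gives 0. *)
Definition qcoef (b : nat -> C) (w : C) (n : nat) : C :=
  match n with O => RtoC 1 | S k => (- (w * tail_series b (S (S k)) w))%C end.

(* With [g = PS b], [quot b w z = (w g z - z g w) / (w - z)] (see [quot_identity]); for [g = z/f] this is the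
   quotient of [1/f(z) - 1/f(w)] by [1/z - 1/w]. The power series also covers [z = w]. *)
Definition quot (b : nat -> C) (w z : C) : C := PS (qcoef b w) z.

Lemma geo_tail rho M b i : 0 < rho -> geo rho M b -> geo rho (M / rho ^ i) (fun j => b (i + j)%nat).
Proof.
intros Hr H j. specialize (H (i + j)%nat). rewrite pow_add in H.
assert (P : 0 < rho ^ i) by now apply pow_lt.
apply Rmult_le_reg_r with (rho ^ i); auto.
unfold Rdiv. rewrite (Rmult_assoc M), Rinv_l; lra.
Qed.

Lemma tail_series_rec b i w : geo_disk b -> Cmod w < 1 -> tail_series b i w = (b i + w * tail_series b (S i) w)%C.
Proof.
intros Hb Hw. pose proof (Cmod_ge_0 w).
destruct (Hb ((Cmod w + 1) / 2)) as [M HM]; [lra|]. set (rho := (Cmod w + 1) / 2) in *.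
unfold tail_series. rewrite (PS_shift rho (M / rho ^ i)).
- rewrite Nat.add_0_r. do 2 f_equal. apply PS_ext. intros n. unfold shift. f_equal. lia.
- unfold rho; lra.
- apply geo_tail; auto. unfold rho; lra.
- unfold rho; lra.
Qed.

Lemma geo_qcoef rho M b w :
  0 < rho < 1 -> geo rho M b -> Cmod w < rho ->
  geo rho (1 + Cmod w * (2 * M / (rho * (1 - Cmod w / rho)))) (qcoef b w).
Proof.
intros Hr H Hw n. pose proof (geo_pos _ _ _ H) as M0. pose proof (Cmod_ge_0 w) as W0.
destruct (ratio_lt1 w rho) as [t0 t1]; try lra.
assert (P : 0 <= 2 * M / (rho * (1 - Cmod w / rho))).
{ apply Rdiv_le_0_compat; [lra|]. apply Rmult_lt_0_compat; lra. }
destruct n as [|k].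
- simpl. rewrite Cmod_1. assert (0 <= Cmod w * (2 * M / (rho * (1 - Cmod w / rho)))) by now apply Rmult_le_pos. lra.
- unfold qcoef. rewrite Cmod_opp, Cmod_mult.
  assert (Hp : 0 < rho ^ S (S k)) by (apply pow_lt; lra).
  assert (B : Cmod (tail_series b (S (S k)) w) <= 2 * (M / rho ^ S (S k)) / (1 - Cmod w / rho)).
  { apply PS_bound; auto; [lra|]. apply geo_tail; auto. lra. }
  apply Rle_trans with (Cmod w * (2 * M / (rho * (1 - Cmod w / rho)))); [|lra].
  rewrite Rmult_assoc. apply Rmult_le_compat_l; auto.
  apply Rmult_le_compat_r with (r := rho ^ S k) in B; [|apply pow_le; lra].
  eapply Rle_trans; [exact B|]. right. simpl pow. field.
  assert (0 < rho ^ k) by (apply pow_lt; lra). repeat split; lra.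
Qed.

Lemma geo_qcoef_unif b R rho :
  geo_disk b -> 0 < R < rho -> rho < 1 ->
  exists M, 0 <= M /\ forall w, Cmod w <= R -> geo rho M (qcoef b w).
Proof.
intros Hb HR Hr. destruct (Hb rho ltac:(lra)) as [M HM]. pose proof (geo_pos _ _ _ HM) as M0.
assert (HR' : R / rho < 1).
{ apply div_lt1. lra. }
assert (P : 0 <= 2 * M / (rho * (1 - R / rho))).
{ apply Rdiv_le_0_compat; [lra|]. apply Rmult_lt_0_compat; lra. }
exists (1 + R * (2 * M / (rho * (1 - R / rho)))).
split; [assert (0 <= R * (2 * M / (rho * (1 - R / rho)))) by (apply Rmult_le_pos; lra); lra|].
intros w Hw n. pose proof (Cmod_ge_0 w) as W0.
eapply Rle_trans; [apply (geo_qcoef rho M b w); auto; lra|].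
apply Rplus_le_compat_l. apply Rmult_le_compat; auto.
- destruct (ratio_lt1 w rho); try lra. apply Rdiv_le_0_compat; [lra|]. apply Rmult_lt_0_compat; lra.
- apply Rmult_le_compat_l; [lra|]. apply Rinv_le_contravar.
  + apply Rmult_lt_0_compat; lra.
  + apply Rmult_le_compat_l; [lra|]. unfold Rdiv.
    assert (Cmod w * / rho <= R * / rho); [|lra].
    apply Rmult_le_compat_r; auto. left; apply Rinv_0_lt_compat; lra.
Qed.

Lemma geo_disk_pair b z w : geo_disk b -> Cmod z < 1 -> Cmod w < 1 ->
  exists rho M, 0 < rho < 1 /\ Cmod z < rho /\ Cmod w < rho /\ geo rho M b.
Proof.
intros Hb Hz Hw. pose proof (Cmod_ge_0 z). pose proof (Cmod_ge_0 w).
set (m := Rmax (Cmod z) (Cmod w)).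
assert (m < 1) by (apply Rmax_lub_lt; auto).
pose proof (Rmax_l (Cmod z) (Cmod w)) as L1. pose proof (Rmax_r (Cmod z) (Cmod w)) as L2. fold m in L1, L2.
destruct (Hb ((m + 1) / 2)) as [M HM]; [lra|].
exists ((m + 1) / 2), M. repeat split; auto; lra.
Qed.

(** Partial sums satisfy the identity up to the explicit term [w * tail_series b (S T) w * z ^ S T],
    which decays geometrically. *)
Lemma quot_identity b z w : geo_disk b -> b O = 1 -> Cmod z < 1 -> Cmod w < 1 ->
  ((w - z) * quot b w z)%C = (w * PS b z - z * PS b w)%C.
Proof.
intros Hb Hb0 Hz Hw.
destruct (geo_disk_pair b z w Hb Hz Hw) as [rho [M [Hr [Hzr [Hwr HM]]]]].
assert (Gg := geo_qcoef rho M b w Hr HM Hwr).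
set (M' := 1 + _) in Gg.
assert (Id : forall T, ((w - z) * psum (qcoef b w) z (S T))%C =
   (w * psum b z (S T) - z * PS b w + w * tail_series b (S T) w * z ^ S T)%C).
{ assert (E0 : PS b w = (1 + w * tail_series b 1 w)%C).
  { change (PS b w) with (tail_series b 0 w). rewrite tail_series_rec, Hb0 by auto. reflexivity. }
  induction T as [|T IH].
  - unfold psum; simpl. rewrite E0, Hb0. ring.
  - unfold psum in *. change (csum (fun n => qcoef b w n * z ^ n)%C (S (S T)))
     with (csum (fun n => qcoef b w n * z ^ n) (S T) + qcoef b w (S T) * z ^ S T)%C.
    change (csum (fun n => b n * z ^ n)%C (S (S T)))
     with (csum (fun n => b n * z ^ n) (S T) + b (S T) * z ^ S T)%C.
    rewrite Cmult_plus_distr_l, IH. unfold qcoef at 1.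
    rewrite (tail_series_rec b (S T)) by auto. rewrite (Cpow_S z (S T)). ring. }
set (t := Cmod z / rho). assert (Ht : 0 <= t < 1) by (apply ratio_lt1; lra).
assert (Ht' := ratio_lt1 w rho ltac:(lra) Hwr).
apply (Cmod_limit_eq _ _ (fun T => (w - z) * psum (qcoef b w) z (S T))%C
  (Cmod (w - z) * (2 * M' / (1 - t)))
  (Cmod w * (2 * M / (1 - t)) + Cmod w * (2 * M / (1 - Cmod w / rho))) t); auto.
- intros T. replace ((w - z) * quot b w z - (w - z) * psum (qcoef b w) z (S T))%C
    with ((w - z) * (quot b w z - psum (qcoef b w) z (S T)))%C by ring.
  rewrite Cmod_mult, Rmult_assoc. apply Rmult_le_compat_l; [apply Cmod_ge_0|].
  apply PS_rem_S; auto. lra.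
- intros T. rewrite Id.
  replace (w * PS b z - z * PS b w - (w * psum b z (S T) - z * PS b w + w * tail_series b (S T) w * z ^ S T))%C
    with (w * (PS b z - psum b z (S T)) - w * (tail_series b (S T) w * z ^ S T))%C by ring.
  eapply Rle_trans; [apply Cmod_sub_le|]. rewrite !(Cmod_mult w), Rmult_plus_distr_r, !(Rmult_assoc (Cmod w)).
  apply Rplus_le_compat; (apply Rmult_le_compat_l; [apply Cmod_ge_0|]).
  + apply PS_rem_S; auto. lra.
  + rewrite Cmod_mult, Cmod_pow.
    assert (B : Cmod (tail_series b (S T) w) <= 2 * (M / rho ^ S T) / (1 - Cmod w / rho)).
    { apply PS_bound; auto; [lra|]. apply geo_tail; auto. lra. }
    assert (Hp : 0 < rho ^ S T) by (apply pow_lt; lra).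
    pose proof (geo_pos _ _ _ HM) as M0.
    apply Rle_trans with (2 * (M / rho ^ S T) / (1 - Cmod w / rho) * Cmod z ^ S T).
    { apply Rmult_le_compat_r; auto. apply pow_le, Cmod_ge_0. }
    replace (2 * (M / rho ^ S T) / (1 - Cmod w / rho) * Cmod z ^ S T)
      with (2 * M / (1 - Cmod w / rho) * t ^ S T).
    2:{ unfold t. unfold Rdiv at 3. rewrite Rpow_mult_distr, pow_inv. field. lra. }
    apply Rmult_le_compat_l; [apply Rdiv_le_0_compat; lra|].
    simpl. assert (0 <= t ^ T) by (apply pow_le; lra). nra.
Qed.

(* The last two clauses say that [f = z / PS b] is injective with [f' <> 0]. *)
Definition univalent_coef (b : nat -> C) : Prop :=
  geo_disk b /\ b O = 1 /\
  (forall z w, Cmod z < 1 -> Cmod w < 1 -> (w * PS b z = z * PS b w)%C -> z = w) /\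
  (forall z, Cmod z < 1 -> (PS b z - z * PS (dcoef b) z)%C <> 0).

Definition quot_dz (b : nat -> C) (w z : C) : C := PS (dcoef (qcoef b w)) z.

Lemma quot_cder b w z : geo_disk b -> Cmod z < 1 -> Cmod w < 1 -> cder (quot b w) z (quot_dz b w z).
Proof.
intros Hb Hz Hw. destruct (geo_disk_pair b z w Hb Hz Hw) as [rho [M [Hr [Hzr [Hwr HM]]]]].
assert (Gg := geo_qcoef rho M b w Hr HM Hwr).
eapply PS_cder; [|exact Gg|exact Hzr]. lra.
Qed.

Lemma geo_disk_cder b z : geo_disk b -> Cmod z < 1 -> cder (PS b) z (PS (dcoef b) z).
Proof.
intros Hb Hz. destruct (geo_disk_pair b z z Hb Hz Hz) as [rho [M [Hr [Hzr [_ HM]]]]].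
eapply PS_cder; [|exact HM|exact Hzr]. lra.
Qed.

Lemma geo_disk_dcoef b : geo_disk b -> geo_disk (dcoef b).
Proof.
intros Hb r Hr. destruct (Hb ((r + 1) / 2)) as [M HM]; [lra|].
apply (geo_dcoef ((r + 1) / 2) r M b); auto. lra.
Qed.

Lemma geo_disk_qcoef b w : geo_disk b -> Cmod w < 1 -> geo_disk (qcoef b w).
Proof.
intros Hb Hw r Hr. pose proof (Cmod_ge_0 w).
set (m := Rmax r (Cmod w)). assert (m < 1) by (apply Rmax_lub_lt; lra).
pose proof (Rmax_l r (Cmod w)) as L1. pose proof (Rmax_r r (Cmod w)) as L2. fold m in L1, L2.
destruct (Hb ((m + 1) / 2)) as [M HM]; [lra|].
assert (G := geo_qcoef ((m + 1) / 2) M b w ltac:(lra) HM ltac:(lra)).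
eexists. apply (geo_le _ r) in G; [exact G|lra].
Qed.

Lemma geo_disk_PS_0 b : geo_disk b -> PS b 0 = b O.
Proof. intros Hb. destruct (Hb (/ 2)) as [M HM]; [lra|]. apply (PS_0 (/ 2) M); auto. lra. Qed.

(* Differentiating [quot_identity] in [z]. *)
Lemma quot_dz_identity b z w : geo_disk b -> b O = 1 -> Cmod z < 1 -> Cmod w < 1 ->
  ((w - z) * quot_dz b w z - quot b w z)%C = (w * PS (dcoef b) z - PS b w)%C.
Proof.
intros Hb Hb0 Hz Hw.
assert (D1 : cder (fun v => (w - v) * quot b w v)%C z ((0 - 1) * quot b w z + (w - z) * quot_dz b w z)%C).
{ apply (cder_mult (fun v => w - v)%C (quot b w)).
  - apply (cder_minus (fun _ => w) (fun v => v)); [apply cder_const|apply cder_id].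
  - now apply quot_cder. }
assert (D2 : cder (fun v => w * PS b v - v * PS b w)%C z
   (w * PS (dcoef b) z - (1 * PS b w + z * 0))%C).
{ apply (cder_minus (fun v => w * PS b v)%C (fun v => v * PS b w)%C).
  - apply cder_scal. now apply geo_disk_cder.
  - apply (cder_mult (fun v => v) (fun _ => PS b w)); [apply cder_id|apply cder_const]. }
assert (E : ((0 - 1) * quot b w z + (w - z) * quot_dz b w z)%C = (w * PS (dcoef b) z - (1 * PS b w + z * 0))%C).
{ apply (cder_unique (fun v => w * PS b v - v * PS b w)%C z); auto.
  apply (cder_ext_loc (fun v => (w - v) * quot b w v)%C _ z _ (1 - Cmod z)); auto; [lra|].
  intros v Hv. apply quot_identity; auto. pose proof (Cmod_le_sub v z). lra. }
replace ((w - z) * quot_dz b w z - quot b w z)%C with ((0 - 1) * quot b w z + (w - z) * quot_dz b w z)%C by ring.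
rewrite E. ring.
Qed.

(** Off the diagonal this is injectivity of [z / PS b]. On it,
    [quot b w w = PS b w - w * PS (dcoef b) w], which is non-zero because the derivative of that map
    does not vanish. *)
Lemma quot_neq0 b z w : univalent_coef b -> Cmod z < 1 -> Cmod w < 1 -> quot b w z <> 0.
Proof.
intros [Hb [Hb0 [Hi Hd]]] Hz Hw E. destruct (Ceq_dec z w) as [->|n].
- assert (I := quot_dz_identity b w w Hb Hb0 Hw Hw). rewrite E in I.
  apply (Hd w Hw). replace (PS b w - w * PS (dcoef b) w)%C
    with (- (w * PS (dcoef b) w - PS b w))%C by ring.
  rewrite <- I. ring.
- apply n, Hi; auto. assert (I := quot_identity b z w Hb Hb0 Hz Hw). rewrite E, Cmult_0_r in I.
  replace (w * PS b z)%C with ((w * PS b z - z * PS b w) + z * PS b w)%C by ring.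
  rewrite <- I. ring.
Qed.

(** Carries regularity from the variable [z] over to the parameter [w]. *)
Lemma quot_sym b z w : geo_disk b -> b O = 1 -> Cmod z < 1 -> Cmod w < 1 -> quot b w z = quot b z w.
Proof.
intros Hb Hb0 Hz Hw. destruct (Ceq_dec z w) as [->|n]; auto.
assert (I := quot_identity b z w Hb Hb0 Hz Hw). assert (J := quot_identity b w z Hb Hb0 Hw Hz).
assert (N : (w - z)%C <> 0) by (apply Csub_neq0; auto).
replace (quot b w z) with ((w - z) * quot b w z / (w - z))%C by (field; auto).
replace (quot b z w) with (- ((z - w) * quot b z w) / (w - z))%C by (field; auto).
rewrite I, J. field. auto.
Qed.

(** Compactness of the product of two circles; [PS_lipschitz] in each variable, through [quot_sym],
    supplies the continuity. *)
Lemma quot_lower b r1 r2 : univalent_coef b -> 0 < r1 < 1 -> 0 < r2 < 1 -> exists m, 0 < m /\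
  forall t s, 0 <= t <= 2 * PI -> 0 <= s <= 2 * PI ->
    m <= Cmod (quot b (RtoC r2 * cis s) (RtoC r1 * cis t)).
Proof.
intros Hu H1 H2. assert (Hu' := Hu). destruct Hu' as [Hb [Hb0 _]].
set (R := Rmax r1 r2). assert (HR : R < 1) by (apply Rmax_lub_lt; lra).
pose proof (Rmax_l r1 r2) as L1. pose proof (Rmax_r r1 r2) as L2. fold R in L1, L2.
set (rho := (R + 1) / 2).
destruct (geo_qcoef_unif b R rho Hb) as [M [M0 HM]]; [unfold rho; lra|unfold rho; lra|].
destruct (PS_lipschitz rho M R) as [L [L0 HL]]; [unfold rho; lra|auto|].
set (P := fun t s => Cmod (quot b (RtoC r2 * cis s) (RtoC r1 * cis t))).
assert (Mz : forall r t, 0 < r -> r <= R -> Cmod (RtoC r * cis t) <= R).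
{ intros r t Hr Hr'. rewrite Cmod_circle_pos; lra. }
assert (Pp : forall t s, 0 < P t s).
{ intros t s. apply Cmod_gt_0, quot_neq0; auto; rewrite Cmod_circle_pos; lra. }
assert (Lip : forall t s t' s', Rabs (P t' s' - P t s) <= 2 * L * (Rabs (t' - t) + Rabs (s' - s))).
{ intros t s t' s'. unfold P. eapply Rle_trans; [apply Rabs_Cmod_sub|].
  eapply Rle_trans; [apply (Cmod_sub_triangle _ (quot b (RtoC r2 * cis s') (RtoC r1 * cis t)))|].
  assert (A : forall w t t' r, Cmod w <= R -> 0 < r -> r <= R ->
     Cmod (quot b w (RtoC r * cis t') - quot b w (RtoC r * cis t)) <= 2 * L * Rabs (t' - t)).
  { intros w x x' r Hw Hr Hr'. eapply Rle_trans; [apply HL; auto|].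
    replace (RtoC r * cis x' - RtoC r * cis x)%C with (RtoC r * (cis x' - cis x))%C by ring.
    rewrite Cmod_mult, Cmod_R, Rabs_pos_eq by lra. pose proof (cis_lip x' x).
    pose proof (Rabs_pos (x' - x)). pose proof (Cmod_ge_0 (cis x' - cis x)).
    assert (r * Cmod (cis x' - cis x) <= 2 * Rabs (x' - x)) by nra.
    apply Rle_trans with (L * (2 * Rabs (x' - x))); [now apply Rmult_le_compat_l|right; ring]. }
  rewrite Rmult_plus_distr_l. apply Rplus_le_compat.
  - apply A; [apply Mz; lra|lra|lra].
  - rewrite !(quot_sym b (RtoC r1 * cis t)) by (auto; rewrite Cmod_circle_pos; lra).
    apply A; [apply Mz; lra|lra|lra]. }
(* Within the second radius [P] loses at most half of its value, and the first makes the common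
   radius [d] at most [P] at the centre; hence [P >= d / 2] everywhere. *)
set (del := fun t s => Rmin (P t s) (P t s / (4 * (2 * L + 1)))).
assert (Hdel : forall t s, 0 < del t s).
{ intros t s. apply Rmin_pos; auto. apply Rdiv_lt_0_compat; auto. lra. }
destruct (compactness_value_2d 0 (2 * PI) 0 (2 * PI) (fun t s => mkposreal _ (Hdel t s))) as [d Hd].
exists (d / 2). split; [pose proof (cond_pos d); lra|]. intros t s Ht Hs.
destruct (Rle_dec (d / 2) (P t s)) as [|n]; auto. exfalso.
apply (Hd t s Ht Hs). intros [u [v [_ [_ [A1 [A2 A3]]]]]]. simpl in A1, A2, A3. apply n.
assert (B1 : del u v <= P u v) by apply Rmin_l.
assert (B2 : del u v <= P u v / (4 * (2 * L + 1))) by apply Rmin_r.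
assert (C1 := Lip u v t s). apply Rabs_le_between in C1.
assert (C2 : 2 * L * (Rabs (t - u) + Rabs (s - v)) <= P u v / 2).
{ set (e := P u v / (4 * (2 * L + 1))) in *.
  assert (e * (4 * (2 * L + 1)) = P u v) by (unfold e; field; lra).
  pose proof (Hdel u v). pose proof (Rabs_pos (t - u)). pose proof (Rabs_pos (s - v)). nra. }
lra.
Qed.

(** * Limits as the number of nodes grows *)

Definition tends (u : nat -> C) (l : C) : Prop :=
  forall eps, 0 < eps -> exists N0, forall N, (N0 <= N)%nat -> Cmod (u N - l) <= eps.

Lemma tends_approx u v l :
  (forall eps, 0 < eps -> exists N0, forall N, (N0 <= N)%nat -> Cmod (v N - u N) <= eps) ->
  tends u l -> tends v l.
Proof.
intros H Hu eps Heps. destruct (H (eps / 2)) as [N1 H1]; [lra|].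
destruct (Hu (eps / 2)) as [N2 H2]; [lra|]. exists (N1 + N2)%nat. intros N HN.
specialize (H1 N ltac:(lia)). specialize (H2 N ltac:(lia)).
pose proof (Cmod_sub_triangle (v N) (u N) l). lra.
Qed.

Lemma tends_ext_ev u v l N0 :
  (forall N, (N0 <= N)%nat -> u N = v N) -> tends u l -> tends v l.
Proof.
intros H. apply tends_approx. intros eps Heps. exists N0. intros N HN.
rewrite H by auto. rewrite Cmod_self. lra.
Qed.

Lemma tends_const c : tends (fun _ => c) c.
Proof. intros eps Heps. exists O. intros N _. rewrite Cmod_self. lra. Qed.

Lemma tends_plus u v l m : tends u l -> tends v m -> tends (fun N => u N + v N)%C (l + m).
Proof.
intros Hu Hv eps Heps. destruct (Hu (eps / 2)) as [N1 H1]; [lra|].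
destruct (Hv (eps / 2)) as [N2 H2]; [lra|]. exists (N1 + N2)%nat. intros N HN.
specialize (H1 N ltac:(lia)). specialize (H2 N ltac:(lia)).
replace (u N + v N - (l + m))%C with ((u N - l) + (v N - m))%C by ring.
eapply Rle_trans; [apply Cmod_triangle|]. lra.
Qed.

Lemma small_factor A eps : 0 <= A -> 0 < eps -> exists e, 0 < e /\ A * e <= eps.
Proof.
intros HA He. exists (eps / (A + 1)). split; [apply Rdiv_lt_0_compat; lra|].
apply Rmult_le_reg_r with (A + 1); [lra|].
replace (A * (eps / (A + 1)) * (A + 1)) with (A * eps) by (field; lra). nra.
Qed.

Lemma tends_scal c u l : tends u l -> tends (fun N => c * u N)%C (c * l).
Proof.
intros Hu eps Heps.
destruct (small_factor (Cmod c) eps (Cmod_ge_0 c) Heps) as [e [He Hce]].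
destruct (Hu e He) as [N0 H]. exists N0. intros N HN. specialize (H N HN).
replace (c * u N - c * l)%C with (c * (u N - l))%C by ring. rewrite Cmod_mult.
eapply Rle_trans; [|exact Hce]. apply Rmult_le_compat_l; auto. apply Cmod_ge_0.
Qed.

Lemma tends_conj u l : tends u l -> tends (fun N => Cconj (u N)) (Cconj l).
Proof.
intros Hu eps Heps. destruct (Hu eps Heps) as [N0 H]. exists N0. intros N HN.
rewrite <- Cminus_conj, Cmod_conj. auto.
Qed.

Lemma tends_csum (u : nat -> nat -> C) (l : nat -> C) K :
  (forall k, (k < K)%nat -> tends (u k) (l k)) ->
  tends (fun N => csum (fun k => u k N) K) (csum l K).
Proof.
induction K as [|K IH]; intros H; simpl; [apply tends_const|].
apply tends_plus; auto.
Qed.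

Lemma tends_congr u l m : l = m -> tends u l -> tends u m.
Proof. now intros ->. Qed.

Lemma avg_exchange N N' (f : nat -> nat -> C) : (0 < N)%nat -> (0 < N')%nat ->
  avg N (fun i => avg N' (fun j => f i j)) = avg N' (fun j => avg N (fun i => f i j)).
Proof.
intros H H'. unfold avg.
transitivity (csum (fun i => csum (fun j => f i j) N') N / RtoC (INR N') / RtoC (INR N))%C.
- f_equal. unfold Cdiv. rewrite Cmult_comm, <- csum_scal. apply csum_ext. intros; ring.
- rewrite csum_exchange.
  transitivity (csum (fun j => csum (fun i => f i j) N) N' / RtoC (INR N) / RtoC (INR N'))%C.
  + field. split; now apply RtoC_INR_neq0.
  + f_equal. unfold Cdiv. rewrite Cmult_comm, <- csum_scal. apply csum_ext. intros; ring.
Qed.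

(** * The logarithmic derivative of the two-variable function *)

Definition qlog (b : nat -> C) (w z : C) : C := (quot_dz b w z / quot b w z)%C.

Lemma quot_dz_cder b w z : geo_disk b -> Cmod z < 1 -> Cmod w < 1 -> exists l, cder (quot_dz b w) z l.
Proof.
intros Hb Hz Hw. eexists. apply geo_disk_cder; auto.
now apply geo_disk_dcoef, geo_disk_qcoef.
Qed.

Definition logder_coef (b : nat -> C) (w : C) (a : nat -> C) : Prop :=
  geo_disk a /\ (forall z, Cmod z < 1 -> quot_dz b w z = (PS a z * quot b w z)%C) /\
  (forall r B, 0 < r < 1 ->
    (forall t, 0 <= t <= 2 * PI -> Cmod (qlog b w (RtoC r * cis t)) <= B) -> geo r B a).

Definition logder (b : nat -> C) (c : C -> nat -> C) : Prop :=
  forall w, Cmod w < 1 -> logder_coef b w (c w).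

Lemma exists_logder b : univalent_coef b -> exists c, logder b c.
Proof.
intros Hu. assert (Hu' := Hu). destruct Hu' as [Hb [Hb0 _]].
apply (choice (fun w a => Cmod w < 1 -> logder_coef b w a)). intros w.
destruct (Rlt_dec (Cmod w) 1) as [Hw|n]; [|exists (fun _ => RtoC 0); intros K; lra].
assert (D : forall z, Cmod z < 1 -> exists l, cder (qlog b w) z l).
{ intros z Hz. destruct (quot_dz_cder b w z Hb Hz Hw) as [l Hl]. eexists.
  apply (cder_div (quot_dz b w) (quot b w)); [exact Hl|now apply quot_cder|now apply quot_neq0]. }
destruct (holomorphic_power_series (qlog b w) 1) as [c [C1 [C2 C3]]]; [lra| | |].
- intros z Hz. destruct (D z Hz) as [l Hl]. eapply cder_ccont; eauto.
- intros z Hz. apply D. lra.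
- exists c. intros _. split; [exact C2|]. split; [|exact C3].
  intros z Hz. rewrite <- C1 by auto. unfold qlog. field. now apply quot_neq0.
Qed.

Lemma qlog_bound b r1 r2 : univalent_coef b -> 0 < r1 < 1 -> 0 < r2 < 1 -> exists B, 0 <= B /\
  forall t s, 0 <= t <= 2 * PI -> 0 <= s <= 2 * PI ->
    Cmod (qlog b (RtoC r2 * cis s) (RtoC r1 * cis t)) <= B.
Proof.
intros Hu H1 H2. assert (Hu' := Hu). destruct Hu' as [Hb [Hb0 _]].
destruct (quot_lower b r1 r2 Hu H1 H2) as [m [Hm Hlow]].
set (R := Rmax r1 r2). assert (HR : R < 1) by (apply Rmax_lub_lt; lra).
pose proof (Rmax_l r1 r2) as L1. pose proof (Rmax_r r1 r2) as L2. fold R in L1, L2.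
set (rho := (R + 1) / 2). set (rho' := (R + rho) / 2).
destruct (geo_qcoef_unif b R rho Hb) as [M [M0 HM]]; [unfold rho; lra|unfold rho; lra|].
assert (Hrr : R < rho' /\ rho' < rho /\ rho < 1) by (unfold rho', rho; lra).
set (M' := M / rho / (1 - rho' / rho)).
assert (HM' : 0 <= M').
{ apply Rdiv_le_0_compat; [apply Rdiv_le_0_compat; lra|].
  pose proof (div_lt1 rho' rho). lra. }
assert (Q : r1 / rho' < 1).
{ apply div_lt1. lra. }
exists (2 * M' / (1 - r1 / rho') / m).
split; [repeat apply Rdiv_le_0_compat; lra|].
intros t s Ht Hs. unfold qlog.
set (z := (RtoC r1 * cis t)%C). set (w := (RtoC r2 * cis s)%C).
assert (Hz : Cmod z = r1) by (apply Cmod_circle_pos; lra).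
assert (Hw : Cmod w = r2) by (apply Cmod_circle_pos; lra).
rewrite Cmod_div by (apply quot_neq0; auto; lra).
assert (A : Cmod (quot_dz b w z) <= 2 * M' / (1 - r1 / rho')).
{ rewrite <- Hz. apply PS_bound; [lra| |lra].
  apply geo_dcoef_explicit; [lra|]. apply HM. lra. }
specialize (Hlow t s Ht Hs). fold z w in Hlow.
apply Rmult_le_compat; auto; [apply Cmod_ge_0| |].
- left; apply Rinv_0_lt_compat. lra.
- apply Rinv_le_contravar; lra.
Qed.

(** [quot] is a power series in [z] whose coefficients depend on [w]; this closed form makes
    holomorphy in [w] visible. *)
Lemma qlog_formula b w z : univalent_coef b -> Cmod z < 1 -> Cmod w < 1 -> w <> z ->
  qlog b w z = ((w * PS (dcoef b) z - PS b w) / (w * PS b z - z * PS b w) + 1 / (w - z))%C.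
Proof.
intros Hu Hz Hw Hn. assert (Hu' := Hu). destruct Hu' as [Hb [Hb0 _]].
assert (N := quot_neq0 b z w Hu Hz Hw). assert (N' := Csub_neq0 _ _ Hn).
rewrite <- (quot_dz_identity b z w), <- (quot_identity b z w) by auto. unfold qlog. field. auto.
Qed.

(** For [Cmod w < Cmod z] the diagonal is avoided, so [qlog_formula] applies and is holomorphic in
    [w]. *)
Lemma qlog_power_series b z : univalent_coef b -> 0 < Cmod z < 1 -> exists d,
  (forall w, Cmod w < Cmod z -> qlog b w z = PS d w) /\
  (forall r B, 0 < r < Cmod z ->
    (forall s, 0 <= s <= 2 * PI -> Cmod (qlog b (RtoC r * cis s) z) <= B) -> geo r B d).
Proof.
intros Hu Hz. assert (Hu' := Hu). destruct Hu' as [Hb [Hb0 _]].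
assert (D : forall w, Cmod w < Cmod z -> exists l, cder (fun w => qlog b w z) w l).
{ intros w Hw.
  assert (Hn : w <> z) by (intros K; rewrite K in Hw; lra).
  eexists.
  apply (cder_ext_loc (fun w => (w * PS (dcoef b) z - PS b w) / (w * PS b z - z * PS b w) + 1 / (w - z))%C
           (fun w => qlog b w z) w _ (Cmod z - Cmod w)); [lra| |].
  - intros v Hv. pose proof (Cmod_le_sub v w). symmetry. apply qlog_formula; auto; try lra.
    intros K. rewrite K in H. rewrite K in Hv. lra.
  - assert (Dg := geo_disk_cder b w Hb ltac:(lra)).
    apply (cder_plus (fun w => (w * PS (dcoef b) z - PS b w) / (w * PS b z - z * PS b w))%C
             (fun w => 1 / (w - z))%C).
    + apply (cder_div (fun w => w * PS (dcoef b) z - PS b w)%C (fun w => w * PS b z - z * PS b w)%C).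
      * apply (cder_minus (fun w => w * PS (dcoef b) z)%C (PS b)); [|exact Dg].
        apply (cder_mult (fun w => w) (fun _ => PS (dcoef b) z)); [apply cder_id|apply cder_const].
      * apply (cder_minus (fun w => w * PS b z)%C (fun w => z * PS b w)%C); [|apply cder_scal; exact Dg].
        apply (cder_mult (fun w => w) (fun _ => PS b z)); [apply cder_id|apply cder_const].
      * rewrite <- quot_identity by (auto; lra). apply Cmult_neq_0; [now apply Csub_neq0|].
        apply quot_neq0; auto; lra.
    + apply (cder_div (fun _ => RtoC 1) (fun w => w - z)%C); [apply cder_const| |now apply Csub_neq0].
      apply (cder_minus (fun w => w) (fun _ => z)); [apply cder_id|apply cder_const]. }
destruct (holomorphic_power_series (fun w => qlog b w z) (Cmod z)) as [d [D1 [_ D3]]]; [lra| | |].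
- intros w Hw. destruct (D w Hw) as [l Hl]. eapply cder_ccont; eauto.
- intros w Hw. apply D. lra.
- exists d. auto.
Qed.

Lemma root_cis N j : (j < N)%nat -> exists t, 0 <= t <= 2 * PI /\ root N j = cis t.
Proof.
intros H. exists (2 * PI * INR j / INR N). split; [|reflexivity].
assert (P := lt_0_INR N ltac:(lia)). pose proof (pos_INR j). pose proof PI_RGT_0.
assert (INR j <= INR N) by (apply le_INR; lia). split.
- apply Rdiv_le_0_compat; auto. nra.
- apply Rmult_le_reg_r with (INR N); auto. unfold Rdiv. rewrite Rmult_assoc, Rinv_l by lra. nra.
Qed.

Lemma qlog_PS b c w z : univalent_coef b -> logder b c -> Cmod w < 1 -> Cmod z < 1 -> qlog b w z = PS (c w) z.
Proof.
intros Hu Hc Hw Hz. destruct (Hc w Hw) as [_ [H _]]. unfold qlog. rewrite H by auto.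
field. now apply quot_neq0.
Qed.

Lemma geo_logder_unif b c r rho : univalent_coef b -> logder b c -> 0 < r < 1 -> 0 < rho < 1 -> exists B, 0 <= B /\
  forall N j, (j < N)%nat -> geo rho B (c (RtoC r * root N j)%C).
Proof.
intros Hu Hc Hr Hrho. destruct (qlog_bound b rho r Hu Hrho Hr) as [B [HB HL]].
exists B. split; auto. intros N j Hj.
destruct (root_cis N j Hj) as [s [Hs ->]].
destruct (Hc (RtoC r * cis s)%C) as [_ [_ H]]; [rewrite Cmod_circle_pos; lra|].
apply H; auto.
Qed.

(* As functions of the first variable the coefficients are limits of averages of the
   holomorphic functions [qlog b _ z], hence carry no negative frequency. *)
Lemma logder_coef_avg_neg b c r p l : univalent_coef b -> logder b c -> 0 < r < 1 -> (0 < l)%nat ->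
  tends (fun N => avg N (fun k => c (RtoC r * root N k)%C p * root N k ^ l)%C) 0.
Proof.
intros Hu Hc Hr Hl eps Heps. unfold Cminus.
(* Radii [r < r2 < r1 < r3 < 1]: [w] runs over the circle of radius [r] and [z] over that of radius
   [r1]. The expansion in [w] is controlled at radius [r2 < |z|], the one in [z] at radius [r3]. *)
set (r2 := (3 * r + 1) / 4). set (r1 := (r + 1) / 2). set (r3 := (r + 3) / 4).
assert (Hrr : 0 < r < r2 /\ r2 < r1 < r3 /\ r3 < 1) by (unfold r1, r2, r3; lra).
assert (P1 : 0 < r1 ^ p) by (apply pow_lt; lra).
destruct (small_factor (2 / r1 ^ p) eps) as [e [He Hee]]; auto.
{ apply Rdiv_le_0_compat; lra. }
destruct (qlog_bound b r1 r2 Hu) as [B12 [HB12 HL12]]; try lra.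
destruct (geo_logder_unif b c r r3 Hu Hc) as [B3 [HB3 HG3]]; try lra.
destruct (alias_neg r2 B12 r l e Hl) as [N0 [HN0 HA]]; auto; try lra.
exists N0. intros N HN.
destruct (alias_pos r3 B3 r1 p e) as [N1 [HN1 HA1]]; auto; try lra.
specialize (HA N HN). specialize (HA1 N1 (le_n N1)).
rewrite Copp_0, Cplus_0_r.
(* The double average is small when [w] is averaged first. In [Y], averaging [z] first extracts the
   coefficient of index [p]. *)
assert (X : Cmod (avg N1 (fun j => avg N (fun k =>
   PS (c (RtoC r * root N k)%C) (RtoC r1 * root N1 j) * root N k ^ l)%C * Cconj (root N1 j) ^ p)%C) <= e).
{ apply avg_bound; auto. intros j Hj. rewrite Cmod_mult, Cmod_conj_root_pow, Rmult_1_r.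
  destruct (root_cis N1 j Hj) as [t [Ht Et]]. set (z := (RtoC r1 * root N1 j)%C).
  assert (Hz : Cmod z = r1) by (apply Cmod_scaled_root; lra).
  destruct (qlog_power_series b z Hu) as [d [D1 D2]]; [lra|].
  assert (Gd : geo r2 B12 d).
  { apply D2; [lra|]. intros s Hs. unfold z. rewrite Et. now apply HL12. }
  specialize (HA d Gd).
  rewrite (avg_ext N _ (fun k => PS d (RtoC r * root N k) * root N k ^ l)%C); auto.
  intros k Hk. rewrite <- D1, (qlog_PS b c); auto; rewrite ?Hz, ?Cmod_scaled_root; lra. }
assert (Y : Cmod (avg N1 (fun j => avg N (fun k =>
   PS (c (RtoC r * root N k)%C) (RtoC r1 * root N1 j) * root N k ^ l)%C * Cconj (root N1 j) ^ p)%C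
   - avg N (fun k => c (RtoC r * root N k)%C p * RtoC r1 ^ p * root N k ^ l)%C) <= e).
{ rewrite (avg_ext N1 _ (fun j => avg N (fun k => PS (c (RtoC r * root N k)%C) (RtoC r1 * root N1 j) * Cconj (root N1 j) ^ p * root N k ^ l)%C)).
  2:{ intros j _. rewrite Cmult_comm, <- avg_scal by lia. apply avg_ext. intros k _. ring. }
  rewrite avg_exchange by lia. apply avg_sub_bound; [lia|]. intros k Hk.
  rewrite (avg_ext N1 _ (fun j => root N k ^ l * (PS (c (RtoC r * root N k)%C) (RtoC r1 * root N1 j) * Cconj (root N1 j) ^ p))%C)
    by (intros; ring).
  rewrite avg_scal by lia.
  match goal with |- Cmod (?a * ?x - ?y * ?z * ?a)%C <= _ =>
    replace (a * x - y * z * a)%C with (a * (x - y * z))%C by ring end.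
  rewrite Cmod_mult, Cmod_root_pow, Rmult_1_l. apply HA1. now apply HG3. }
assert (Z : Cmod (avg N (fun k => c (RtoC r * root N k)%C p * RtoC r1 ^ p * root N k ^ l)%C) <= 2 * e).
{ rewrite Cmod_sub_sym in Y.
  match type of X with Cmod ?x <= _ => eapply Rle_trans; [apply (Cmod_le_sub _ x)|] end. lra. }
rewrite (avg_ext N _ (fun k => RtoC r1 ^ p * (c (RtoC r * root N k)%C p * root N k ^ l))%C) in Z by (intros; ring).
rewrite avg_scal in Z by lia. rewrite Cmod_mult, Cmod_pow, Cmod_R in Z.
rewrite Rabs_pos_eq in Z by lra.
eapply Rle_trans; [|exact Hee].
apply Rmult_le_reg_l with (r1 ^ p); auto.
eapply Rle_trans; [exact Z|]. right. field. lra.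
Qed.

(** The expansion in [w] of [c w 0], the coefficient of [z] in the logarithm of [quot], which equals
    [qcoef b w 1]. *)
Definition first_coef (b : nat -> C) (n : nat) : C :=
  match n with O => RtoC 0 | S k => (- b (S (S k)))%C end.

Lemma geo_disk_first_coef b : geo_disk b -> geo_disk (first_coef b).
Proof.
intros Hb r Hr. destruct (Hb r Hr) as [M HM].
exists (M / r). intros n. pose proof (geo_pos _ _ _ HM).
destruct n as [|k].
- simpl. rewrite Cmod_0, Rmult_0_l. apply Rdiv_le_0_compat; lra.
- unfold first_coef. rewrite Cmod_opp. specialize (HM (S (S k))).
  apply Rmult_le_reg_r with r; [lra|].
  replace (M / r * r) with M by (field; lra). simpl pow in *. lra.
Qed.

Lemma PS_first_coef b c w : univalent_coef b -> logder b c -> Cmod w < 1 -> PS (first_coef b) w = c w O.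
Proof.
intros Hu Hc Hw. assert (Hu' := Hu). destruct Hu' as [Hb [Hb0 _]].
destruct (Hc w Hw) as [Ec [Hc1 _]].
assert (E : c w O = qcoef b w 1).
{ specialize (Hc1 0). rewrite Cmod_0 in Hc1. specialize (Hc1 Rlt_0_1).
  unfold quot_dz, quot in Hc1. rewrite !geo_disk_PS_0 in Hc1; auto.
  - unfold dcoef in Hc1. simpl in Hc1. simpl. 
    replace (c w O) with (c w O * 1)%C by ring. rewrite <- Hc1. ring.
  - now apply geo_disk_qcoef.
  - now apply geo_disk_dcoef, geo_disk_qcoef. }
rewrite E. unfold qcoef.
destruct (geo_disk_pair (first_coef b) w w (geo_disk_first_coef b Hb) Hw Hw) as [rho [M [Hr [Hwr [_ HM]]]]].
destruct (geo_disk_pair b w w Hb Hw Hw) as [rho' [M' [Hr' [Hwr' [_ HM']]]]].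
set (t := Cmod w / rho). set (t' := Cmod w / rho').
assert (T := ratio_lt1 w rho ltac:(lra) Hwr). assert (T' := ratio_lt1 w rho' ltac:(lra) Hwr').
fold t in T. fold t' in T'.
assert (G2 := geo_tail rho' M' b 2 ltac:(lra) HM').
rewrite (PS_shift rho M) by (auto; lra). simpl (first_coef b 0). rewrite Cplus_0_l.
replace (- (w * tail_series b 2 w))%C with (w * (- tail_series b 2 w))%C by ring. f_equal.
symmetry. apply (PS_unique rho' (M' / rho' ^ 2) _ _ _ (2 * (M' / rho' ^ 2) / (1 - t'))); try lra.
- intros n. unfold shift, first_coef. rewrite Cmod_opp. apply (G2 n).
- intros n. fold t'.
  replace (- tail_series b 2 w - psum (shift (first_coef b)) w n)%C
    with (- (tail_series b 2 w - psum (fun j => b (2 + j)%nat) w n))%C.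
  + rewrite Cmod_opp. eapply Rle_trans; [apply (PS_rem rho' (M' / rho' ^ 2)); auto; lra|].
    fold t'. right. unfold Rdiv. ring.
  + unfold psum. replace (csum (fun n0 => shift (first_coef b) n0 * w ^ n0)%C n)
      with ((-(1)) * csum (fun n0 => b (2 + n0)%nat * w ^ n0) n)%C; [ring|].
    rewrite <- csum_scal. apply csum_ext. intros k _. unfold shift, first_coef. simpl. ring.
Qed.

(** The values of [Re L] at pairs of nodes on the circle of radius [r]; by [quot_exp] they are
    logarithms of [|quot|]. *)
Definition lquot (c : C -> nat -> C) (r : R) (N i j : nat) : R := Re (PS (icoef (c (RtoC r * root N j)%C)) (RtoC r * root N i)).

Lemma quot_exp b c w z : univalent_coef b -> logder b c -> Cmod w < 1 -> Cmod z < 1 -> Cmod (quot b w z) = exp (Re (PS (icoef (c w)) z)).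
Proof.
intros Hu Hc Hw Hz. assert (Hu' := Hu). destruct Hu' as [Hb [Hb0 _]].
destruct (Hc w Hw) as [Ec [Hc1 _]].
destruct (geo_disk_pair (c w) z z Ec Hz Hz) as [rho [M [Hr [Hzr [_ HM]]]]].
apply (log_modulus (quot b w) (quot_dz b w) (c w) rho M); auto; try lra.
- intros v Hv. split; [apply quot_cder|apply Hc1]; auto; lra.
- unfold quot. rewrite geo_disk_PS_0; [reflexivity|now apply geo_disk_qcoef].
Qed.

(** The expansion treats the two variables differently; the symmetry of [quot] is recovered through
    its modulus and injectivity of [exp]. *)
Lemma lquot_sym b c r N i j : univalent_coef b -> logder b c -> 0 < r < 1 -> lquot c r N i j = lquot c r N j i.
Proof.
intros Hu Hc Hr. assert (Hu' := Hu). destruct Hu' as [Hb [Hb0 _]]. apply exp_inv. unfold lquot.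
rewrite <- !(quot_exp b c) by (auto; rewrite Cmod_scaled_root; lra).
f_equal. apply quot_sym; auto; rewrite Cmod_scaled_root; lra.
Qed.

(** * The area theorem *)

Definition weight (Y : nat -> C) (K N i : nat) : C :=
  (Cconj (root N i) + csum (fun l => Y l * root N i ^ S l) K)%C.

Definition weight_bound (Y : nat -> C) (K : nat) : R := 1 + rsum (fun l => Cmod (Y l)) K.

Lemma Cmod_weight Y K N i : Cmod (weight Y K N i) <= weight_bound Y K.
Proof.
unfold weight, weight_bound. eapply Rle_trans; [apply Cmod_triangle|].
rewrite Cmod_conj, Cmod_root. apply Rplus_le_compat_l.
eapply Rle_trans; [apply Cmod_csum_le|]. apply rsum_le. intros l _.
rewrite Cmod_mult, Cmod_root_pow. lra.
Qed.

Lemma weight_bound_ge1 Y K : 1 <= weight_bound Y K.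
Proof.
unfold weight_bound. assert (0 <= rsum (fun l => Cmod (Y l)) K); [|lra].
rewrite <- (rsum_0 K). apply rsum_le. intros; apply Cmod_ge_0.
Qed.

Lemma avg_mult_weight Y K N (phi : nat -> C) : (0 < N)%nat ->
  avg N (fun i => phi i * weight Y K N i)%C =
  (avg N (fun i => phi i * Cconj (root N i))
   + csum (fun l => Y l * avg N (fun i => phi i * root N i ^ S l)) K)%C.
Proof.
intros HN. rewrite (avg_ext N _ (fun i => phi i * Cconj (root N i)
   + csum (fun l => Y l * (phi i * root N i ^ S l)) K)%C).
- rewrite avg_plus by auto. f_equal.
  rewrite (avg_csum N (fun l i => Y l * (phi i * root N i ^ S l))%C) by auto.
  apply csum_ext. intros l _. now rewrite avg_scal.
- intros i _. unfold weight. rewrite Cmult_plus_distr_l, <- csum_scal. f_equal.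
  apply csum_ext. intros l _. ring.
Qed.

Lemma avg_mult_conj_weight Y K N (phi : nat -> C) : (0 < N)%nat ->
  avg N (fun i => phi i * Cconj (weight Y K N i))%C =
  (avg N (fun i => phi i * root N i)
   + csum (fun l => Cconj (Y l) * avg N (fun i => phi i * Cconj (root N i) ^ S l)) K)%C.
Proof.
intros HN. rewrite (avg_ext N _ (fun i => Cconj (Cconj (phi i) * weight Y K N i))%C).
2:{ intros i _. now rewrite Cmult_conj, Cconj_conj. }
rewrite <- avg_conj, avg_mult_weight, Cplus_conj, csum_conj, avg_conj by auto. f_equal.
- apply avg_ext. intros i _. now rewrite Cmult_conj, !Cconj_conj.
- apply csum_ext. intros l _. rewrite Cmult_conj, avg_conj by auto. f_equal.
  apply avg_ext. intros i _. now rewrite Cmult_conj, Cconj_conj, Cpow_conj.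
Qed.

(** The frequencies of the weight are [-1] and [1] to [K], none of them zero modulo [N]. This is the
    mass condition of conditional positivity. *)
Lemma csum_weight Y K N : (S K < N)%nat -> csum (weight Y K N) N = 0.
Proof.
intros HN. assert (A : avg N (weight Y K N) = 0).
{ rewrite (avg_ext N _ (fun i => 1 * weight Y K N i)%C) by (intros; ring).
  rewrite avg_mult_weight by lia.
  rewrite (avg_ext N _ (fun i => Cconj (root N i ^ 1))) by (intros; simpl; rewrite Cmult_1_r; ring).
  rewrite <- avg_conj, avg_root_pow by lia.
  rewrite (csum_ext _ (fun _ => RtoC 0)), csum_0.
  - apply injective_projections; simpl; ring.
  - intros l Hl. rewrite (avg_ext N _ (fun i => root N i ^ S l)%C) by (intros; ring).
    rewrite avg_root_pow by lia. ring. }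
unfold avg in A. assert (H : RtoC (INR N) <> 0) by (apply RtoC_INR_neq0; lia).
replace (csum (weight Y K N) N) with (csum (weight Y K N) N / RtoC (INR N) * RtoC (INR N))%C by (field; auto).
rewrite A. ring.
Qed.

(** What the weight extracts from [Re (PS a)]: the real part puts half of each coefficient at
    frequency [n] and half of its conjugate at [-n]. The mode [-1] reads [a 1], and the mode [S l]
    reads the conjugate of [a (S l)]. *)
Definition row_limit (Y : nat -> C) (K : nat) (r : R) (a : nat -> C) : C :=
  (/ 2 * (a 1%nat * RtoC r + csum (fun l => Y l * (Cconj (a (S l)) * RtoC r ^ S l)) K))%C.

Lemma row_weight Y K rho M r : 0 < r < rho -> 0 <= M ->
  forall eps, 0 < eps -> exists N0, (0 < N0)%nat /\ forall N, (N0 <= N)%nat ->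
    forall a, geo rho M a ->
    Cmod (avg N (fun i => RtoC (Re (PS a (RtoC r * root N i))) * weight Y K N i)%C - row_limit Y K r a) <= eps.
Proof.
intros Hr HM. induction K as [|K IH]; intros eps Heps.
- destruct (row_pos rho M r 1 eps ltac:(lia) Hr HM Heps) as [N0 [P0 H]].
  exists N0. split; auto. intros N HN a Ha. specialize (H N HN a Ha).
  unfold row_limit, weight. simpl csum. eapply Rle_trans; [|exact H]. right. f_equal. f_equal.
  + apply avg_ext. intros i _. simpl. rewrite Cmult_1_r. ring.
  + simpl. rewrite Cmult_1_r. ring.
- destruct (IH (eps / 2)) as [N1 [P1 H1]]; [lra|].
  destruct (small_factor (Cmod (Y K)) (eps / 2) (Cmod_ge_0 _)) as [e [He Hee]]; [lra|].
  destruct (row_neg rho M r (S K) e ltac:(lia) Hr HM He) as [N2 [P2 H2]].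
  exists (N1 + N2)%nat. split; [lia|]. intros N HN a Ha.
  specialize (H1 N ltac:(lia) a Ha). specialize (H2 N ltac:(lia) a Ha).
  rewrite avg_mult_weight in H1 |- * by lia. unfold row_limit in *. cbn [csum].
  match goal with |- Cmod (?x + (?y + ?z * ?u) - ?h * (?v + (?w + ?z * ?t)))%C <= _ =>
    replace (x + (y + z * u) - h * (v + (w + z * t)))%C
      with ((x + y - h * (v + w)) + z * (u - h * t))%C by ring end.
  eapply Rle_trans; [apply Cmod_triangle|]. rewrite Cmod_mult.
  apply Rmult_le_compat_l with (r := Cmod (Y K)) in H2; [|apply Cmod_ge_0]. lra.
Qed.

Lemma tends_alias_pos rho M r p a : 0 < r < rho -> geo rho M a ->
  tends (fun N => avg N (fun j => PS a (RtoC r * root N j) * Cconj (root N j) ^ p)%C) (a p * RtoC r ^ p).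
Proof.
intros Hr Ha eps Heps. destruct (alias_pos rho M r p eps Hr (geo_pos _ _ _ Ha) Heps) as [N0 [_ H]].
exists N0. intros N HN. now apply H.
Qed.

Lemma tends_alias_neg rho M r p a : (0 < p)%nat -> 0 < r < rho -> geo rho M a ->
  tends (fun N => avg N (fun j => PS a (RtoC r * root N j) * root N j ^ p)%C) 0.
Proof.
intros Hp Hr Ha eps Heps. destruct (alias_neg rho M r p eps Hp Hr (geo_pos _ _ _ Ha) Heps) as [N0 [_ H]].
exists N0. intros N HN. unfold Cminus. rewrite Copp_0, Cplus_0_r. now apply H.
Qed.

Lemma tends_alias_weight Y K rho M r a : 0 < r < rho -> geo rho M a ->
  tends (fun N => avg N (fun j => PS a (RtoC r * root N j) * Cconj (weight Y K N j))%C)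
    (csum (fun l => Cconj (Y l) * (a (S l) * RtoC r ^ S l)) K)%C.
Proof.
intros Hr Ha.
apply (tends_ext_ev (fun N => avg N (fun j => PS a (RtoC r * root N j) * root N j ^ 1)
  + csum (fun l => Cconj (Y l) * avg N (fun j => PS a (RtoC r * root N j) * Cconj (root N j) ^ S l)) K)%C _ _ 1).
- intros N HN. rewrite avg_mult_conj_weight by lia. f_equal.
  apply avg_ext. intros j _. simpl. rewrite Cmult_1_r. reflexivity.
- rewrite <- (Cplus_0_l (csum _ K)). apply tends_plus; [eapply tends_alias_neg; eauto|].
  apply (tends_csum (fun l N => Cconj (Y l) * avg N (fun j => PS a (RtoC r * root N j) * Cconj (root N j) ^ S l))%C
    (fun l => Cconj (Y l) * (a (S l) * RtoC r ^ S l))%C).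
  intros l _. apply tends_scal. eapply tends_alias_pos; eauto.
Qed.

Lemma havg_ext x k k' N : (forall i j, (i < N)%nat -> (j < N)%nat -> k i j = k' i j) ->
  havg x k N = havg x k' N.
Proof.
intros H. apply avg_ext. intros j Hj. f_equal. apply avg_ext. intros i Hi. now rewrite H.
Qed.

Lemma havg_plus x k k' N : (0 < N)%nat ->
  havg x (fun i j => k i j + k' i j) N = (havg x k N + havg x k' N)%C.
Proof.
intros HN. unfold havg. rewrite <- avg_plus by auto. apply avg_ext. intros j _.
rewrite <- Cmult_plus_distr_r, <- avg_plus by auto. f_equal. apply avg_ext.
intros i _. rewrite RtoC_plus. ring.
Qed.

Lemma havg_scal x c k N : (0 < N)%nat ->
  havg x (fun i j => c * k i j) N = (RtoC c * havg x k N)%C.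
Proof.
intros HN. unfold havg. rewrite <- avg_scal by auto. apply avg_ext. intros j _.
rewrite Cmult_assoc, <- avg_scal by auto. f_equal. apply avg_ext.
intros i _. rewrite RtoC_mult. ring.
Qed.

Lemma havg_const x c N : (0 < N)%nat -> csum x N = 0 -> havg x (fun _ _ => c) N = 0.
Proof.
intros HN Hx. unfold havg. rewrite (avg_ext N _ (fun _ => RtoC 0)); [now apply avg_const|].
intros j _. rewrite avg_scal by auto. unfold avg. rewrite Hx. field. now apply RtoC_INR_neq0.
Qed.

Lemma havg_rows Y K N k (L : nat -> C) eps : (0 < N)%nat ->
  (forall j, (j < N)%nat -> Cmod (avg N (fun i => RtoC (k i j) * weight Y K N i)%C - L j) <= eps) ->
  Cmod (havg (weight Y K N) k N - avg N (fun j => L j * Cconj (weight Y K N j))%C) <= eps * weight_bound Y K.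
Proof.
intros HN H. unfold havg. apply avg_sub_bound; auto. intros j Hj.
match goal with |- Cmod (?a * ?c - ?b * ?c)%C <= _ =>
  replace (a * c - b * c)%C with ((a - b) * c)%C by ring end.
rewrite Cmod_mult, Cmod_conj. apply Rmult_le_compat; auto; try apply Cmod_ge_0. apply Cmod_weight.
Qed.

(** The mixed average [X] of [lquot] is computed twice. Rows extract the coefficient of index [S l]
    in [z]; by symmetry the columns extract the coefficient of index 1, which [PS_first_coef]
    identifies. *)
Lemma tends_coef_first b c r l : univalent_coef b -> logder b c -> 0 < r < 1 ->
  tends (fun N => avg N (fun j => icoef (c (RtoC r * root N j)%C) (S l) * Cconj (root N j))%C)
    (RtoC r * first_coef b (S l))%C.
Proof.
intros Hu Hc Hr. assert (Hu' := Hu). destruct Hu' as [Hb _].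
set (rho := (r + 1) / 2). assert (Hrho : r < rho < 1) by (unfold rho; lra).
destruct (geo_logder_unif b c r rho Hu Hc Hr) as [B [HB HG]]; [lra|].
assert (Hi : forall N j, (j < N)%nat -> geo rho (B * rho) (icoef (c (RtoC r * root N j)%C))).
{ intros N j Hj. apply geo_icoef; [lra|]. now apply HG. }
assert (HB' : 0 <= B * rho) by (apply Rmult_le_pos; lra).
destruct (geo_disk_first_coef b Hb rho) as [Ma HMa]; [lra|].
assert (Rn : RtoC r <> 0) by (intros E; apply RtoC_inj in E; lra).
assert (Rp : (RtoC r ^ S l)%C <> 0) by now apply Cpow_nz.
set (X := fun N => avg N (fun j => avg N (fun i => RtoC (lquot c r N i j) * Cconj (root N i) ^ S l)%C * Cconj (root N j))%C).
assert (T1 : tends X (/ 2 * RtoC r * (first_coef b (S l) * RtoC r ^ S l))%C).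
{ apply (tends_approx (fun N => / 2 * RtoC r * avg N (fun i => PS (first_coef b) (RtoC r * root N i) * Cconj (root N i) ^ S l))%C).
  - intros eps Heps. destruct (row_pos rho (B * rho) r 1 eps) as [N0 [P0 H]]; auto; try lra.
    exists N0. intros N HN. unfold X.
    replace (avg N (fun j => avg N (fun i => RtoC (lquot c r N i j) * Cconj (root N i) ^ S l)%C * Cconj (root N j))%C)
      with (avg N (fun i => avg N (fun j => RtoC (lquot c r N j i) * Cconj (root N j) ^ 1)%C * Cconj (root N i) ^ S l)%C).
    + rewrite <- avg_scal by lia. apply avg_sub_bound; [lia|]. intros i Hi'.
      rewrite <- (Rmult_1_r eps).
      match goal with |- Cmod (?a * ?c - ?h * (?b * ?c))%C <= _ =>
        replace (a * c - h * (b * c))%C with ((a - h * b) * c)%C by ring end.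
      rewrite Cmod_mult, Cmod_conj_root_pow. apply Rmult_le_compat_r; [lra|].
      specialize (H N HN _ (Hi N i Hi')). eapply Rle_trans; [|exact H]. right. f_equal. f_equal.
      rewrite (PS_first_coef b c) by (auto; rewrite Cmod_scaled_root; lra).
      simpl. field.
    + symmetry. rewrite (avg_ext N _ (fun j => avg N (fun i => RtoC (lquot c r N i j) * Cconj (root N i) ^ S l * Cconj (root N j))%C)).
      2:{ intros j _. rewrite Cmult_comm, <- avg_scal by lia. apply avg_ext. intros; ring. }
      rewrite avg_exchange by lia. apply avg_ext. intros i _.
      rewrite (Cmult_comm (avg N _)), <- avg_scal by lia. apply avg_ext. intros j _.
      rewrite (lquot_sym b c) by auto. simpl. ring.
  - apply tends_scal. apply (tends_alias_pos rho Ma); auto. lra. }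
assert (T2 : tends (fun N => / 2 * RtoC r ^ S l * avg N (fun j => icoef (c (RtoC r * root N j)%C) (S l) * Cconj (root N j)))%C
   (/ 2 * RtoC r * (first_coef b (S l) * RtoC r ^ S l))%C).
{ apply (tends_approx X); auto. intros eps Heps.
  destruct (row_pos rho (B * rho) r (S l) eps) as [N0 [P0 H]]; auto; try lra; [lia|].
  exists N0. intros N HN. unfold X. rewrite <- avg_scal by lia. apply avg_sub_bound; [lia|].
  intros j Hj. specialize (H N HN _ (Hi N j Hj)).
  rewrite Cmod_sub_sym.
  match goal with |- Cmod (?a * ?c - ?h * ?q * (?b * ?c))%C <= _ =>
    replace (a * c - h * q * (b * c))%C with ((a - h * (b * q)) * c)%C by ring end.
  rewrite Cmod_mult, Cmod_conj, Cmod_root, Rmult_1_r. exact H. }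
apply (tends_scal (2 / RtoC r ^ S l)%C) in T2.
eapply tends_congr; [|eapply (tends_ext_ev _ _ _ 0); [|exact T2]].
- field. repeat split; auto using C2_neq0.
- intros N _. cbv beta. field. repeat split; auto using C2_neq0.
Qed.

(** Only the mode [-1] contributes: against the modes [S m] the average tends to zero by
    [logder_coef_avg_neg]. *)
Lemma tends_coef_weight Y K b c r l : univalent_coef b -> logder b c -> 0 < r < 1 ->
  tends (fun N => avg N (fun j => icoef (c (RtoC r * root N j)%C) (S l) * weight Y K N j)%C)
    (RtoC r * first_coef b (S l))%C.
Proof.
intros Hu Hc Hr.
apply (tends_ext_ev (fun N => avg N (fun j => icoef (c (RtoC r * root N j)%C) (S l) * Cconj (root N j))
  + csum (fun m => Y m * (/ RtoC (INR (S l)) * avg N (fun j => c (RtoC r * root N j)%C l * root N j ^ S m))) K)%C _ _ 1).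
- intros N HN. rewrite avg_mult_weight by lia. f_equal. apply csum_ext. intros m _. f_equal.
  rewrite <- avg_scal by lia. apply avg_ext. intros j _. unfold icoef, Cdiv. ring.
- eapply tends_congr; [|apply tends_plus; [exact (tends_coef_first b c r l Hu Hc Hr)|]].
  2:{ apply (tends_csum (fun m N => Y m * (/ RtoC (INR (S l)) * avg N (fun j => c (RtoC r * root N j)%C l * root N j ^ S m)))%C
        (fun m => Y m * (/ RtoC (INR (S l)) * 0))%C).
      intros m _. apply tends_scal, tends_scal. apply (logder_coef_avg_neg b c); auto. lia. }
  rewrite (csum_ext _ (fun _ => RtoC 0)), csum_0; [ring|]. intros; ring.
Qed.

Definition cross_limit (Y : nat -> C) (K : nat) (b : nat -> C) (r : R) : C :=
  (RtoC r * csum (fun l => Cconj (Y l) * (first_coef b (S l) * RtoC r ^ S l)) K)%C.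

(** Rows read by the mode [-1] pair with the conjugate [Y] modes, and rows read by the [Y] modes
    pair with the mode [-1]. The two contributions are conjugate halves of [cross_limit], and all
    other pairings ask for a negative frequency. *)
Lemma tends_havg_lquot Y K b c r : univalent_coef b -> logder b c -> 0 < r < 1 ->
  tends (fun N => havg (weight Y K N) (lquot c r N) N) (RtoC (Re (cross_limit Y K b r))).
Proof.
intros Hu Hc Hr. assert (Hu' := Hu). destruct Hu' as [Hb _].
set (rho := (r + 1) / 2). assert (Hrho : r < rho < 1) by (unfold rho; lra).
destruct (geo_logder_unif b c r rho Hu Hc Hr) as [B [HB HG]]; [lra|].
assert (Hi : forall N j, (j < N)%nat -> geo rho (B * rho) (icoef (c (RtoC r * root N j)%C))).
{ intros N j Hj. apply geo_icoef; [lra|]. now apply HG. }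
assert (HB' : 0 <= B * rho) by (apply Rmult_le_pos; lra).
destruct (geo_disk_first_coef b Hb rho) as [Ma HMa]; [lra|].
apply (tends_approx (fun N => avg N (fun j => row_limit Y K r (icoef (c (RtoC r * root N j)%C)) * Cconj (weight Y K N j))%C)).
{ intros eps Heps. pose proof (weight_bound_ge1 Y K) as HBx.
  destruct (row_weight Y K rho (B * rho) r ltac:(lra) HB' (eps / weight_bound Y K)) as [N0 [P0 H]].
  { apply Rdiv_lt_0_compat; lra. }
  exists N0. intros N HN.
  replace eps with (eps / weight_bound Y K * weight_bound Y K) by (field; lra).
  apply (havg_rows Y K N (lquot c r N) (fun j => row_limit Y K r (icoef (c (RtoC r * root N j)%C)))); [lia|].
  intros j Hj. apply H; auto. }
apply (tends_ext_ev (fun N => / 2 * (RtoC r * avg N (fun j => PS (first_coef b) (RtoC r * root N j) * Cconj (weight Y K N j))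
   + csum (fun l => Y l * RtoC r ^ S l * Cconj (avg N (fun j => icoef (c (RtoC r * root N j)%C) (S l) * weight Y K N j))) K))%C _ _ 1).
- intros N HN.
  rewrite (csum_ext _ (fun l => avg N (fun j => Y l * RtoC r ^ S l * (Cconj (icoef (c (RtoC r * root N j)%C) (S l)) * Cconj (weight Y K N j))))%C).
  2:{ intros l _. rewrite avg_conj, <- avg_scal by lia. apply avg_ext. intros j _. now rewrite Cmult_conj. }
  rewrite <- (avg_csum N) by lia. rewrite <- avg_scal, <- avg_plus, <- avg_scal by lia.
  apply avg_ext. intros j Hj. unfold row_limit.
  rewrite (PS_first_coef b c) by (auto; rewrite Cmod_scaled_root; lra).
  rewrite <- Cmult_assoc. f_equal. rewrite Cmult_plus_distr_r. f_equal.
  + simpl. field.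
  + rewrite (Cmult_comm (csum _ K)), <- csum_scal. apply csum_ext. intros l _. ring.
- rewrite RtoC_Re. apply tends_scal. apply tends_plus.
  + apply tends_scal. apply (tends_alias_weight Y K rho Ma); auto. lra.
  + eapply tends_congr; [|apply (tends_csum
      (fun l N => Y l * RtoC r ^ S l * Cconj (avg N (fun j => icoef (c (RtoC r * root N j)%C) (S l) * weight Y K N j)))%C
      (fun l => Y l * RtoC r ^ S l * Cconj (RtoC r * first_coef b (S l)))%C)].
    * unfold cross_limit. rewrite Cmult_conj, csum_conj, <- csum_scal. apply csum_ext. intros l _.
      rewrite !Cmult_conj, Cconj_conj, Cpow_conj, !Cconj_RtoC. ring.
    * intros l _. apply tends_scal, tends_conj. now apply tends_coef_weight.
Qed.

Lemma PS_dilate a q z : PS a (q * z) = PS (fun n => a n * q ^ n)%C z.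
Proof.
unfold PS, CSer. f_equal; apply Series_ext; intros n; rewrite Cpow_mult_l; f_equal; ring.
Qed.

(** Coefficients in [z] of [- 2 log (1 - rho q z)]. *)
Definition circle_coef (rho : R) (q : C) (n : nat) : C := (-(2) * logc n * (RtoC rho * q) ^ n)%C.

(** The factor [RtoC 1] puts the kernel in the form required by the averaging lemmas, with radius
    1. *)
Definition ckernel (rho : R) (N i j : nat) : R := Re (PS (circle_coef rho (Cconj (root N j))) (RtoC 1 * root N i)).

Lemma geo_circle_coef rho q : 0 < rho -> Cmod q = 1 -> geo (/ rho) 2 (circle_coef rho q).
Proof.
intros Hr Hq n. unfold circle_coef. rewrite !Cmod_mult, Cmod_opp, Cmod_pow, Cmod_mult, Hq, !Cmod_R.
rewrite (Rabs_pos_eq 2), (Rabs_pos_eq rho), Rmult_1_r, pow_inv by lra.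
assert (G := geo_logc n). rewrite pow1 in G. assert (0 < rho ^ n) by now apply pow_lt.
replace (2 * Cmod (logc n) * rho ^ n * / rho ^ n) with (2 * Cmod (logc n)) by (field; lra). lra.
Qed.

Lemma PS_scal rho M a k z : 0 < rho -> geo rho M a -> Cmod z < rho ->
  PS (fun n => k * a n)%C z = (k * PS a z)%C.
Proof.
intros Hr Ha Hz. symmetry. assert (T := ratio_lt1 z rho Hr Hz). set (t := Cmod z / rho) in *.
apply (PS_unique rho (Cmod k * M) _ _ _ (Cmod k * (2 * M / (1 - t)))); auto.
- intros n. rewrite Cmod_mult, Rmult_assoc. apply Rmult_le_compat_l; [apply Cmod_ge_0|apply Ha].
- intros n. fold t. replace (psum (fun n => k * a n)%C z n) with (k * psum a z n)%C.
  + replace (k * PS a z - k * psum a z n)%C with (k * (PS a z - psum a z n))%C by ring.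
    rewrite Cmod_mult, Rmult_assoc. apply Rmult_le_compat_l; [apply Cmod_ge_0|].
    eapply Rle_trans; [apply (PS_rem rho M); auto|]. fold t. right. unfold Rdiv. ring.
  + unfold psum. rewrite <- csum_scal. apply csum_ext. intros; ring.
Qed.

Lemma ckernel_log rho N i j : 0 < rho < 1 ->
  ckernel rho N i j = - ln (Cmod (1 - RtoC rho * Cconj (root N j) * root N i) ^ 2).
Proof.
intros Hr. unfold ckernel. rewrite Cmult_1_l. set (q := (RtoC rho * Cconj (root N j))%C).
assert (Hq : Cmod (q * root N i) = rho).
{ unfold q. rewrite !Cmod_mult, Cmod_conj, !Cmod_root, Cmod_R, Rabs_pos_eq; lra. }
assert (E : PS (circle_coef rho (Cconj (root N j))) (root N i) = (-(2) * PS logc (q * root N i))%C).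
{ rewrite <- (PS_scal 1 1 logc); [|lra|apply geo_logc|lra].
  rewrite PS_dilate. apply PS_ext. intros n. reflexivity. }
rewrite E. assert (L := log_one_minus (q * root N i)). rewrite Hq in L. specialize (L ltac:(lra)).
assert (P : 0 < Cmod (1 - q * root N i)).
{ pose proof (Cmod_le_sub 1 (q * root N i)). rewrite Cmod_1 in H. lra. }
simpl pow. rewrite Rmult_1_r, ln_mult, L by auto. simpl. ring.
Qed.

Lemma avg_modes_first Y K N : (S (S K) < N)%nat ->
  avg N (fun j => Cconj (root N j) * Cconj (weight Y K N j))%C = 1.
Proof.
intros HN. rewrite avg_mult_conj_weight by lia.
rewrite (avg_ext N _ (fun _ => RtoC 1)).
2:{ intros j _. rewrite Cmult_comm. apply root_conj. }
rewrite avg_const by lia. rewrite (csum_ext _ (fun _ => RtoC 0)), csum_0; [ring|].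
intros l Hl. rewrite (avg_ext N _ (fun j => Cconj (root N j ^ S (S l)))).
- rewrite <- avg_conj, avg_root_pow by lia. apply injective_projections; simpl; ring.
- intros j _. rewrite Cpow_conj, (Cpow_S _ (S l)). ring.
Qed.

Lemma avg_modes_other Y K N l : (S (S K) < N)%nat -> (l < K)%nat ->
  avg N (fun j => root N j ^ S l * Cconj (weight Y K N j))%C = Cconj (Y l).
Proof.
intros HN Hl. rewrite avg_mult_conj_weight by lia.
rewrite (avg_ext N _ (fun j => root N j ^ S (S l))%C) by (intros; rewrite (Cpow_S _ (S l)); ring).
rewrite avg_root_pow, Cplus_0_l by lia.
rewrite (csum_ext _ (fun m => Cconj (Y m) * (if Nat.eq_dec m l then 1 else 0))%C).
- now apply csum_delta.
- intros m Hm. rewrite avg_root_conj by lia. f_equal.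
  destruct (Nat.eq_dec (S l) (S m)), (Nat.eq_dec m l); auto; lia.
Qed.

(** The circle kernel acts on the frequencies [n] and [- n] as multiplication by [rho^n / n]; the
    mode [-1] of the weight has coefficient 1. *)
Definition circle_limit (Y : nat -> C) (K : nat) (rho : R) : R :=
  rho + rsum (fun l => rho ^ S l / INR (S l) * Cmod (Y l) ^ 2) K.

Lemma logc_S l : logc (S l) = RtoC (- / INR (S l)).
Proof.
unfold logc, icoef. assert (H : INR (S l) <> 0) by (apply not_0_INR; lia).
rewrite RtoC_opp, RtoC_inv by auto. field. intros E. apply RtoC_inj in E. auto.
Qed.

Lemma csum_RtoC (f : nat -> R) n : csum (fun k => RtoC (f k)) n = RtoC (rsum f n).
Proof. induction n as [|n IH]; cbn [csum rsum]; auto. rewrite IH, RtoC_plus. reflexivity. Qed.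

Lemma tends_havg_circle Y K rho : 0 < rho < 1 ->
  tends (fun N => havg (weight Y K N) (ckernel rho N) N) (RtoC (circle_limit Y K rho)).
Proof.
intros Hr. assert (Hi : 1 < / rho) by (rewrite <- Rinv_1; apply Rinv_lt_contravar; lra).
assert (Hg : forall N j, geo (/ rho) 2 (circle_coef rho (Cconj (root N j)))).
{ intros N j. apply geo_circle_coef; [lra|]. now rewrite Cmod_conj, Cmod_root. }
apply (tends_approx (fun N => avg N (fun j => row_limit Y K 1 (circle_coef rho (Cconj (root N j))) * Cconj (weight Y K N j))%C)).
{ intros eps Heps. pose proof (weight_bound_ge1 Y K) as HBx.
  destruct (row_weight Y K (/ rho) 2 1 ltac:(lra) ltac:(lra) (eps / weight_bound Y K)) as [N0 [P0 H]].
  { apply Rdiv_lt_0_compat; lra. }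
  exists N0. intros N HN.
  replace eps with (eps / weight_bound Y K * weight_bound Y K) by (field; lra).
  apply (havg_rows Y K N (ckernel rho N) (fun j => row_limit Y K 1 (circle_coef rho (Cconj (root N j))))); [lia|].
  intros j Hj. apply H; auto. }
apply (tends_ext_ev (fun _ => RtoC (circle_limit Y K rho)) _ _ (S (S (S K)))); [|apply tends_const].
intros N HN. symmetry.
rewrite (avg_ext N _ (fun j => RtoC rho * (Cconj (root N j) * Cconj (weight Y K N j))
   + csum (fun l => Y l * RtoC (rho ^ S l / INR (S l)) * (root N j ^ S l * Cconj (weight Y K N j))) K)%C).
- rewrite avg_plus, avg_scal, avg_modes_first by lia.
  rewrite (avg_csum N (fun l j => Y l * RtoC (rho ^ S l / INR (S l)) * (root N j ^ S l * Cconj (weight Y K N j)))%C) by lia.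
  unfold circle_limit. rewrite RtoC_plus, Cmult_1_r. f_equal. rewrite <- csum_RtoC.
  apply csum_ext. intros l Hl. rewrite avg_scal, avg_modes_other by lia.
  rewrite RtoC_mult, Cmod2_conj. ring.
- intros j _. unfold row_limit. rewrite <- Cmult_assoc, Cmult_plus_distr_r, Cmult_plus_distr_l. f_equal.
  + unfold circle_coef. rewrite logc_S. simpl Cpow. simpl INR. rewrite Rinv_1, RtoC_opp. field.
  + rewrite (Cmult_comm (csum _ K)), <- csum_scal, <- csum_scal. apply csum_ext. intros l _.
    unfold circle_coef. rewrite logc_S, !Cmult_conj, Copp_conj, Cpow_conj, Cmult_conj, Cconj_conj, !Cconj_RtoC.
    rewrite Cpow_mult_l, RtoC_opp. unfold Rdiv. rewrite RtoC_mult, <- !RtoC_pow, pow1. field.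
Qed.

(** This fixes the regulariser: divided by [rho], the right side is a squared distance plus
    [(1 - rho)^2 / rho]. *)
Lemma circle_identity u v rho : Cmod u = 1 -> Cmod v = 1 ->
  Cmod (1 - RtoC rho * Cconj v * u) ^ 2 = rho * Cmod (u - v) ^ 2 + (1 - rho) ^ 2.
Proof.
intros Hu Hv.
assert (U : Re u ^ 2 + Im u ^ 2 = 1) by (rewrite <- Cmod2_alt, Hu; ring).
assert (V : Re v ^ 2 + Im v ^ 2 = 1) by (rewrite <- Cmod2_alt, Hv; ring).
rewrite !Cmod2_alt. destruct u as [a b], v as [c d]. simpl in *.
transitivity (1 - 2 * rho * (a * c + b * d) + rho ^ 2 * ((a * (a * 1) + b * (b * 1)) * (c * (c * 1) + d * (d * 1)))).
- ring.
- rewrite U, V.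
  transitivity (rho * ((a * (a * 1) + b * (b * 1)) + (c * (c * 1) + d * (d * 1)) - 2 * (a * c + b * d)) + (1 - rho) ^ 2).
  + rewrite U, V. ring.
  + ring.
Qed.

(** The Poisson kernel times [(1 - rho) / (1 + rho)]. *)
Definition pole_kernel (rho : R) (N i j : nat) : R :=
  (1 - rho) ^ 2 / Cmod (1 - RtoC rho * Cconj (root N j) * root N i) ^ 2.

Lemma pole_dist rho N i j : 0 < rho < 1 -> 1 - rho <= Cmod (1 - RtoC rho * Cconj (root N j) * root N i).
Proof.
intros Hr. pose proof (Cmod_le_sub 1 (RtoC rho * Cconj (root N j) * root N i)) as H.
rewrite Cmod_1, !Cmod_mult, Cmod_conj, !Cmod_root, Cmod_R, Rabs_pos_eq in H by lra. lra.
Qed.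

Lemma pole_kernel_range rho N i j : 0 < rho < 1 -> 0 < pole_kernel rho N i j <= 1.
Proof.
intros Hr. pose proof (pole_dist rho N i j Hr) as P. unfold pole_kernel.
set (m := Cmod (1 - RtoC rho * Cconj (root N j) * root N i)) in *.
assert (0 < (1 - rho) ^ 2) by (apply pow_lt; lra). assert (0 < m ^ 2) by (apply pow_lt; lra).
split; [apply Rdiv_lt_0_compat; auto|].
apply Rmult_le_reg_r with (m ^ 2); auto. unfold Rdiv. rewrite Rmult_assoc, Rinv_l by lra.
rewrite Rmult_1_r, Rmult_1_l. apply pow_incr. lra.
Qed.

(* What remains of the regularised kernel after removing the circle kernel and [2 lquot]. *)
Definition defect (c : C -> nat -> C) (r rho : R) (N i j : nat) : R :=
  ln (1 + pole_kernel rho N i j * (exp (-2 * lquot c r N i j) - 1)).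

(** Here [w i] is [1 / f] at a node, so [|w i - w j|] is the distance of the roots of unity times
    [exp U / r]. Factoring [exp (2 U)] out of the regularised square leaves [exp (-2 U)] on the
    regulariser, and [defect] records this discrepancy. *)
Lemma kernel_split b c r rho N i j : univalent_coef b -> logder b c -> 0 < r < 1 -> 0 < rho < 1 ->
  let w := fun i => (PS b (RtoC r * root N i) / (RtoC r * root N i))%C in
  - ln (Cmod (w i - w j) ^ 2 + (1 - rho) ^ 2 / (rho * r ^ 2)) =
  ln (r ^ 2 * rho) + ckernel rho N i j + -2 * lquot c r N i j + -1 * defect c r rho N i j.
Proof.
intros Hu Hc Hr Hrho w. assert (Hu' := Hu). destruct Hu' as [Hb [Hb0 _]].
set (zi := (RtoC r * root N i)%C). set (zj := (RtoC r * root N j)%C).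
assert (Mi : Cmod zi = r) by (apply Cmod_scaled_root; lra).
assert (Mj : Cmod zj = r) by (apply Cmod_scaled_root; lra).
assert (Ni : zi <> 0) by (apply neq0_of_Cmod; lra). assert (Nj : zj <> 0) by (apply neq0_of_Cmod; lra).
set (U := lquot c r N i j).
assert (E : Cmod (quot b zj zi) = exp U) by (apply (quot_exp b c); auto; lra).
assert (W : (w i - w j)%C = ((zj - zi) * quot b zj zi / (zi * zj))%C).
{ rewrite quot_identity by (auto; lra). unfold w. fold zi zj. field. auto. }
assert (D : Cmod (zj - zi) = r * Cmod (root N i - root N j)).
{ unfold zi, zj. rewrite Cmod_sub_sym.
  replace (RtoC r * root N i - RtoC r * root N j)%C with (RtoC r * (root N i - root N j))%C by ring.
  rewrite Cmod_mult, Cmod_R, Rabs_pos_eq; lra. }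
assert (M : Cmod (w i - w j) = Cmod (root N i - root N j) * exp U / r).
{ rewrite W, Cmod_div, !Cmod_mult, D, E, Mi, Mj by now apply Cmult_neq_0. field. lra. }
rewrite M. rewrite ckernel_log by auto. unfold defect, pole_kernel. fold U.
assert (P := pole_dist rho N i j Hrho).
assert (CI := circle_identity (root N i) (root N j) rho (Cmod_root N i) (Cmod_root N j)).
set (X := Cmod (1 - RtoC rho * Cconj (root N j) * root N i) ^ 2) in *.
assert (HX : 0 < X) by (apply pow_lt; lra).
set (D2 := Cmod (root N i - root N j)) in *.
assert (HE := exp_pos U). assert (HE2 := exp_pos (-2 * U)).
assert (EE : exp (-2 * U) * exp U ^ 2 = 1).
{ simpl. rewrite Rmult_1_r, <- !exp_plus. replace (-2 * U + (U + U)) with 0 by ring. apply exp_0. }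
assert (H1 : 0 < (1 - rho) ^ 2) by (apply pow_lt; lra).
set (Y := 1 + (1 - rho) ^ 2 / X * (exp (-2 * U) - 1)).
assert (HY : X * Y = rho * D2 ^ 2 + (1 - rho) ^ 2 * exp (-2 * U)).
{ unfold Y. transitivity (X + (1 - rho) ^ 2 * (exp (-2 * U) - 1)); [field; lra|]. rewrite CI. ring. }
assert (PY : 0 < Y).
{ apply Rmult_lt_reg_l with X; auto. rewrite HY, Rmult_0_r.
  pose proof (pow2_ge_0 D2). nra. }
assert (K : (D2 * exp U / r) ^ 2 + (1 - rho) ^ 2 / (rho * r ^ 2) = / (r ^ 2 * rho) * (exp U ^ 2 * (X * Y))).
{ rewrite HY. transitivity (/ (r ^ 2 * rho) * (exp U ^ 2 * rho * D2 ^ 2 + (1 - rho) ^ 2 * (exp (-2 * U) * exp U ^ 2))).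
  - rewrite EE. field. lra.
  - ring. }
assert (R2 : 0 < r ^ 2 * rho) by (apply Rmult_lt_0_compat; [apply pow_lt|]; lra).
assert (E2 : 0 < exp U ^ 2) by (now apply pow_lt).
assert (XY : 0 < X * Y) by now apply Rmult_lt_0_compat.
rewrite K, ln_mult, ln_mult, ln_mult, ln_Rinv; auto.
- replace (ln (exp U ^ 2)) with (2 * U); [ring|].
  simpl. rewrite Rmult_1_r, ln_mult, !ln_exp by auto. ring.
- now apply Rinv_0_lt_compat.
- now apply Rmult_lt_0_compat.
Qed.

(** With [y] the argument of the logarithm, [|ln y|] is at most [|y - 1|] times the larger of [1]
    and [1 / y], and [y >= exp (- V)]. *)
Lemma ln_perturb t q V : 0 < t <= 1 -> exp (- V) <= q <= exp V -> 0 <= V ->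
  Rabs (ln (1 + t * (q - 1))) <= (exp V + 1) * exp V * t.
Proof.
intros Ht Hq HV. set (y := 1 + t * (q - 1)).
assert (E1 : 1 <= exp V) by (rewrite <- exp_0; destruct HV as [L|<-]; [left; now apply exp_increasing|lra]).
assert (E0 := exp_pos (- V)). assert (EE : exp (- V) * exp V = 1) by (rewrite <- exp_plus; replace (- V + V) with 0 by ring; apply exp_0).
assert (E2 : exp (- V) <= 1) by nra.
assert (Hy : exp (- V) <= y) by (unfold y; nra).
assert (D : Rabs (y - 1) <= (exp V + 1) * t).
{ unfold y. replace (1 + t * (q - 1) - 1) with (t * (q - 1)) by ring.
  rewrite Rabs_mult, Rabs_pos_eq, Rmult_comm by lra. apply Rmult_le_compat_r; [lra|].
  apply Rabs_le. lra. }
assert (D0 := Rabs_pos (y - 1)).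
assert (Hln : forall x, 0 < x -> ln x <= x - 1).
{ intros x Hx. pose proof (exp_ineq1_le (ln x)). rewrite exp_ln in H by auto. lra. }
assert (P1 : ln y <= Rabs (y - 1)) by (eapply Rle_trans; [apply Hln; lra|apply Rle_abs]).
assert (P2 : - ln y <= Rabs (y - 1) * exp V).
{ rewrite <- ln_Rinv by lra. eapply Rle_trans; [apply Hln; apply Rinv_0_lt_compat; lra|].
  replace (/ y - 1) with ((1 - y) * / y) by (field; lra).
  assert (I : 0 < / y <= exp V).
  { split; [apply Rinv_0_lt_compat; lra|].
    apply Rmult_le_reg_r with y; [lra|]. rewrite Rinv_l by lra. nra. }
  assert (1 - y <= Rabs (y - 1)) by (rewrite Rabs_minus_sym; apply Rle_abs). nra. }
assert (P3 : Rabs (ln y) <= Rabs (y - 1) * exp V) by (apply Rabs_le; split; nra).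
eapply Rle_trans; [exact P3|]. nra.
Qed.

Lemma defect_bound b c r : univalent_coef b -> logder b c -> 0 < r < 1 -> exists A, 0 <= A /\
  forall rho N i j, 0 < rho < 1 -> (i < N)%nat -> (j < N)%nat ->
    Rabs (defect c r rho N i j) <= A * pole_kernel rho N i j.
Proof.
intros Hu Hc Hr. set (rho0 := (r + 1) / 2).
assert (Hrho : r < rho0 < 1) by (unfold rho0; lra).
destruct (geo_logder_unif b c r rho0 Hu Hc Hr) as [B [HB HG]]; [lra|].
assert (T := div_lt1 r rho0 ltac:(lra)).
set (V := 2 * (B * rho0) / (1 - r / rho0)).
assert (HV : 0 <= V) by (apply Rdiv_le_0_compat; [|lra]; apply Rmult_le_pos; [lra|apply Rmult_le_pos; lra]).
exists ((exp (2 * V) + 1) * exp (2 * V)). assert (P := exp_pos (2 * V)).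
split; [apply Rmult_le_pos; lra|].
intros rho N i j Hrh Hi Hj. unfold defect. apply ln_perturb; [now apply pole_kernel_range| |lra].
assert (UB : Rabs (lquot c r N i j) <= V).
{ unfold lquot. eapply Rle_trans; [apply re_le_Cmod|].
  assert (Mi : Cmod (RtoC r * root N i) = r) by (apply Cmod_scaled_root; lra).
  eapply Rle_trans; [apply (PS_bound rho0 (B * rho0)); [lra| |lra]|rewrite Mi; unfold V; lra].
  apply geo_icoef; [lra|]. now apply HG. }
apply Rabs_le_between in UB.
assert (M : forall x y, x <= y -> exp x <= exp y).
{ intros x y [L| ->]; [left; now apply exp_increasing|lra]. }
split; apply M; lra.
Qed.

Definition pole_coef (rho : R) (q : C) (n : nat) : C := (-(1) * (RtoC rho * q) ^ n)%C.

(** The Poisson kernel is [2 Re (1 / (1 - q)) - 1], and the series with all coefficients [-1] is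
    [- 1 / (1 - q)]. *)
Lemma pole_kernel_PS rho N i j : 0 < rho < 1 ->
  pole_kernel rho N i j = (1 - rho) / (1 + rho) *
    (-1 + -2 * Re (PS (pole_coef rho (Cconj (root N j))) (RtoC 1 * root N i))).
Proof.
intros Hr. rewrite Cmult_1_l. unfold pole_kernel. set (q := (RtoC rho * Cconj (root N j) * root N i)%C).
assert (Hq : Cmod q = rho).
{ unfold q. rewrite !Cmod_mult, Cmod_conj, !Cmod_root, Cmod_R, Rabs_pos_eq; lra. }
assert (E : PS (pole_coef rho (Cconj (root N j))) (root N i) = PS (fun _ => (-(1))%C) q).
{ unfold q. rewrite PS_dilate. reflexivity. }
assert (P := pole_dist rho N i j Hr). fold q in P. rewrite E.
assert (G := PS_m1 q ltac:(lra)). set (p := PS _ q) in *.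
assert (Hn : (1 - q)%C <> 0) by (apply neq0_of_Cmod; lra).
assert (Q2 : Re q ^ 2 + Im q ^ 2 = rho ^ 2) by (rewrite <- Cmod2_alt, Hq; ring).
assert (X2 : Cmod (1 - q) ^ 2 = (1 - Re q) ^ 2 + Im q ^ 2).
{ rewrite Cmod2_alt, Re_minus, Im_minus. simpl. ring. }
assert (X0 : 0 < Cmod (1 - q) ^ 2) by (apply pow_lt; lra).
assert (R1 : Re p * Cmod (1 - q) ^ 2 = - (1 - Re q)).
{ assert (G1 : (p * RtoC (Cmod (1 - q) ^ 2))%C = (-(1) * Cconj (1 - q))%C).
  { rewrite Cmod2_conj, Cmult_assoc, G. reflexivity. }
  apply (f_equal Re) in G1. destruct p as [p1 p2], q as [q1 q2]. simpl in *. lra. }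
apply Rmult_eq_reg_r with (Cmod (1 - q) ^ 2); [|lra].
transitivity ((1 - rho) ^ 2); [field; lra|].
transitivity ((1 - rho) / (1 + rho) * (- Cmod (1 - q) ^ 2 - 2 * (Re p * Cmod (1 - q) ^ 2))); [|ring].
rewrite R1, X2.
transitivity ((1 - rho) / (1 + rho) * (1 - (Re q ^ 2 + Im q ^ 2))).
- rewrite Q2. field. lra.
- ring.
Qed.

Lemma avg_le_real N (f : nat -> C) (g : nat -> R) : (0 < N)%nat ->
  (forall j, (j < N)%nat -> Cmod (f j) <= g j) -> Cmod (avg N f) <= Re (avg N (fun j => RtoC (g j))).
Proof.
intros HN H. rewrite rsum_Re_INR by auto. unfold avg.
rewrite Cmod_div by now apply RtoC_INR_neq0.
assert (P := lt_0_INR N HN). rewrite Cmod_R, (Rabs_pos_eq (INR N)) by lra.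
apply Rmult_le_compat_r; [left; now apply Rinv_0_lt_compat|].
eapply Rle_trans; [apply Cmod_csum_le|]. now apply rsum_le.
Qed.

(** The Poisson kernel has mean 1. Thus the defect is small on average as [rho] tends to 1, although
    it is not small near the diagonal. *)
Lemma pole_kernel_avg rho eps : 0 < rho < 1 -> 0 < eps -> exists N0, (0 < N0)%nat /\
  forall N, (N0 <= N)%nat -> forall j,
    Re (avg N (fun i => RtoC (pole_kernel rho N i j))) <= (1 - rho) / (1 + rho) + eps.
Proof.
intros Hr Heps. assert (Hi : 1 < / rho) by (rewrite <- Rinv_1; apply Rinv_lt_contravar; lra).
destruct (row_zero (/ rho) 1 1 (eps / 2)) as [N0 [P0 H]]; try lra.
exists N0. split; auto. intros N HN j.
assert (G : geo (/ rho) 1 (pole_coef rho (Cconj (root N j)))).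
{ intros n. unfold pole_coef. rewrite !Cmod_mult, Cmod_m1, Cmod_pow, Cmod_mult, Cmod_conj, Cmod_root, Cmod_R.
  rewrite (Rabs_pos_eq rho), Rmult_1_r, pow_inv by lra.
  assert (0 < rho ^ n) by (apply pow_lt; lra). right. field. lra. }
specialize (H N HN _ G). set (f := fun i => RtoC (Re (PS (pole_coef rho (Cconj (root N j))) (RtoC 1 * root N i)))) in H.
set (k := (1 - rho) / (1 + rho)).
assert (Hk : 0 < k <= 1).
{ unfold k. split; [apply Rdiv_lt_0_compat; lra|].
  apply Rmult_le_reg_r with (1 + rho); [lra|]. unfold Rdiv. rewrite Rmult_assoc, Rinv_l; lra. }
rewrite (avg_ext N _ (fun i => RtoC k * (RtoC (-1) + RtoC (-2) * f i))%C).
2:{ intros i _. rewrite pole_kernel_PS by auto. fold k. unfold f.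
    now rewrite RtoC_mult, RtoC_plus, RtoC_mult. }
rewrite avg_scal, avg_plus, avg_const, avg_scal by lia.
replace (RtoC (Re (pole_coef rho (Cconj (root N j)) 0))) with (RtoC (-1)) in H.
2:{ f_equal. unfold pole_coef. simpl. ring. }
pose proof (re_le_Cmod (avg N f - RtoC (-1))) as B. rewrite Re_minus in B.
set (a := Re (avg N f)) in *. simpl (Re (RtoC (-1))) in B.
assert (B' : Rabs (a - -1) <= eps / 2) by lra. apply Rabs_le_between in B'.
replace (Re (RtoC k * (RtoC (-1) + RtoC (-2) * avg N f))) with (k * (-1 + -2 * a)) by (unfold a; simpl; ring).
nra.
Qed.

Definition area_sum (b : nat -> C) (r : R) (K : nat) : R :=
  rsum (fun l => INR (S l) * (Cmod (b (S (S l))) * r ^ S (S l)) ^ 2) K.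

(** The maximiser of [2 Re (cross_limit)] minus the sum of [|Y_l|^2 / (l + 1)], which is the
    quadratic part of [circle_limit] at [rho = 1]. *)
Definition extremal_weight (b : nat -> C) (r : R) (l : nat) : C :=
  (RtoC (INR (S l) * r ^ S (S l)) * first_coef b (S l))%C.

Lemma cross_limit_extremal b r K : cross_limit (extremal_weight b r) K b r = RtoC (area_sum b r K).
Proof.
unfold cross_limit, area_sum. rewrite <- csum_RtoC, <- csum_scal. apply csum_ext. intros l _.
unfold extremal_weight, first_coef. rewrite Cmult_conj, Cconj_RtoC, Copp_conj.
rewrite Rpow_mult_distr, !RtoC_mult, Cmod2_conj, !RtoC_pow, <- Cpow_mult_r.
replace (S (S l) * 2)%nat with (S (S l) + (1 + S l))%nat by lia.
rewrite !Cpow_add_r. ring.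
Qed.

Lemma circle_limit_extremal b r K rho : 0 < rho < 1 -> circle_limit (extremal_weight b r) K rho <= 1 + area_sum b r K.
Proof.
intros Hr. unfold circle_limit, area_sum. apply Rplus_le_compat; [lra|]. apply rsum_le. intros l _.
unfold extremal_weight, first_coef. rewrite Cmod_mult, Cmod_opp, Cmod_R, Rabs_mult.
set (n := INR (S l)). assert (Hn : 0 < n) by (apply lt_0_INR; lia). rewrite (Rabs_pos_eq n) by lra.
set (m := Cmod (b (S (S l)))).
replace ((n * Rabs (r ^ S (S l)) * m) ^ 2) with (n ^ 2 * (m * r ^ S (S l)) ^ 2).
2:{ rewrite !Rpow_mult_distr, pow2_abs. ring. }
replace (rho ^ S l / n * (n ^ 2 * (m * r ^ S (S l)) ^ 2)) with (rho ^ S l * (n * (m * r ^ S (S l)) ^ 2)) by (field; lra).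
rewrite <- (Rmult_1_l (n * _)) at 2. apply Rmult_le_compat_r.
- apply Rmult_le_pos; [lra|apply pow2_ge_0].
- rewrite <- (pow1 (S l)). apply pow_incr. lra.
Qed.

(** Positivity of the kernel reads [0 <= circle - 2 * cross - defect]. At the extremal weight the
    first term is at most [1 + S], the cross term is [S], and the defect is of order [1 - rho]. *)
Theorem area_theorem b r K : univalent_coef b -> 0 < r < 1 -> area_sum b r K <= 1.
Proof.
intros Hu Hr. destruct (exists_logder b Hu) as [c Hc].
destruct (defect_bound b c r Hu Hc Hr) as [A [HA HD]].
set (Y := extremal_weight b r). set (S := area_sum b r K).
pose proof (weight_bound_ge1 Y K) as HB.
assert (Main : forall rho, 0 < rho < 1 -> S <= 1 + A * (weight_bound Y K * weight_bound Y K) * (1 - rho)).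
{ intros rho Hrho. apply le_epsilon. intros e He.
  (* Error budget: [e / 6] for the circle kernel, twice [e / 6] for [lquot], which enters with
     factor 2, and [e / 2] for the average of the pole kernel. *)
  destruct (small_factor (A * (weight_bound Y K * weight_bound Y K)) (e / 2)) as [e1 [He1 Hee1]]; [|lra|].
  { apply Rmult_le_pos; auto. nra. }
  destruct (tends_havg_circle Y K rho Hrho (e / 6)) as [N1 H1]; [lra|].
  destruct (tends_havg_lquot Y K b c r Hu Hc Hr (e / 6)) as [N2 H2]; [lra|].
  destruct (pole_kernel_avg rho e1 Hrho He1) as [N3 [P3 H3]].
  set (N := (N1 + N2 + N3 + K + 2)%nat). assert (HN : (0 < N)%nat) by (unfold N; lia).
  specialize (H1 N ltac:(unfold N; lia)). specialize (H2 N ltac:(unfold N; lia)).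
  specialize (H3 N ltac:(unfold N; lia)).
  assert (CE : Re (cross_limit Y K b r) = S) by (unfold Y; now rewrite cross_limit_extremal).
  rewrite CE in H2.
  assert (X0 : csum (weight Y K N) N = 0) by (apply csum_weight; unfold N; lia).
  assert (Pos := log_kernel_complex (fun i => (PS b (RtoC r * root N i) / (RtoC r * root N i))%C)
    (weight Y K N) ((1 - rho) ^ 2 / (rho * r ^ 2)) N HN).
  specialize (Pos ltac:(apply Rdiv_lt_0_compat; [apply pow_lt; lra|apply Rmult_lt_0_compat; [lra|apply pow_lt; lra]]) X0).
  rewrite (havg_ext _ _ (fun i j => ln (r ^ 2 * rho) + ckernel rho N i j + -2 * lquot c r N i j + -1 * defect c r rho N i j)) in Pos.
  2:{ intros i j _ _. now apply (kernel_split b c r rho N i j). }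
  rewrite !havg_plus, !havg_scal, havg_const in Pos by auto.
  assert (HDD : Cmod (havg (weight Y K N) (defect c r rho N) N) <= A * (weight_bound Y K * weight_bound Y K) * ((1 - rho) / (1 + rho) + e1)).
  { unfold havg. apply avg_bound; auto. intros j Hj. rewrite Cmod_mult, Cmod_conj.
    assert (Q : Cmod (avg N (fun i => RtoC (defect c r rho N i j) * weight Y K N i)%C) <= A * weight_bound Y K * ((1 - rho) / (1 + rho) + e1)).
    { eapply Rle_trans; [apply (avg_le_real N _ (fun i => A * weight_bound Y K * pole_kernel rho N i j)); auto|].
      - intros i Hi. rewrite Cmod_mult, Cmod_R.
        replace (A * weight_bound Y K * pole_kernel rho N i j) with (A * pole_kernel rho N i j * weight_bound Y K) by ring.
        apply Rmult_le_compat; [apply Rabs_pos|apply Cmod_ge_0|now apply HD|apply Cmod_weight].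
      - rewrite (avg_ext N _ (fun i => RtoC (A * weight_bound Y K) * RtoC (pole_kernel rho N i j))%C) by (intros; apply RtoC_mult).
        rewrite avg_scal by auto.
        replace (Re (RtoC (A * weight_bound Y K) * avg N (fun i => RtoC (pole_kernel rho N i j))))
          with (A * weight_bound Y K * Re (avg N (fun i => RtoC (pole_kernel rho N i j)))) by (simpl; ring).
        apply Rmult_le_compat_l; [apply Rmult_le_pos; lra|apply H3]. }
    replace (A * (weight_bound Y K * weight_bound Y K) * ((1 - rho) / (1 + rho) + e1)) with
      (A * weight_bound Y K * ((1 - rho) / (1 + rho) + e1) * weight_bound Y K) by ring.
    apply Rmult_le_compat; auto; try apply Cmod_ge_0. apply Cmod_weight. }
  pose proof (re_le_Cmod (havg (weight Y K N) (ckernel rho N) N - RtoC (circle_limit Y K rho))) as R1.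
  pose proof (re_le_Cmod (havg (weight Y K N) (lquot c r N) N - RtoC S)) as R2.
  pose proof (re_le_Cmod (havg (weight Y K N) (defect c r rho N) N)) as R3.
  rewrite Re_minus in R1, R2.
  set (a1 := havg (weight Y K N) (ckernel rho N) N) in *.
  set (a2 := havg (weight Y K N) (lquot c r N) N) in *.
  set (a3 := havg (weight Y K N) (defect c r rho N) N) in *.
  replace (Re (0 + a1 + RtoC (-2) * a2 + RtoC (-1) * a3)) with (Re a1 - 2 * Re a2 - Re a3) in Pos by (simpl; ring).
  pose proof (circle_limit_extremal b r K rho Hrho) as DS. fold Y S in DS.
  simpl (Re (RtoC _)) in R1, R2.
  assert (R1' : Rabs (Re a1 - circle_limit Y K rho) <= e / 6) by (eapply Rle_trans; [exact R1|exact H1]).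
  assert (R2' : Rabs (Re a2 - S) <= e / 6).
  { eapply Rle_trans; [exact R2|exact H2]. }
  apply Rabs_le_between in R1', R2'. assert (R3' := Rle_trans _ _ _ R3 HDD). apply Rabs_le_between in R3'.
  assert (Kk : (1 - rho) / (1 + rho) <= 1 - rho).
  { unfold Rdiv. rewrite <- (Rmult_1_r (1 - rho)) at 2. apply Rmult_le_compat_l; [lra|].
    rewrite <- Rinv_1. apply Rinv_le_contravar; lra. }
  assert (0 <= A * (weight_bound Y K * weight_bound Y K)) by (apply Rmult_le_pos; auto; nra).
  nra. }
apply le_epsilon. intros e He.
destruct (small_factor (A * (weight_bound Y K * weight_bound Y K)) e) as [d [Hd Hde]]; auto.
{ apply Rmult_le_pos; auto. nra. }
set (d' := Rmin d (/ 2)).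
assert (Hd' : 0 < d' <= / 2) by (unfold d'; split; [apply Rmin_pos; lra|apply Rmin_r]).
assert (Hdd : d' <= d) by apply Rmin_l.
specialize (Main (1 - d') ltac:(lra)).
assert (0 <= A * (weight_bound Y K * weight_bound Y K)) by (apply Rmult_le_pos; auto; nra).
nra.
Qed.

Lemma bernoulli d n : 0 <= d <= 1 -> 1 - INR n * d <= (1 - d) ^ n.
Proof.
intros Hd. induction n as [|n IH]; [simpl; lra|].
rewrite S_INR. simpl pow. pose proof (pos_INR n).
assert ((1 - d) * (1 - INR n * d) <= (1 - d) * (1 - d) ^ n) by (apply Rmult_le_compat_l; lra).
nra.
Qed.

(** The sum is finite, so [r] can tend to 1; Bernoulli's inequality makes the loss linear in
    [1 - r]. *)
Lemma area_theorem_closed b K : univalent_coef b ->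
  rsum (fun l => INR (S l) * Cmod (b (S (S l))) ^ 2) K <= 1.
Proof.
intros Hu. set (a := fun l => INR (S l) * Cmod (b (S (S l))) ^ 2).
assert (Ha : forall l, 0 <= a l) by (intros l; apply Rmult_le_pos; [apply pos_INR|apply pow2_ge_0]).
set (L := rsum (fun l => a l * INR (S (S l) * 2)) K).
assert (HL : 0 <= L).
{ unfold L. rewrite <- (rsum_0 K). apply rsum_le. intros. apply Rmult_le_pos; auto. apply pos_INR. }
apply le_epsilon. intros e He.
destruct (small_factor L e HL He) as [d [Hd Hde]].
set (d' := Rmin d (/ 2)).
assert (Hd' : 0 < d' <= / 2) by (unfold d'; split; [apply Rmin_pos; lra|apply Rmin_r]).
assert (Hdd : d' <= d) by apply Rmin_l.
assert (A := area_theorem b (1 - d') K Hu ltac:(lra)).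
assert (B : rsum a K + - d' * L <= area_sum b (1 - d') K).
{ unfold L, area_sum. rewrite <- rsum_scal, <- rsum_plus. apply rsum_le. intros l _.
  rewrite Rpow_mult_distr, <- pow_mult.
  replace (INR (S l) * (Cmod (b (S (S l))) ^ 2 * (1 - d') ^ (S (S l) * 2)))
    with (a l * (1 - d') ^ (S (S l) * 2)) by (unfold a; ring).
  pose proof (bernoulli d' (S (S l) * 2) ltac:(lra)). specialize (Ha l).
  replace (a l + - d' * (a l * INR (S (S l) * 2))) with (a l * (1 - INR (S (S l) * 2) * d')) by ring.
  now apply Rmult_le_compat_l. }
nra.
Qed.

(** * The bound on the second-order expression *)

(** The sum of [(m + k)^3 y^k] over [k >= 0], written with the forward differences of the cube: the
    difference of order [j] comes with [y^j / (1 - y)^(j+1)]. *)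
Definition cube_tail (y : R) (m : R) : R :=
  m ^ 3 / (1 - y) + y * (3 * m ^ 2 + 3 * m + 1) / (1 - y) ^ 2
  + y ^ 2 * (6 * m + 6) / (1 - y) ^ 3 + 6 * y ^ 3 / (1 - y) ^ 4.

Lemma cube_sum y T : 0 < y < 1 ->
  rsum (fun l => INR (S l) ^ 3 * y ^ S (S l)) T + y ^ S (S T) * cube_tail y (INR (S T))
  = y ^ 2 * (1 + 4 * y + y ^ 2) / (1 - y) ^ 4.
Proof.
intros Hy. induction T as [|T IH].
- unfold cube_tail. simpl. field. lra.
- rewrite <- IH. cbn [rsum]. rewrite (S_INR (S T)). set (m := INR (S T)).
  rewrite Rplus_assoc. f_equal. rewrite <- (tech_pow_Rmult y (S (S T))).
  unfold cube_tail. field. lra.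
Qed.

Lemma cube_sum_le y T : 0 < y < 1 ->
  rsum (fun l => INR (S l) ^ 3 * y ^ S (S l)) T <= y ^ 2 * (1 + 4 * y + y ^ 2) / (1 - y) ^ 4.
Proof.
intros Hy. rewrite <- (cube_sum y T Hy). pose proof (pos_INR (S T)). set (m := INR (S T)) in *.
assert (0 <= y ^ S (S T) * cube_tail y m); [|lra].
apply Rmult_le_pos; [apply pow_le; lra|]. unfold cube_tail.
pose proof (pow2_ge_0 m). assert (0 <= m ^ 3) by (now apply pow_le).
assert (0 < y ^ 2) by (apply pow_lt; lra). assert (0 < y ^ 3) by (apply pow_lt; lra).
repeat apply Rplus_le_le_0_compat; apply Rdiv_le_0_compat; try (apply pow_lt; lra); try lra.
- apply Rmult_le_pos; lra.
- apply Rmult_le_pos; lra.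
Qed.

(* Weighted AM-GM with the weight [lam] replaces the Cauchy-Schwarz inequality. *)
Lemma weighted_sum_bound b lam r u T : univalent_coef b -> 0 < lam -> 0 < r < 1 -> Cmod u <= r ->
  r ^ 4 * (r ^ 4 + 4 * r ^ 2 + 1) <= lam ^ 2 * (1 - r ^ 2) ^ 4 ->
  Cmod (csum (fun l => RtoC (INR (S l) ^ 2) * b (S (S l)) * u ^ S (S l))%C T) <= lam.
Proof.
intros Hu Hlam Hr Hur Hroot.
assert (Hy : 0 < r ^ 2 < 1) by (simpl; nra).
assert (C := cube_sum_le (r ^ 2) T Hy). assert (Ar := area_theorem_closed b T Hu).
assert (F : (r ^ 2) ^ 2 * (1 + 4 * r ^ 2 + (r ^ 2) ^ 2) / (1 - r ^ 2) ^ 4 <= lam ^ 2).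
{ assert (P : 0 < (1 - r ^ 2) ^ 4) by (apply pow_lt; lra).
  apply Rmult_le_reg_r with ((1 - r ^ 2) ^ 4); auto.
  unfold Rdiv. rewrite Rmult_assoc, Rinv_l, Rmult_1_r by lra.
  eapply Rle_trans; [|exact Hroot]. right. ring. }
eapply Rle_trans; [apply Cmod_csum_le|].
apply Rle_trans with (rsum (fun l => lam / 2 * (INR (S l) * Cmod (b (S (S l))) ^ 2)
   + / (2 * lam) * (INR (S l) ^ 3 * (r ^ 2) ^ S (S l))) T).
- apply rsum_le. intros l _. rewrite !Cmod_mult, Cmod_R, Cmod_pow, Rabs_pos_eq by apply pow2_ge_0.
  set (n := INR (S l)). set (m := Cmod (b (S (S l)))).
  assert (Hn : 0 <= n) by apply pos_INR. assert (Hm : 0 <= m) by apply Cmod_ge_0.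
  assert (Hp : Cmod u ^ S (S l) <= r ^ S (S l)) by (apply pow_incr; split; auto; apply Cmod_ge_0).
  rewrite <- pow_mult, Nat.mul_comm, pow_mult. set (p := r ^ S (S l)) in *.
  apply Rle_trans with (n ^ 2 * m * p).
  + apply Rmult_le_compat_l; auto. apply Rmult_le_pos; auto. apply pow2_ge_0.
  + assert (Q : 0 <= n / (2 * lam) * (lam * m - n * p) ^ 2).
    { apply Rmult_le_pos; [apply Rdiv_le_0_compat; lra|apply pow2_ge_0]. }
    replace (n / (2 * lam) * (lam * m - n * p) ^ 2) with
     (lam / 2 * (n * m ^ 2) + / (2 * lam) * (n ^ 3 * p ^ 2) - n ^ 2 * m * p) in Q by (field; lra). lra.
- rewrite rsum_plus, !rsum_scal.
  apply Rle_trans with (lam / 2 * 1 + / (2 * lam) * lam ^ 2).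
  + apply Rplus_le_compat; apply Rmult_le_compat_l; try lra. left. apply Rinv_0_lt_compat. lra.
  + right. field. lra.
Qed.

(** The coefficient of [b n * u ^ n] is [n (n - 1) + 1 - n = (n - 1)^2], the constant 1 cancels
    [b 0], and [n = 1] drops out. The three truncation orders are matched so that the polynomials
    agree exactly. *)
Lemma psum_second_order (b : nat -> C) (u : C) T : b O = 1 ->
  (u ^ 2 * psum (dcoef (dcoef b)) u T + psum b u (S (S T)) - u * psum (dcoef b) u (S T) - 1)%C
  = csum (fun l => RtoC (INR (S l) ^ 2) * b (S (S l)) * u ^ S (S l))%C T.
Proof.
intros Hb0. induction T as [|T IH].
- unfold psum, dcoef. simpl. rewrite Hb0. ring.
- cbn [csum]. rewrite <- IH. unfold psum. cbn [csum]. unfold dcoef.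
  rewrite !(S_INR (S T)), !RtoC_plus, RtoC_pow, !Cpow_S. ring.
Qed.

Lemma second_order_bound b lam r u : univalent_coef b -> 0 < lam -> 0 < r < 1 -> Cmod u <= r ->
  r ^ 4 * (r ^ 4 + 4 * r ^ 2 + 1) <= lam ^ 2 * (1 - r ^ 2) ^ 4 ->
  Cmod (u ^ 2 * PS (dcoef (dcoef b)) u + (PS b u - u * PS (dcoef b) u) - 1) <= lam.
Proof.
intros Hu Hlam Hr Hur Hroot. assert (Hu' := Hu). destruct Hu' as [Hb [Hb0 _]].
set (rho := (r + 1) / 2). assert (Hrho : Cmod u < rho /\ 0 < rho < 1) by (unfold rho; lra).
destruct (Hb rho) as [M0 H0]; [lra|].
destruct (geo_disk_dcoef b Hb rho) as [M1 H1]; [lra|].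
destruct (geo_disk_dcoef _ (geo_disk_dcoef b Hb) rho) as [M2 H2]; [lra|].
set (t := Cmod u / rho). assert (Ht : 0 <= t < 1) by (apply ratio_lt1; lra).
assert (W : 0 < / (1 - t)) by (apply Rinv_0_lt_compat; lra).
assert (G : 0 <= 2 * M0 / (1 - t)).
{ pose proof (geo_pos _ _ _ H0). apply Rdiv_le_0_compat; lra. }
apply (Cmod_limit_le _ (fun T => u ^ 2 * psum (dcoef (dcoef b)) u T + psum b u (S (S T)) - u * psum (dcoef b) u (S T) - 1)%C
  lam (Cmod (u ^ 2) * (2 * M2 / (1 - t)) + 2 * M0 / (1 - t) + Cmod u * (2 * M1 / (1 - t))) t); auto.
- intros T.
  match goal with |- Cmod ?x <= _ => replace x with
    (u ^ 2 * (PS (dcoef (dcoef b)) u - psum (dcoef (dcoef b)) u T)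
     + (PS b u - psum b u (S (S T))) - u * (PS (dcoef b) u - psum (dcoef b) u (S T)))%C by ring end.
  eapply Rle_trans; [apply Cmod_sub_le|]. eapply Rle_trans; [apply Rplus_le_compat_r, Cmod_triangle|].
  rewrite (Cmod_mult (u ^ 2)), (Cmod_mult u), !Rmult_plus_distr_r, !(Rmult_assoc (Cmod _)).
  repeat apply Rplus_le_compat; try (apply Rmult_le_compat_l; [apply Cmod_ge_0|]).
  + eapply Rle_trans; [apply (PS_rem rho M2); auto; lra|]. fold t. right. unfold Rdiv. ring.
  + eapply Rle_trans; [apply (PS_rem_S rho M0); auto; lra|]. fold t.
    apply Rmult_le_compat_l; auto. simpl. assert (0 <= t ^ T) by (apply pow_le; lra). nra.
  + apply PS_rem_S; auto; lra.
- intros T. cbv beta. rewrite (psum_second_order b u T Hb0). now apply weighted_sum_bound with r.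
Qed.

(** * From the class S to coefficient sequences, and the root of the equation *)

Lemma class_S_deriv f z : class_S f -> Cmod z < 1 -> cder f z (C_derive f z).
Proof.
intros [[Ha _] _] Hz. apply is_derive_C_iff, C_derive_correct; [exact z|now apply Ha].
Qed.

Lemma class_S_neq0 f z : class_S f -> Cmod z < 1 -> z <> 0 -> f z <> 0.
Proof.
intros [[_ [H0 _]] Hi] Hz Hn E. apply Hn, Hi.
- exact Hz.
- unfold in_disk. rewrite Cmod_0. lra.
- now rewrite H0.
Qed.

Lemma z_over_0 f : z_over f 0 = 1.
Proof. unfold z_over. destruct (Ceq_dec 0 0); [reflexivity|congruence]. Qed.

Lemma z_over_neq0 f (z : C) : z <> 0 -> z_over f z = (z / f z)%C.
Proof. intros H. unfold z_over. destruct (Ceq_dec z 0); [congruence|reflexivity]. Qed.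

(** Caratheodory's factor at [0] writes [f z = z * phi z] with [phi] continuous and zero-free in the
    disk, so [/ phi] fills the singularity of [z / f]. *)
Lemma z_over_series f : class_S f -> exists b, geo_disk b /\ forall z, Cmod z < 1 -> z_over f z = PS b z.
Proof.
intros Hf. assert (Hf' := Hf). destruct Hf' as [[Ha [H0 H1]] Hi].
assert (D0 := class_S_deriv f 0 Hf). rewrite Cmod_0 in D0. specialize (D0 Rlt_0_1).
apply cder_iff in D0. destruct D0 as [phi [P1 [P2 P3]]].
assert (Q : forall z, Cmod z < 1 -> z <> 0 -> f z = (z * phi z)%C).
{ intros z Hz Hn. specialize (P3 z). rewrite H0 in P3.
  replace (f z) with (f z - 0)%C by ring. rewrite P3. ring. }
assert (Pn : forall z, Cmod z < 1 -> phi z <> 0).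
{ intros z Hz E. destruct (Ceq_dec z 0) as [->|n].
  - rewrite E, H1 in P2. apply RtoC_inj in P2. lra.
  - apply (class_S_neq0 f z Hf Hz n). rewrite Q, E by auto. ring. }
assert (G : forall z, Cmod z < 1 -> (/ phi z)%C = z_over f z).
{ intros z Hz. destruct (Ceq_dec z 0) as [->|n].
  - rewrite z_over_0, P2, H1, <- RtoC_inv, Rinv_1 by lra. reflexivity.
  - rewrite z_over_neq0, Q by auto. field. auto. }
assert (Dphi : forall z, 0 < Cmod z < 1 -> exists l, cder phi z l).
{ intros z Hz. apply (diff_quotient_cder f phi 0 z (C_derive f z)); auto.
  - apply neq0_of_Cmod. lra.
  - apply class_S_deriv; auto. lra. }
destruct (holomorphic_power_series (fun z => / phi z)%C 1) as [b [B1 [B2 _]]]; [lra| | |].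
- intros z Hz. apply ccont_inv; [|now apply Pn].
  destruct (Ceq_dec z 0) as [->|n]; auto.
  destruct (Dphi z) as [l Hl]; [split; [now apply Cmod_gt_0|auto]|]. eapply cder_ccont; eauto.
- intros z Hz. destruct (Dphi z Hz) as [l Hl]. eexists. apply cder_inv; [exact Hl|]. apply Pn. lra.
- exists b. split; [exact B2|]. intros z Hz. rewrite <- G, <- B1; auto.
Qed.

(** Differentiate [f * (z / f) = z] and multiply by [z / f]. *)
Lemma z_over_deriv_identity f b z : class_S f -> geo_disk b ->
  (forall z, Cmod z < 1 -> z_over f z = PS b z) -> Cmod z < 1 ->
  (C_derive f z * z_over f z ^ 2)%C = (PS b z - z * PS (dcoef b) z)%C.
Proof.
intros Hf Hb Hg Hz. assert (Hf' := Hf). destruct Hf' as [[Ha [H0 H1]] Hi].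
destruct (Ceq_dec z 0) as [->|n].
- rewrite <- Hg, z_over_0, H1 by auto. ring.
- assert (Fz := class_S_neq0 f z Hf Hz n).
  assert (D := cder_mult f (PS b) z _ _ (class_S_deriv f z Hf Hz) (geo_disk_cder b z Hb Hz)).
  assert (Z0 : 0 < Cmod z) by now apply Cmod_gt_0.
  assert (E : (C_derive f z * PS b z + f z * PS (dcoef b) z)%C = 1).
  { apply (cder_unique (fun w => w) z); [|apply cder_id].
    apply (cder_ext_loc (fun w => f w * PS b w)%C _ z _ (Rmin (Cmod z) (1 - Cmod z))); auto.
    - apply Rmin_pos; lra.
    - intros w Hw.
      pose proof (Rlt_le_trans _ _ _ Hw (Rmin_l _ _)) as W1.
      pose proof (Rlt_le_trans _ _ _ Hw (Rmin_r _ _)) as W2.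
      assert (Hw1 : Cmod w < 1) by (pose proof (Cmod_le_sub w z); lra).
      assert (Hw0 : w <> 0).
      { intros K. rewrite K, Cmod_sub_sym in W1. replace (z - 0)%C with z in W1 by ring. lra. }
      rewrite <- Hg, z_over_neq0 by auto. field. now apply class_S_neq0. }
  assert (FG : (f z * PS b z)%C = z) by (rewrite <- Hg, z_over_neq0 by auto; field; auto).
  rewrite Hg by auto.
  transitivity ((C_derive f z * PS b z + f z * PS (dcoef b) z) * PS b z - (f z * PS b z) * PS (dcoef b) z)%C; [ring|].
  rewrite E, FG. ring.
Qed.

Lemma z_over_univ f b : class_S f -> geo_disk b ->
  (forall z, Cmod z < 1 -> z_over f z = PS b z) -> univalent_coef b.
Proof.
intros Hf Hb Hg. assert (Hf' := Hf). destruct Hf' as [[Ha [H0 H1]] Hi].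
assert (D0 : Cmod 0 < 1) by (rewrite Cmod_0; lra).
split; [auto|split; [|split]].
- rewrite <- geo_disk_PS_0, <- Hg, z_over_0; auto.
- intros z w Hz Hw. rewrite <- !Hg by auto.
  destruct (Ceq_dec z 0) as [->|nz].
  + rewrite z_over_0. intros E. replace w with (w * 1)%C by ring. rewrite E. ring.
  + destruct (Ceq_dec w 0) as [->|nw].
    * rewrite z_over_0. intros E. replace z with (z * 1)%C by ring. rewrite <- E. ring.
    * rewrite !z_over_neq0 by auto. intros E. apply Hi; auto.
      assert (Fz := class_S_neq0 f z Hf Hz nz). assert (Fw := class_S_neq0 f w Hf Hw nw).
      replace (f w) with (w * (z / f z) * (f z * f w) / (z * w))%C by (field; auto).
      rewrite E. field. auto.
- intros z Hz. rewrite <- (z_over_deriv_identity f) by auto.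
  assert (N : z_over f z <> 0).
  { destruct (Ceq_dec z 0) as [->|n].
    - rewrite z_over_0. intros E. apply RtoC_inj in E. lra.
    - rewrite z_over_neq0 by auto. unfold Cdiv. apply Cmult_neq_0; auto.
      intros E. assert (Fz := class_S_neq0 f z Hf Hz n).
      assert (X : (f z * / f z)%C = 1) by (field; auto). rewrite E, Cmult_0_r in X.
      apply RtoC_inj in X. lra. }
  apply Cmult_neq_0; [|now apply Cpow_nz].
  apply (injective_derivative_neq0 f (C_derive f)); auto.
  intros v Hv. now apply class_S_deriv.
Qed.

(** On [(0, 1)] the polynomial [p] strictly increases and [q] decreases, so their crossing is unique
    and [p <= q] holds up to it. *)
Lemma smallest_root_exists lam : 0 < lam ->
  exists r0, is_smallest_root_in_01 lam r0 /\
    forall r, 0 < r <= r0 -> r ^ 4 * (r ^ 4 + 4 * r ^ 2 + 1) <= lam ^ 2 * (1 - r ^ 2) ^ 4.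
Proof.
intros Hlam.
set (p := fun r => r ^ 4 * (r ^ 4 + 4 * r ^ 2 + 1)). set (q := fun r => lam ^ 2 * (1 - r ^ 2) ^ 4).
assert (L2 : 0 < lam ^ 2) by now apply pow_lt.
assert (Mp : forall s r, 0 < s < r -> p s < p r).
{ intros s r Hs. unfold p.
  assert (A2 : 0 < s ^ 2 < r ^ 2) by (split; [apply pow_lt; lra|simpl; nra]).
  replace (s ^ 4) with (s ^ 2 * s ^ 2) by ring. replace (r ^ 4) with (r ^ 2 * r ^ 2) by ring.
  assert (A4 : 0 < s ^ 2 * s ^ 2 < r ^ 2 * r ^ 2) by nra.
  apply Rmult_gt_0_lt_compat; lra. }
assert (Mq : forall s r, 0 < s <= r -> r < 1 -> q r <= q s).
{ intros s r Hs Hr. unfold q. apply Rmult_le_compat_l; [lra|]. apply pow_incr. simpl. nra. }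
assert (Hcont : continuity (fun r => p r - q r)).
{ unfold p, q. intros x. apply derivable_continuous_pt. reg. }
destruct (IVT (fun r => p r - q r) 0 1 Hcont) as [r0 [Hr0 Er0]]; [lra|unfold p, q; simpl; simpl in L2; lra|unfold p, q; simpl; lra|].
assert (H0 : r0 <> 0) by (intros ->; unfold p, q in Er0; simpl in Er0; simpl in L2; lra).
assert (H1 : r0 <> 1) by (intros ->; unfold p, q in Er0; simpl in Er0; lra).
exists r0. split; [split|].
- split; [lra|exact Er0].
- intros s [Hs Es]. destruct (Rle_dec r0 s) as [|n]; auto. exfalso.
  pose proof (Mp s r0 ltac:(lra)). pose proof (Mq s r0 ltac:(lra) ltac:(lra)).
  change (p s - q s = 0) in Es. lra.
- intros r Hr. change (p r <= q r). pose proof (Mq r r0 Hr ltac:(lra)).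
  destruct (Req_dec r r0) as [->|n]; [lra|]. pose proof (Mp r r0 ltac:(lra)). lra.
Qed.

Lemma cder_dilate f r z l : cder f (RtoC r * z)%C l -> cder (fun z => f (RtoC r * z)%C) z (RtoC r * l).
Proof.
intros H. apply (cder_comp f (fun z => RtoC r * z)%C); auto.
eapply cder_congr; [|apply cder_scal, cder_id]. ring.
Qed.

Theorem theorem3p1 :
  forall (f : C -> C) (lambda : R),
    class_S f ->
    (0 < lambda <= 1)%R ->
    exists r0 : R,
      is_smallest_root_in_01 lambda r0 /\
      forall r : R, (0 < r <= r0)%R ->
        class_M lambda (fun z : C => (f (RtoC r * z) / RtoC r)%C).
Proof.
intros f lambda Hf Hl. assert (Hf' := Hf). destruct Hf' as [[Ha [H0 H1]] Hi].
destruct (smallest_root_exists lambda ltac:(lra)) as [r0 [Hr0 Hroot]].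
exists r0. split; [exact Hr0|]. intros r Hr.
assert (Hr1 : 0 < r < 1) by (destruct Hr0 as [[? _] _]; lra).
specialize (Hroot r Hr).
destruct (z_over_series f Hf) as [b [Hb Hg]].
assert (Hu := z_over_univ f b Hf Hb Hg).
assert (Rn : RtoC r <> 0) by (intros E; apply RtoC_inj in E; lra).
set (fr := fun z : C => (f (RtoC r * z) / RtoC r)%C).
assert (In : forall z, Cmod z < 1 -> Cmod (RtoC r * z) <= r).
{ intros z Hz. rewrite Cmod_mult, Cmod_R, Rabs_pos_eq by lra. pose proof (Cmod_ge_0 z). nra. }
assert (Dr : forall z, Cmod z < 1 -> cder fr z (C_derive f (RtoC r * z)%C)).
{ intros z Hz. specialize (In z Hz).
  apply (cder_ext_loc (fun z => / RtoC r * f (RtoC r * z)%C)%C _ z _ 1); [lra| |].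
  - intros w _. unfold fr, Cdiv. ring.
  - eapply cder_congr; [|apply cder_scal, cder_dilate, class_S_deriv; [exact Hf|lra]]. field. auto. }
assert (Z : forall z, Cmod z < 1 -> z_over fr z = PS b (RtoC r * z)%C).
{ intros z Hz. specialize (In z Hz). rewrite <- Hg by lra.
  destruct (Ceq_dec z 0) as [->|n].
  - rewrite Cmult_0_r, !z_over_0. reflexivity.
  - assert (n' : (RtoC r * z)%C <> 0) by now apply Cmult_neq_0.
    rewrite !z_over_neq0 by auto. unfold fr. field.
    repeat split; auto; apply class_S_neq0; auto; lra. }
assert (D1 : forall z, Cmod z < 1 -> C_derive (z_over fr) z = (RtoC r * PS (dcoef b) (RtoC r * z))%C).
{ intros z Hz. specialize (In z Hz). apply is_C_derive_unique, is_derive_C_iff.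
  apply (cder_ext_loc (fun z => PS b (RtoC r * z)%C) _ z _ (1 - Cmod z)); [lra| |].
  - intros w Hw. symmetry. apply Z. pose proof (Cmod_le_sub w z). lra.
  - apply cder_dilate, geo_disk_cder; auto. lra. }
(* [D1] holds on a neighbourhood of each point, so the total function [C_derive (z_over fr)] can be
   differentiated again there. *)
assert (D2 : forall z, Cmod z < 1 -> C_derive (C_derive (z_over fr)) z
   = (RtoC r * (RtoC r * PS (dcoef (dcoef b)) (RtoC r * z)))%C).
{ intros z Hz. specialize (In z Hz). apply is_C_derive_unique, is_derive_C_iff.
  apply (cder_ext_loc (fun z => RtoC r * PS (dcoef b) (RtoC r * z))%C _ z _ (1 - Cmod z)); [lra| |].
  - intros w Hw. symmetry. apply D1. pose proof (Cmod_le_sub w z). lra.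
  - apply cder_scal. apply cder_dilate, geo_disk_cder; [now apply geo_disk_dcoef|lra]. }
split; [split; [|split]|split].
- intros z Hz. eexists. apply is_derive_C_iff, Dr, Hz.
- unfold fr. rewrite Cmult_0_r, H0. field. auto.
- apply is_C_derive_unique, is_derive_C_iff.
  eapply cder_congr; [|apply Dr; rewrite Cmod_0; lra]. now rewrite Cmult_0_r, H1.
- intros z Hz Hn E. apply (class_S_neq0 f (RtoC r * z)%C Hf).
  + specialize (In z Hz). lra.
  + now apply Cmult_neq_0.
  + replace (f (RtoC r * z)%C) with (fr z * RtoC r)%C by (unfold fr; field; auto). rewrite E. ring.
- intros z Hz. fold fr. rewrite D2 by exact Hz.
  assert (Hfr : C_derive fr z = C_derive f (RtoC r * z)%C).
  { apply is_C_derive_unique, is_derive_C_iff, Dr, Hz. }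
  rewrite Hfr, (Z z Hz). specialize (In z Hz). rewrite <- Hg by lra.
  rewrite z_over_deriv_identity with (b := b) by (auto; lra).
  set (u := (RtoC r * z)%C) in *.
  (* The factor [r^2] from differentiating twice merges with [z^2]: the expression becomes the one
     for [f] at [u = r z], where [Cmod u <= r]. *)
  replace (z ^ 2 * (RtoC r * (RtoC r * PS (dcoef (dcoef b)) u)))%C
    with (u ^ 2 * PS (dcoef (dcoef b)) u)%C by (unfold u; ring).
  apply second_order_bound with r; auto. lra.
Qed.
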